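(* Let $\theta_0\in\mathbb{R}^p$ and let $(\hat\theta_n)_{n\ge1}$ be random vectors in $\mathbb{R}^p$ such that for every $n$ $$\hat\theta_n-\theta_0=\Sigma_0^{1/2}\,\frac1n\sum_{i=1}^nZ_i+R_n,$$ where $Z_1,Z_2,\ldots$ are i.i.d. random vectors with mean zero and the $p\times p$ identity matrix as covariance matrix, $\Sigma_0$ is a $p\times p$ covariance matrix, and $\sqrt m\,\sup_{n\ge m}\|R_n\|\to0$ in probability as $m\to\infty$. For $\varepsilon>0$ let $Q_\varepsilon$ be the total number of $n\ge1$ for which $\|\hat\theta_n-\theta_0\|\ge\varepsilon$. Then, as $\varepsilon\to0$, $$\varepsilon^2Q_\varepsilon\to_d Q=\mu\bigl\{t\ge0:\|\Sigma_0^{1/2}W(t)/t\|\ge1\bigr\},$$ where $W(t)=(W_1(t),\ldots,W_p(t))'$ is a vector of $p$ independent standard Brownian motions and $\mu$ is Lebesgue measure on $[0,\infty)$. If moreover the distance is $\|x-y\|=\{(x-y)'A(x-y)\}^{1/2}$ with $A$ a symmetric positive definite $p\times p$ matrix, then $EQ=\operatorname{Tr}(A\Sigma_0)$.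
   Context: $\to_d$ denotes convergence in distribution. The distance function $\|\cdot\|$ is a given function on $\mathbb{R}^p$ with the properties: $\|x+y\|\le\|x\|+\|y\|$; $\|x\|=0$ if and only if $x=0$; $\|x_n\|\to\|x\|$ when $x_n\to x$; $\|ax\|=|a|\,\|x\|$ for scalars $a$; and $\|(x_1,\ldots,x_p)'\|\le c\sum_{i=1}^p|x_i|$ for some constant $c$. $\Sigma_0^{1/2}$ is the symmetric nonnegative definite square root of $\Sigma_0$. *)

(* Defs.v *)
From HB Require Import structures.
From mathcomp Require Import all_boot all_order all_algebra finmap.
From mathcomp Require Import all_classical all_reals all_analysis.
From mathcomp Require Import measurable_realfun.

Set Implicit Arguments.
Unset Strict Implicit.
Unset Printing Implicit Defensive.

Import Order.TTheory GRing.Theory Num.Theory.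
Import numFieldNormedType.Exports.

Local Open Scope classical_set_scope.
Local Open Scope ring_scope.

(* R^p with its Borel sigma-algebra. *)
Notation borelV R p := (g_sigma_algebraType (@open 'cV[R]_p)) (only parsing).

Definition coordinate (R : realType) (p : nat) (T : Type)
    (X : T -> 'cV[R]_p) (j : 'I_p) : T -> R := fun w => X w j 0.

(* Only sequential continuity is required of a distance; nonnegativity
   follows from the triangle inequality and homogeneity. *)
Record is_distance (R : realType) (p : nat) (dist : 'cV[R]_p -> R) : Prop :=
  IsDistance {
    dist_triangle : forall x y, dist (x + y) <= dist x + dist y ;
    dist_eq0 : forall x, dist x = 0 <-> x = 0 ;
    dist_cvg : forall (u : nat -> 'cV[R]_p) (x : 'cV[R]_p),
      u @ \oo --> x -> dist (u n) @[n --> \oo] --> dist x ;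
    dist_scale : forall (a : R) x, dist (a *: x) = `|a| * dist x ;
    dist_bound : exists c : R, forall x, dist x <= c * \sum_(i < p) `|x i 0|
  }.

Definition quadform (R : realType) (p : nat) (A : 'M[R]_p) (x : 'cV[R]_p) : R :=
  (x^T *m A *m x) 0 0.

Definition symm_nonneg_def (R : realType) (p : nat) (A : 'M[R]_p) : Prop :=
  A \is symmetricmx /\ forall x : 'cV[R]_p, 0 <= quadform A x.

Definition symm_pos_def (R : realType) (p : nat) (A : 'M[R]_p) : Prop :=
  A \is symmetricmx /\ forall x : 'cV[R]_p, x != 0 -> 0 < quadform A x.

(* S = Sigma^{1/2}; such an S is unique. *)
Definition is_symm_sqrt (R : realType) (p : nat) (S Sigma : 'M[R]_p) : Prop :=
  symm_nonneg_def S /\ S *m S = Sigma.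

(* Mutual independence of the classes of events F i: product rule over every
   finite subfamily. *)
Definition independent_classes d (T : measurableType d) (R : realType)
    (P : probability T R) (I : choiceType) (F : I -> set_system T) : Prop :=
  forall (J : {fset I}) (A : I -> set T),
    (forall i, i \in J -> F i (A i)) ->
    P (\bigcap_(i in [set` J]) A i) = (\prod_(i <- J) P (A i))%E.

Definition independent_RVs d (T : measurableType d) (R : realType)
    (P : probability T R) (I : choiceType) d' (E : measurableType d')
    (X : I -> T -> E) : Prop :=
  independent_classes P (fun i => g_sigma_algebra_preimage (X i)).

Record iid d (T : measurableType d) (R : realType) (P : probability T R)
    d' (E : measurableType d') (X : nat -> T -> E) : Prop := Iid {
  iid_measurable : forall i, measurable_fun setT (X i) ;
  iid_independent : independent_RVs P X ;
  iid_identical : forall i j (B : set E), measurable B ->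
    P (X i @^-1` B) = P (X j @^-1` B)
}.

(* Square-integrable coordinates, mean zero, identity covariance matrix. *)
Definition standardized d (T : measurableType d) (R : realType)
    (P : probability T R) (p : nat) (Z : T -> 'cV[R]_p) : Prop :=
  [/\ forall j, coordinate Z j \in Lfun P 2%:E,
      forall j, ('E_P[coordinate Z j] = 0)%E
    & forall j k, covariance P (coordinate Z j) (coordinate Z k)
                  = ((1%:M : 'M[R]_p) j k)%:E].

Definition cvg_in_probability0 d (T : measurableType d) (R : realType)
    (P : probability T R) (Y : nat -> T -> \bar R) : Prop :=
  forall delta : R, 0 < delta ->
    P [set w | (delta%:E <= `|Y m w|)%E] @[m --> \oo] --> 0%E.

(* X_ i ->_d X along F, for [-oo, +oo]-valued random variables, possibly on
   different probability spaces: convergence of the distribution functions at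
   every continuity point of the limit one.  The limit must be almost surely
   finite, so that no mass escapes to infinity. *)
Definition cvg_in_distribution (R : realType)
    d (T : measurableType d) (P : probability T R)
    d' (T' : measurableType d') (P' : probability T' R)
    (I : Type) (F : set_system I)
    (X_ : I -> T -> \bar R) (X : T' -> \bar R) : Prop :=
  [/\ \forall i \near F, measurable_fun setT (X_ i),
      measurable_fun setT X,
      {ae P', forall w, X w \is a fin_num}
    & forall x : R,
      {for x, continuous (fun y : R => P' [set w | (X w <= y%:E)%E])} ->
      P [set w | (X_ i w <= x%:E)%E] @[i --> F]
        --> P' [set w | (X w <= x%:E)%E] ].

(* The time set is [0, +oo[; values at negative times are irrelevant. *)
Record standard_BM d (T : measurableType d) (R : realType)
    (P : probability T R) (B : R -> T -> R) : Prop := StandardBM {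
  BM_measurable : forall t, 0 <= t -> measurable_fun setT (B t) ;
  BM_start : {ae P, forall w, B 0 w = 0} ;
  BM_independent_increments : forall t : nat -> R,
    0 <= t 0%N -> nondecreasing_seq t ->
    independent_RVs P (fun i : nat => (fun w => B (t i.+1) w - B (t i) w)) ;
  BM_gaussian_increments : forall s t, 0 <= s -> s < t ->
    forall A : set R, measurable A ->
    P ((fun w => B t w - B s w) @^-1` A) = normal_prob 0 (Num.sqrt (t - s)) A ;
  BM_continuous : forall w, {within `[0, +oo[, continuous (fun t => B t w)}
}.

(* The independence is that of the coordinate processes, i.e. of the
   sigma-algebras they generate. *)
Record standard_BM_vector d (T : measurableType d) (R : realType)
    (P : probability T R) (p : nat) (W : R -> T -> 'cV[R]_p) : Prop :=
  StandardBMVector {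
    BMV_coord : forall j, standard_BM P (fun t => coordinate (W t) j) ;
    BMV_independent : independent_classes P (fun j : 'I_p =>
      <<s \bigcup_(t in `[0, +oo[)
            g_sigma_algebra_preimage (coordinate (W t) j) >>)
  }.

Definition Qcount (R : realType) (p : nat) (dist : 'cV[R]_p -> R) (T : Type)
    (theta : nat -> T -> 'cV[R]_p) (theta0 : 'cV[R]_p) (eps : R) (w : T)
    : \bar R :=
  counting [set n : nat | (1 <= n)%N /\ eps <= dist (theta n w - theta0)].

(* At t = 0 the convention 0^-1 = 0 excludes t; a single point is
   Lebesgue-null. *)
Definition Qlimit (R : realType) (p : nat) (dist : 'cV[R]_p -> R) (T : Type)
    (S : 'M[R]_p) (W : R -> T -> 'cV[R]_p) (w : T) : \bar R :=
  lebesgue_measure [set t : R | 0 <= t /\ 1 <= dist (t^-1 *: (S *m W t w))].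

(* Main.v *)
Require Import Defs.
From HB Require Import structures.
From mathcomp Require Import all_boot all_order all_algebra finmap.
From mathcomp Require Import all_classical all_reals all_analysis.
From mathcomp Require Import measurable_realfun ring lra.

Set Implicit Arguments.
Unset Strict Implicit.
Unset Printing Implicit Defensive.

Import Order.TTheory GRing.Theory Num.Theory.
Import numFieldNormedType.Exports.

Local Open Scope classical_set_scope.
Local Open Scope ring_scope.

                                             

(** Put [D x = dist (S *m x)] and let [walk n] be the partial sums of the [Z i]. Off a small event
    the remainder hypothesis makes [dist (theta n - theta0) / e] close to [D (walk n / (e n))],
    uniformly in [n >= a / e^2]. With [n = t / e^2], [e walk n] behaves like [W t], so [e^2 Q_e],
    which puts mass [e^2] on each exceeding index, should converge to the time that [D (W t / t)]
    spends in [[1, +oo[].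

    On a compact window [[a, b[] ([late_count_cvg]) the indicator is replaced by a Lipschitz ramp
    [f] and the law is tested on Lipschitz [g]. The sum is compared in mean with a finite sum over a
    grid of times, a Lipschitz function of finitely many walk positions; second moments of walk
    increments bound the error ([late_count_discretized]). The grid sum converges by the
    finite-dimensional central limit theorem ([walk_fdd_cvg]), and refining the grid gives an
    integral along the continuous Brownian path. The central limit theorem is proved with phased
    cosines: [Ex_cos_fsum] multiplies the contributions of independent summands, a Taylor estimate
    in the manner of Lindeberg handles each summand, and [levy_continuity] passes from cosines to
    Lipschitz functions by approximation with trigonometric polynomials (Bernstein polynomials in
    sines).

    The window then exhausts all times. Indices before [a / e^2] weigh at most about [a]. Those
    after [b / e^2] are controlled by [walk_excess_tail], a Chebyshev bound over blocks delimited by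
    squares, uniform in [e <= 1]. Ramps below and above the indicator of [[1, +oo[] sandwich the
    distribution function of [e^2 Q_e] ([exceedance_time_upper], [exceedance_time_lower]). The two
    bounds meet because [D (W t / t)] spends no time at the level 1: by Tonelli and the scaling
    [W t / t ~ W 1 / sqrt t], the expected times in [[c, +oo[] and in []c, +oo[] are both
    [E (D (W 1))^2 / c^2], which is finite, so the two times agree almost surely
    ([occupation_gt_ge]).

    The same formula with [c = 1] gives [E Q = E (D (W 1))^2]; for the quadratic distance this is
    [tr (S A S) = tr (A Sigma0)]. *)

(** * Real-valued expectations and integrability under a probability *)

Section Expectation.
Context d (T : measurableType d) (R : realType) (P : probability T R).
Implicit Types f g X Y : T -> R.

Definition L1 f : Prop := P.-integrable setT (EFin \o f).

Definition Ex f : R := Rintegral P setT f.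

Definition Pr (A : set T) : R := fine (P A).

Lemma L1_measurable f : L1 f -> measurable_fun setT f.
Proof. by move=> /integrableP[/measurable_EFinP]. Qed.

Lemma L1_bounded f (M : R) :
  measurable_fun setT f -> (forall w, `|f w| <= M) -> L1 f.
Proof.
move=> mf fM; apply: measurable_bounded_integrable => //.
  by rewrite (le_lt_trans (probability_le1 _ _))// ltry.
exists M; split; first exact: num_real.
by move=> x Mx w _ /=; rewrite (le_trans (fM w))// ltW.
Qed.

Lemma L1_le f g : measurable_fun setT f -> L1 g ->
  (forall w, `|f w| <= g w) -> L1 f.
Proof.
move=> mf Lg fg; apply: (le_integrable measurableT _ _ Lg).
  exact/measurable_EFinP.
by move=> w _ /=; rewrite lee_fin (le_trans (fg w))// ler_norm.
Qed.

Lemma L1_cst (c : R) : L1 (cst c).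
Proof. by apply: (@L1_bounded _ `|c|). Qed.

Lemma L1D f g : L1 f -> L1 g -> L1 (fun w => f w + g w).
Proof. by move=> Lf Lg; exact: (integrableD measurableT Lf Lg). Qed.

Lemma L1B f g : L1 f -> L1 g -> L1 (fun w => f w - g w).
Proof. by move=> Lf Lg; exact: (integrableB measurableT Lf Lg). Qed.

Lemma L1Z (c : R) f : L1 f -> L1 (fun w => c * f w).
Proof. by move=> Lf; exact: (integrableZl measurableT c Lf). Qed.

Lemma L1_abs f : L1 f -> L1 (fun w => `|f w|).
Proof. by move=> Lf; exact: integrable_norm. Qed.

Lemma L1_sum (I : Type) (s : seq I) (F : I -> T -> R) :
  (forall i, L1 (F i)) -> L1 (fun w => \sum_(i <- s) F i w).
Proof.
move=> LF; elim: s => [|i s IH].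
  rewrite (_ : (fun _ => _) = cst 0); first exact: L1_cst.
  by apply/funext => w; rewrite big_nil.
rewrite (_ : (fun _ => _) = (fun w => F i w + \sum_(j <- s) F j w)).
  exact: L1D.
by apply/funext => w; rewrite big_cons.
Qed.

Lemma L1_ext f g : f =1 g -> L1 f -> L1 g.
Proof. by move=> /funext ->. Qed.

Lemma Ex_EFin f : L1 f -> (\int[P]_w (f w)%:E = (Ex f)%:E)%E.
Proof. by move=> Lf; rewrite /Ex /Rintegral fineK//; exact: integrable_fin_num. Qed.

Lemma eq_Ex f g : f =1 g -> Ex f = Ex g.
Proof. by move=> /funext ->. Qed.

Lemma Ex_cst (c : R) : Ex (fun=> c) = c.
Proof.
rewrite /Ex Rintegral_cst//.
by rewrite -[RHS]mulr1; congr (c * _); rewrite -[RHS]/(fine 1%E); congr fine; exact: probability_setT.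
Qed.

Lemma ExD f g : L1 f -> L1 g -> Ex (fun w => f w + g w) = Ex f + Ex g.
Proof. by move=> Lf Lg; exact: RintegralD. Qed.

Lemma ExB f g : L1 f -> L1 g -> Ex (fun w => f w - g w) = Ex f - Ex g.
Proof. by move=> Lf Lg; exact: RintegralB. Qed.

Lemma ExZ (c : R) f : L1 f -> Ex (fun w => c * f w) = c * Ex f.
Proof. by move=> Lf; exact: RintegralZl. Qed.

Lemma Ex_sum (I : Type) (s : seq I) (F : I -> T -> R) :
  (forall i, L1 (F i)) -> Ex (fun w => \sum_(i <- s) F i w) = \sum_(i <- s) Ex (F i).
Proof.
move=> LF; elim: s => [|i s IH].
  by rewrite big_nil -[RHS](Ex_cst 0); apply: eq_Ex => w; rewrite big_nil.
rewrite big_cons -IH -ExD//; last exact: L1_sum.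
by apply: eq_Ex => w; rewrite big_cons.
Qed.

Lemma le_Ex f g : L1 f -> L1 g -> (forall w, f w <= g w) -> Ex f <= Ex g.
Proof. by move=> Lf Lg fg; exact: le_Rintegral. Qed.

Lemma Ex_ge0 f : (forall w, 0 <= f w) -> 0 <= Ex f.
Proof. by move=> f0; exact: Rintegral_ge0. Qed.

Lemma normEx f : L1 f -> `|Ex f| <= Ex (fun w => `|f w|).
Proof. by move=> Lf; exact: le_normr_Rintegral. Qed.

Lemma normEx_le f g : L1 f -> L1 g -> (forall w, `|f w| <= g w) ->
  `|Ex f| <= Ex g.
Proof.
by move=> Lf Lg fg; apply: le_trans (normEx Lf) _; apply: le_Ex => //; exact: L1_abs.
Qed.

Lemma normEx_bounded f (M : R) : measurable_fun setT f ->
  (forall w, `|f w| <= M) -> `|Ex f| <= M.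
Proof.
move=> mf fM; rewrite -[leRHS]Ex_cst; apply: normEx_le => //.
  exact: L1_bounded fM.
exact: L1_cst.
Qed.

Lemma L1_indic (A : set T) : measurable A -> L1 \1_A.
Proof.
move=> mA; apply: (@L1_bounded _ 1); first exact: measurable_indic.
by move=> w; rewrite indicE ger0_norm// lern1 leq_b1.
Qed.

Lemma Ex_indic (A : set T) : measurable A -> Ex \1_A = Pr A.
Proof.
by move=> mA; rewrite /Ex /Rintegral integral_indic// setIT.
Qed.

Lemma PrE (A : set T) : measurable A -> P A = (Pr A)%:E.
Proof. by move=> mA; rewrite /Pr fineK// fin_num_measure. Qed.

Lemma le_Pr (A B : set T) : measurable A -> measurable B ->
  A `<=` B -> Pr A <= Pr B.
Proof.
by move=> mA mB AB; rewrite -lee_fin -!PrE//; apply: le_measure; rewrite ?inE.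
Qed.

Lemma measurable_le_cst f (c : R) : measurable_fun setT f ->
  measurable [set w | c <= f w].
Proof.
move=> mf; have := mf measurableT _ (measurable_itv `[c, +oo[).
by rewrite setTI; congr measurable; apply/seteqP; split => w /=; rewrite in_itv/= andbT.
Qed.

Lemma markov_ineq f (c : R) : L1 f -> (forall w, 0 <= f w) -> 0 < c ->
  Pr [set w | c <= f w] <= Ex f / c.
Proof.
move=> Lf f0 c0.
have mA := measurable_le_cst c (L1_measurable Lf).
rewrite ler_pdivlMr// mulrC -Ex_indic// -ExZ; last exact: L1_indic.
apply: le_Ex => //; first exact/L1Z/L1_indic.
move=> w; rewrite indicE; have [/set_mem/= wA|] := boolP (w \in _).
  by rewrite mulr1.
by rewrite mulr0.
Qed.

(** Integrate [|x| <= x^2 / (2 s) + s / 2], which is an equality at [|x| = s]. *)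
Lemma Ex_norm_le X (s : R) : measurable_fun setT X ->
  L1 (fun w => X w ^+ 2) -> 0 < s -> Ex (fun w => X w ^+ 2) <= s ^+ 2 ->
  Ex (fun w => `|X w|) <= s.
Proof.
move=> mX LX s0 Xs.
have amgm w : `|X w| <= s^-1 / 2 * X w ^+ 2 + s / 2.
  have : 0 <= (`|X w| - s) ^+ 2 by exact: sqr_ge0.
  rewrite sqrrB real_normK ?num_real// => h.
  rewrite -(ler_pM2l s0) mulrDr !mulrA divff ?gt_eqF// mul1r.
  lra.
have L2' : L1 (fun w => s^-1 / 2 * X w ^+ 2 + s / 2).
  by apply: L1D; [exact: L1Z|exact: L1_cst].
apply: (le_trans (le_Ex _ L2' amgm)).
  by apply: (L1_le _ L2'); [exact: measurableT_comp|move=> w; rewrite normr_id].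
rewrite (ExD (L1Z _ LX) (L1_cst _)) ExZ// Ex_cst.
rewrite [leRHS](_ : s = s^-1 / 2 * s ^+ 2 + s / 2); last by field; rewrite gt_eqF.
by rewrite lerD2r ler_wpM2l// divr_ge0// invr_ge0 ltW.
Qed.

Lemma L1_of_sq X : measurable_fun setT X -> L1 (fun w => X w ^+ 2) -> L1 X.
Proof.
move=> mX LX; apply: (@L1_le _ (fun w => 1 + X w ^+ 2)) => //.
  by apply: L1D => //; exact: L1_cst.
move=> w; have : 0 <= (`|X w| - 1) ^+ 2 by exact: sqr_ge0.
have := normr_ge0 (X w).
rewrite sqrrB real_normK ?num_real//; lra.
Qed.

Lemma L1_mul_sq X Y : measurable_fun setT X -> measurable_fun setT Y ->
  L1 (fun w => X w ^+ 2) -> L1 (fun w => Y w ^+ 2) -> L1 (fun w => X w * Y w).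
Proof.
move=> mX mY LX LY; apply: (@L1_le _ (fun w => X w ^+ 2 + Y w ^+ 2)).
- exact: measurable_funM.
- exact: L1D.
- move=> w; have : 0 <= (`|X w| - `|Y w|) ^+ 2 by exact: sqr_ge0.
  rewrite sqrrB !real_normK ?num_real// normrM.
  have := mulr_ge0 (normr_ge0 (X w)) (normr_ge0 (Y w)); lra.
Qed.

End Expectation.

(** * Independence: product formula for expectations and partial sums *)

Section Independence.
Context d (T : measurableType d) (R : realType) (P : probability T R).
Implicit Types X Y : T -> R.

Definition indep2 X Y : Prop := forall A B : set R, measurable A -> measurable B ->
  P (X @^-1` A `&` Y @^-1` B) = (P (X @^-1` A) * P (Y @^-1` B))%E.

Lemma measurable_preimage X (A : set R) : measurable_fun setT X ->
  measurable A -> measurable (X @^-1` A).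
Proof. by move=> mX mA; rewrite -[X in measurable X]setTI; exact: mX. Qed.

(** Rectangles form a pi-system generating the product sigma-algebra. The measures are kept general
    because the lemma is applied to a restricted and to a rescaled probability. *)
Lemma rectangle_unique (m1 m2 : {measure set (R * R) -> \bar R}) :
  (m1 setT < +oo)%E ->
  (forall A B, measurable A -> measurable B -> m1 (A `*` B) = m2 (A `*` B)) ->
  forall C, measurable C -> m1 C = m2 C.
Proof.
move=> fm m12 C mC.
pose G : set (set (R * R)) :=
  [set C | exists A, measurable A /\ exists B, measurable B /\ C = A `*` B].
apply: (measure_unique G (fun=> setT)) => //.
- rewrite measurable_prod_measurableType //; congr (<<s _ >>).
  rewrite predeqE; split => [[A mA [B mB <-]]|[A [mA [B [mB ->]]]]].
    by exists A; split => //; exists B.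
  by exists A => //; exists B.
- move=> /= _ _ [X1 [mX1 [X2 [mX2 ->]]]] [Y1 [mY1 [Y2 [mY2 ->]]]].
  rewrite -setXI; exists (X1 `&` Y1); split; first exact: measurableI.
  by exists (X2 `&` Y2); split => //; exact: measurableI.
- by move=> _; exists setT; split => //; exists setT; split => //; rewrite setXTT.
- by rewrite bigcup_const.
- by move=> _ [A [mA [B [mB ->]]]]; exact: m12.
Qed.

Lemma indep2_comp X Y (f g : R -> R) : measurable_fun setT f ->
  measurable_fun setT g -> indep2 X Y -> indep2 (f \o X) (g \o Y).
Proof.
move=> mf mg XY A B mA mB.
apply: (XY (f @^-1` A) (g @^-1` B)); rewrite -[X in measurable X]setTI.
  exact: mf.
exact: mg.
Qed.

(** The joint law of the pair is the product of the marginal laws, since they agree on rectangles;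
    Fubini then factors the integral of the product. *)
Lemma indep2_ExM X Y : measurable_fun setT X -> measurable_fun setT Y ->
  indep2 X Y -> L1 P X -> L1 P Y ->
  L1 P (fun w => X w * Y w) /\ Ex P (fun w => X w * Y w) = Ex P X * Ex P Y.
Proof.
move=> mX mY XY LX LY.
pose X' : {mfun T >-> R} := HB.pack X (isMeasurableFun.Build _ _ _ _ X mX).
pose Y' : {mfun T >-> R} := HB.pack Y (isMeasurableFun.Build _ _ _ _ Y mY).
have mXY : measurable_fun setT (fun w => (X w, Y w)) by exact: measurable_fun_pair.
pose XY' : {mfun T >-> (R * R)%type} := HB.pack (fun w => (X w, Y w))
  (isMeasurableFun.Build _ _ _ _ (fun w => (X w, Y w)) mXY).
pose m := (distribution P X' \x distribution P Y')%E.
have lawE C : measurable C -> m C = distribution P XY' C.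
  apply: product_measure_unique => A B mA mB.
  by rewrite /distribution/= /pushforward/= -XY.
have mM : measurable_fun setT (fun z : R * R => (z.1 * z.2)%:E).
  by apply/measurable_EFinP; apply: measurable_funM.
have iX (Z : {mfun T >-> R}) : L1 P Z ->
    (distribution P Z).-integrable setT (EFin : R -> \bar R).
  by move=> LZ; apply: integrable_pushforward => //.
have ExE (Z : {mfun T >-> R}) : L1 P Z ->
    (\int[distribution P Z]_x x%:E = (Ex P Z)%:E)%E.
  by move=> LZ; rewrite -Ex_EFin// /distribution integral_pushforward.
have inner x : (\int[distribution P Y']_y (x * y)%:E = x%:E * (Ex P Y)%:E)%E.
  rewrite -(ExE Y' LY) -integralZl//; last exact: iX.
have im : m.-integrable setT (fun z => (z.1 * z.2)%:E).
  apply/integrable12ltyP => //.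
  have [_ Xfin] := integrableP _ _ _ (iX X' LX).
  have [_ Yfin] := integrableP _ _ _ (iX Y' LY).
  have mabs : measurable_fun [set: R] (fun y : R => `|y|%:E).
    by apply/measurable_EFinP; exact: normr_measurable.
  have inner2 x : (\int[distribution P Y']_y `|(x * y)%:E| =
      `|x|%:E * \int[distribution P Y']_y `|y%:E|)%E.
    rewrite -ge0_integralZl//.
    by apply: eq_integral => y _; rewrite /= normrM.
  under eq_integral do rewrite inner2.
  have Yn : (0 <= \int[distribution P Y']_y `|y%:E|)%E by exact: integral_ge0.
  rewrite ge0_integralZr//.
  by rewrite lte_mul_pinfty// ?integral_ge0// ge0_fin_numE// integral_ge0.
have lawint : (\int[m]_z (z.1 * z.2)%:E = \int[distribution P XY']_z (z.1 * z.2)%:E)%E.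
  by apply: eq_measure_integral => C mC _; exact: lawE.
have LXY : L1 P (fun w => X w * Y w).
  have [_ fin] := integrableP _ _ _ im.
  apply/integrableP; split.
    by apply/measurable_EFinP; exact: measurable_funM.
  move: fin; rewrite (_ : (\int[m]_x _)%E = \int[distribution P XY']_z `|(z.1 * z.2)%:E|)%E; last first.
    by apply: eq_measure_integral => C mC _; exact: lawE.
  by rewrite ge0_integral_pushforward//; apply: measurableT_comp => //.
split => //; apply: EFin_inj; rewrite EFinM -!Ex_EFin//.
transitivity (\int[m]_z (z.1 * z.2)%:E)%E.
  by rewrite lawint integral_pushforward.
rewrite -integral12_prod_meas1// /fubini_F/=.
under eq_integral do rewrite inner.
rewrite integralZr//; last exact: iX.
by rewrite (ExE X' LX) Ex_EFin// Ex_EFin.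
Qed.

Lemma independent_classes_seq (I : choiceType) (F : I -> set_system T) (s : seq I)
    (A : I -> set T) : independent_classes P F -> uniq s ->
  (forall i, i \in s -> F i (A i)) ->
  P (\big[setI/setT]_(i <- s) A i) = (\prod_(i <- s) P (A i))%E.
Proof.
move=> iF us FA; have pJ : perm_eq [fset i in s]%fset s.
  by apply: uniq_perm => // i; rewrite !inE.
rewrite -bigcap_seq -(perm_big _ pJ)/= -iF.
  have -> // : [set` [fset i in s]%fset] = [set` s].
  by apply/seteqP; split => i /=; rewrite !inE.
by move=> i; rewrite !inE; exact: FA.
Qed.

Definition fsum (I : choiceType) (X : I -> T -> R) (s : seq I) : T -> R :=
  fun w => \sum_(j <- s) X j w.

(** With [D := setT] this is the product rule for the [X j] themselves. A general [D] is what lets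
    the induction of [indep_event_fsum] absorb one variable into the event. *)
Definition indep_event (I : choiceType) (X : I -> T -> R) (s : seq I) (D : set T) :=
  forall A : I -> set R, (forall j, measurable (A j)) ->
    P (\big[setI/setT]_(j <- s) (X j @^-1` A j) `&` D) =
    (\prod_(j <- s) P (X j @^-1` A j) * P D)%E.

                                                                                                          
(** Induction on the list. The law of the pair ([X i], sum over [s]) restricted to [D] equals [P D]
    times its unrestricted law: on a rectangle this is the induction hypothesis for the events [X i]
    in [U] with and without [D], and rectangles determine finite measures. The preimage of [B] under
    addition is then one particular planar set. *)
Lemma indep_event_fsum (I : choiceType) (X : I -> T -> R) (s : seq I) :
  (forall i, measurable_fun setT (X i)) -> uniq s -> indep_event X s setT ->
  forall D, measurable D -> indep_event X s D -> forall B, measurable B ->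
  P (fsum X s @^-1` B `&` D) = (P (fsum X s @^-1` B) * P D)%E.
Proof.
move=> mX; elim: s => [_ _ D mD _ B mB|i s IH /= /andP[si us] fT D mD fD B mB].
  rewrite (_ : fsum X [::] = cst 0); last by apply/funext => w; rewrite /fsum big_nil.
  rewrite preimage_cst; case: ifPn => _.
    by rewrite setTI probability_setT mul1e.
  by rewrite set0I measure0 mul0e.
have mXA j (A : set R) : measurable A -> measurable (X j @^-1` A).
  exact: measurable_preimage.
have mS : measurable_fun setT (fsum X s) by exact: measurable_sum.
pose g w := (X i w, fsum X s w).
have mg : measurable_fun setT g by exact: measurable_fun_pair.
pose upd (A : I -> set R) C j := if j == i then C else A j.
have updP A C E : (\big[setI/setT]_(j <- i :: s) (X j @^-1` upd A C j) `&` E =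
    \big[setI/setT]_(j <- s) (X j @^-1` A j) `&` (X i @^-1` C `&` E))%classic.
  rewrite big_cons {1}/upd eqxx setIA [X in X `&` E]setIC; congr (_ `&` _ `&` _).
  apply: eq_big_seq => j js; rewrite /upd; case: eqP => // ji.
  by rewrite -ji js in si.
have updM A C : (\prod_(j <- i :: s) P (X j @^-1` upd A C j) =
    P (X i @^-1` C) * \prod_(j <- s) P (X j @^-1` A j))%E.
  rewrite big_cons {1}/upd eqxx; congr (_ * _)%E.
  apply: eq_big_seq => j js; rewrite /upd; case: eqP => // ji.
  by rewrite -ji js in si.
have mupd A C : (forall j, measurable (A j)) -> measurable C ->
    forall j, measurable (upd A C j).
  by move=> mA mC j; rewrite /upd; case: ifP.
have fam_tail E : indep_event X (i :: s) E -> forall C, measurable C ->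
    P (X i @^-1` C `&` E) = (P (X i @^-1` C) * P E)%E /\
    indep_event X s (X i @^-1` C `&` E).
  move=> fE C mC.
  have e1 : P (X i @^-1` C `&` E) = (P (X i @^-1` C) * P E)%E.
    have := fE (upd (fun=> setT) C) (mupd _ _ (fun=> measurableT) mC).
    rewrite updP updM big1 ?setTI => [->|j _]; last by rewrite preimage_setT.
    by rewrite big1 ?mule1// => j _; rewrite preimage_setT probability_setT.
  split=> // A mA; rewrite e1.
  by rewrite -updP fE ?updM; [rewrite muleAC muleA muleC muleA|exact: mupd].
have fsT : indep_event X s setT.
  move=> A mA; have [_ /(_ A mA)] := fam_tail _ fT _ measurableT.
  by rewrite preimage_setT !setTI.
have rectE C : measurable C -> P (g @^-1` C `&` D) = (P D * P (g @^-1` C))%E.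
  move=> mC.
  have D0 : 0 <= fine (P D) by exact: fine_ge0.
  pose m0 := [the {measure set T -> \bar R} of mrestr P mD].
  pose m1' := [the {measure set (R * R) -> \bar R} of pushforward m0 g].
  pose m1 := m1' mg.
  pose pg' := [the {measure set (R * R) -> \bar R} of pushforward P g].
  pose pg := pg' mg.
  pose m2 := [the {measure set (R * R) -> \bar R} of mscale (NngNum D0) pg].
  have PD : (fine (P D))%:E = P D by rewrite fineK// fin_num_measure.
  rewrite -PD; apply: (@rectangle_unique m1 m2) => //.
    by rewrite /m1/= /pushforward/= preimage_setT /mrestr setTI (le_lt_trans (probability_le1 _ _))// ltry.
  move=> U V mU mV; rewrite /m1 /m2 /= /pushforward /mrestr /= /mscale/= PD.
  have -> : g @^-1` (U `*` V) = fsum X s @^-1` V `&` X i @^-1` U.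
    by rewrite setIC.
  have [e1 f1] := fam_tail _ fD _ mU.
  have [e2 f2] := fam_tail _ fT _ mU.
  move: e2 f2; rewrite !setIT => e2 f2.
  (* The event attached to the shorter sum is now [X i] in [U] intersected with [D]; the same is
     done below without [D]. *)
  rewrite -setIA IH//; last exact: measurableI (mXA _ _ mU) mD.
  have -> : pushforward P g (U `*` V) = P (fsum X s @^-1` V `&` X i @^-1` U).
    by rewrite setIC.
  rewrite IH//; last exact: mXA.
  by rewrite e1 muleA muleC.
have -> : fsum X (i :: s) @^-1` B = g @^-1` ((fun z => z.1 + z.2) @^-1` B).
  by apply/seteqP; split => w /=; rewrite /fsum big_cons.
rewrite rectE 1?muleC//.
rewrite -[X in measurable X]setTI; apply: measurable_funD => //.
Qed.

Lemma independent_RVs_event (I : choiceType) (X : I -> T -> R) (s : seq I) :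
  independent_RVs P X -> uniq s -> indep_event X s setT.
Proof.
move=> iX us A mA; rewrite setIT probability_setT mule1.
apply: (independent_classes_seq iX us) => i _.
by exists (A i) => //; rewrite setTI.
Qed.

Lemma indep2_fsum (I : choiceType) (X : I -> T -> R) (s : seq I) (i : I) :
  (forall j, measurable_fun setT (X j)) -> independent_RVs P X ->
  uniq (i :: s) -> indep2 (fsum X s) (X i).
Proof.
move=> mX iX /[dup] uis /= /andP[si us] A B mA mB.
apply: indep_event_fsum => //.
- exact: independent_RVs_event.
- exact: measurable_preimage.
- move=> C mC; pose C' j := if j == i then B else C j.
  have E : (\big[setI/setT]_(j <- i :: s) (X j @^-1` C' j) =
      \big[setI/setT]_(j <- s) (X j @^-1` C j) `&` X i @^-1` B)%classic.
    rewrite big_cons {1}/C' eqxx setIC; congr (_ `&` _).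
    apply: eq_big_seq => j js; rewrite /C'; case: eqP => // ji.
    by rewrite -ji js in si.
  have := independent_RVs_event iX uis (A := C').
  rewrite setIT probability_setT mule1 E => ->; last first.
    by move=> j; rewrite /C'; case: ifP.
  rewrite big_cons {1}/C' eqxx muleC; congr (_ * _)%E.
  apply: eq_big_seq => j js; rewrite /C'; case: eqP => // ji.
  by rewrite -ji js in si.
Qed.

End Independence.

                                                               

(** * Taylor bounds for sine and cosine *)

Section TrigBounds.
Context (R : realType).
Implicit Types x c : R.

(** Each of the Taylor bounds below is obtained by integrating the preceding one; this mean value
    argument is the integration step. *)
Lemma ge0_is_derive (f df : R -> R) x : (forall y : R, is_derive y (1 : R) f (df y)) ->
  (forall y, 0 <= y -> 0 <= df y) -> f 0 = 0 -> 0 <= x -> 0 <= f x.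
Proof.
move=> fdf df0 f0 x0.
have cf : {within `[0, x], continuous f}.
  apply: continuous_subspaceT => y; apply: differentiable_continuous.
  by apply/derivable1_diffP; exact: ex_derive.
have [c c0x] := MVT_segment x0 (fun y _ => fdf y) cf.
rewrite f0 !subr0 => ->; rewrite mulr_ge0// df0//.
by move: c0x; rewrite in_itv/= => /andP[].
Qed.

Lemma sin_le x : 0 <= x -> sin x <= x.
Proof.
move=> x0; rewrite -subr_ge0.
apply: (@ge0_is_derive (fun y => y - sin y) (fun y => 1 - cos y)) => //.
by rewrite sin0 subr0.
Qed.

Lemma cos_ge_lin x : 0 <= x -> 1 - x <= cos x.
Proof.
move=> x0; rewrite -subr_ge0.
apply: (@ge0_is_derive (fun y => cos y - (1 - y)) (fun y => - sin y - (0 - 1))) => //.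
by rewrite cos0; ring.
Qed.

Lemma cos_ge_sqr x : 0 <= x -> 1 - x ^+ 2 / 2 <= cos x.
Proof.
move=> x0; rewrite -subr_ge0.
apply: (@ge0_is_derive (fun y => cos y - (1 - y ^+ 2 / 2)) (fun y => y - sin y)) => //.
- by move=> y; apply: is_derive_eq; rewrite /GRing.scale/=; field.
- by move=> y y0; rewrite subr_ge0 sin_le.
- by rewrite cos0 expr0n/=; ring.
Qed.

Lemma sin_ge_sqr x : 0 <= x -> x - x ^+ 2 / 2 <= sin x.
Proof.
move=> x0; rewrite -subr_ge0.
apply: (@ge0_is_derive (fun y => sin y - (y - y ^+ 2 / 2)) (fun y => cos y - (1 - y))) => //.
- by move=> y; apply: is_derive_eq; rewrite /GRing.scale/=; field.
- by move=> y y0; rewrite subr_ge0 cos_ge_lin.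
- by rewrite sin0 expr0n/=; ring.
Qed.

Lemma sin_ge_cube x : 0 <= x -> x - x ^+ 3 / 6 <= sin x.
Proof.
move=> x0; rewrite -subr_ge0.
apply: (@ge0_is_derive (fun y => sin y - (y - y ^+ 3 / 6)) (fun y => cos y - (1 - y ^+ 2 / 2))) => //.
- by move=> y; apply: is_derive_eq; rewrite /GRing.scale/=; field.
- by move=> y y0; rewrite subr_ge0 cos_ge_sqr.
- by rewrite sin0 expr0n/=; ring.
Qed.

Lemma cos_le_cube x : 0 <= x -> cos x <= 1 - x ^+ 2 / 2 + x ^+ 3 / 6.
Proof.
move=> x0; rewrite -subr_ge0.
apply: (@ge0_is_derive (fun y => 1 - y ^+ 2 / 2 + y ^+ 3 / 6 - cos y)
  (fun y => sin y - (y - y ^+ 2 / 2))) => //.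
- by move=> y; apply: is_derive_eq; rewrite /GRing.scale/=; field.
- by move=> y y0; rewrite subr_ge0 sin_ge_sqr.
- by rewrite cos0 !expr0n/=; ring.
Qed.

(** The quadratic bound makes a second moment sufficient where [x] is large; the cubic one makes the
    error [o(x^2)] where [x] is small. This is the form that Lindeberg's argument uses. *)
Lemma norm_sin_sub x : `|sin x - x| <= Num.min (`|x| ^+ 2) (`|x| ^+ 3).
Proof.
have main (y : R) : 0 <= y -> `|sin y - y| <= Num.min (y ^+ 2) (y ^+ 3).
  move=> y0; rewrite distrC ger0_norm ?subr_ge0 ?sin_le// le_min.
  have := sin_ge_sqr y0; have := sin_ge_cube y0; have := exprn_ge0 2 y0.
  have := exprn_ge0 3 y0; lra.
have [x0|x0] := leP 0 x; first by rewrite (ger0_norm x0) main.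
rewrite (ltr0_norm x0) -normrN (_ : - (sin x - x) = sin (- x) - (- x)).
  by rewrite main// oppr_ge0 ltW.
by rewrite sinN; ring.
Qed.

Lemma norm_cos_sub x : `|cos x - (1 - x ^+ 2 / 2)| <= Num.min (`|x| ^+ 2) (`|x| ^+ 3).
Proof.
have main (y : R) : 0 <= y -> `|cos y - (1 - y ^+ 2 / 2)| <= Num.min (y ^+ 2) (y ^+ 3).
  move=> y0; rewrite ger0_norm ?subr_ge0 ?cos_ge_sqr// le_min.
  have := cos_le_cube y0; have := exprn_ge0 2 y0; have := exprn_ge0 3 y0.
  have := cos_le1 y; lra.
by rewrite -cos_norm -real_normK ?num_real// main.
Qed.

Lemma norm_cosD_sub c x :
  `|cos (c + x) - (cos c - x * sin c - x ^+ 2 / 2 * cos c)| <=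
    2 * Num.min (`|x| ^+ 2) (`|x| ^+ 3).
Proof.
have -> : cos (c + x) - (cos c - x * sin c - x ^+ 2 / 2 * cos c) =
    cos c * (cos x - (1 - x ^+ 2 / 2)) - sin c * (sin x - x).
  by rewrite cosD; ring.
rewrite (le_trans (ler_normB _ _))// !normrM mulr_natl mulr2n lerD//.
  by rewrite (le_trans _ (norm_cos_sub x))// ler_piMl// cos_max.
by rewrite (le_trans _ (norm_sin_sub x))// ler_piMl// sin_max.
Qed.

End TrigBounds.

(** * Bernstein polynomials *)

Section Bernstein.
Context (R : realType).
Implicit Types (phi psi : nat -> R) (s c : R).

                                                                                           
(** The expectation of [phi] at a binomial variable with parameters [N] and [s], conditioned on one
    toss at a time: the Bernstein polynomial, in a form suited to induction. *)
Fixpoint bern (N : nat) phi s : R :=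
  if N is N'.+1 then s * bern N' (fun k => phi k.+1) s + (1 - s) * bern N' phi s
  else phi 0%N.

Lemma bernD N phi psi s :
  bern N (fun k => phi k + psi k) s = bern N phi s + bern N psi s.
Proof. by elim: N phi psi => //= N IH phi psi; rewrite !IH; ring. Qed.

Lemma bernZ N a phi s : bern N (fun k => a * phi k) s = a * bern N phi s.
Proof. by elim: N phi => //= N IH phi; rewrite !IH; ring. Qed.

Lemma bernB N phi psi s :
  bern N (fun k => phi k - psi k) s = bern N phi s - bern N psi s.
Proof. by elim: N phi psi => //= N IH phi psi; rewrite !IH; ring. Qed.

Lemma bern_cst N a s : bern N (fun=> a) s = a.
Proof. by elim: N => //= N ->; ring. Qed.

Lemma le_bern N phi psi s : 0 <= s <= 1 -> (forall k, (k <= N)%N -> phi k <= psi k) ->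
  bern N phi s <= bern N psi s.
Proof.
move=> /andP[s0 s1]; elim: N phi psi => /= [|N IH] phi psi h; first exact: h.
apply: lerD; apply: ler_wpM2l => //; rewrite ?subr_ge0//; apply: IH => k kN; apply: h => //.
by rewrite (leq_trans kN).
Qed.

Lemma norm_bern N phi s : 0 <= s <= 1 ->
  `|bern N phi s| <= bern N (fun k => `|phi k|) s.
Proof.
move=> s01; rewrite ler_norml -[X in X <= _ <= _]mulN1r -bernZ.
by apply/andP; split; apply: le_bern => // k _; rewrite ?mulN1r ?ler_norm// lerNl -normrN ler_norm.
Qed.

(** The second moment of the binomial about an arbitrary centre; leaving [c] free lets a successful
    toss be absorbed as a shift to [c - 1]. *)
Lemma bern_sqr N c s :
  bern N (fun k => (k%:R - c) ^+ 2) s = (N%:R * s - c) ^+ 2 + N%:R * s * (1 - s).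
Proof.
elim: N c => [|N IH] c /=; first by rewrite !mul0r addr0.
have -> : (fun k : nat => (k.+1%:R - c) ^+ 2) = (fun k : nat => (k%:R - (c - 1)) ^+ 2) :> (nat -> R).
  by apply/funext => k; rewrite -natr1; ring.
by rewrite !IH -natr1; ring.
Qed.

Lemma bern_dist N s (r : R) : 0 <= s <= 1 -> (0 < N)%N -> 0 < r -> N%:R <= r ^+ 2 ->
  bern N (fun k => `|k%:R - N%:R * s|) s <= r.
Proof.
move=> s01 N0 r0 Nr.
apply: (@le_trans _ _ (bern N (fun k => r^-1 / 2 * (k%:R - N%:R * s) ^+ 2 + r / 2) s)).
  apply: le_bern => // k _; set y := _ - _.
  have : 0 <= (`|y| - r) ^+ 2 by exact: sqr_ge0.
  rewrite sqrrB real_normK ?num_real// => h.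
  rewrite -(ler_pM2l r0) mulrDr !mulrA divff ?gt_eqF// mul1r.
  lra.
rewrite bernD (bernZ _ (r^-1 / 2)) bern_sqr bern_cst subrr expr0n/= add0r.
have h : N%:R * s * (1 - s) <= r ^+ 2.
  move/andP: s01 => [s0 s1]; rewrite (le_trans _ Nr)// -mulrA ler_piMr//.
  by rewrite mulr_ile1// ?subr_ge0// gerBl.
rewrite [leRHS](_ : r = r^-1 / 2 * r ^+ 2 + r / 2); last by field; rewrite gt_eqF.
by rewrite lerD2r ler_wpM2l// divr_ge0// invr_ge0 ltW.
Qed.

End Bernstein.

(** * Approximation of Lipschitz functions by trigonometric polynomials *)

Section TrigApprox.
Context (R : realType) (I : finType).
Implicit Types (F : (I -> R) -> R) (x y u : I -> R).

(** The phase [c] makes sines available, so that expectations of these functions carry the same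
    information as complex characteristic functions. *)
Inductive trigpoly : ((I -> R) -> R) -> Prop :=
| trig_cos u c : trigpoly (fun x => cos (\sum_i u i * x i + c))
| trig_add F G : trigpoly F -> trigpoly G -> trigpoly (fun x => F x + G x)
| trig_scale a F : trigpoly F -> trigpoly (fun x => a * F x).

Lemma trig_cst a : trigpoly (fun=> a).
Proof.
have -> : (fun=> a) = (fun x => a * cos (\sum_i (fun=> 0) i * x i + 0)) :> ((I -> R) -> R).
  by apply/funext => x; rewrite big1 ?addr0 ?cos0 ?mulr1// => i _; rewrite mul0r.
exact/trig_scale/trig_cos.
Qed.

Lemma trig_mul_cos F u c : trigpoly F ->
  trigpoly (fun x => cos (\sum_i u i * x i + c) * F x).
Proof.
elim=> [v e|G H _ IG _ IH|a G _ IG].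
- have -> : (fun x => cos (\sum_i u i * x i + c) * cos (\sum_i v i * x i + e)) =
      (fun x => 2^-1 * (cos (\sum_i (u i + v i) * x i + (c + e)) +
                        cos (\sum_i (u i - v i) * x i + (c - e)))).
    apply/funext => x.
    have -> : \sum_i (u i + v i) * x i + (c + e) =
        (\sum_i u i * x i + c) + (\sum_i v i * x i + e).
      by under eq_bigr do rewrite mulrDl; rewrite big_split/=; ring.
    have -> : \sum_i (u i - v i) * x i + (c - e) =
        (\sum_i u i * x i + c) - (\sum_i v i * x i + e).
      by under eq_bigr do rewrite mulrBl; rewrite big_split/= sumrN; ring.
    set A := \sum_i u i * x i + c; set B := \sum_i v i * x i + e.
    by rewrite (cosD A B) (cosB A B); field.
  by apply: trig_scale; apply: trig_add; exact: trig_cos.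
- rewrite (_ : (fun _ => _) = (fun x => cos (\sum_i u i * x i + c) * G x +
    cos (\sum_i u i * x i + c) * H x)); first exact: trig_add.
  by apply/funext => x; rewrite mulrDr.
- rewrite (_ : (fun _ => _) = (fun x => a * (cos (\sum_i u i * x i + c) * G x))).
    exact: trig_scale.
  by apply/funext => x; rewrite mulrCA.
Qed.

(** Polynomials in this variable are trigonometric polynomials, and
    [M (2 squash M t - 1) = M sin (t / M)] is close to [t] for large [M]. *)
Definition squash (M : R) (t : R) : R := (1 + sin (t / M)) / 2.

Lemma squash01 M t : 0 <= squash M t <= 1.
Proof.
rewrite /squash; have := sin_le1 (t / M); have := sin_geN1 (t / M); lra.
Qed.

Lemma trig_bern N (F : nat -> (I -> R) -> R) M i : (forall k, trigpoly (F k)) ->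
  trigpoly (fun x => bern N (fun k => F k x) (squash M (x i))).
Proof.
have mulsin G : trigpoly G -> trigpoly (fun x => sin (x i / M) * G x).
  move=> tG; rewrite (_ : (fun _ => _) =
      (fun x => cos (\sum_j (if j == i then M^-1 else 0) * x j + (- (pi / 2))) * G x)).
    exact: trig_mul_cos.
  apply/funext => x; rewrite (bigD1 i)//= eqxx big1 ?addr0 ?cosBpihalf.
    by rewrite [X in sin X]mulrC.
  by move=> j /negbTE ->; rewrite mul0r.
elim: N F => [|N IH] F tF /=; first exact: tF.
rewrite (_ : (fun _ => _) = (fun x =>
  (2^-1 * bern N (fun k => F k.+1 x) (squash M (x i)) +
   2^-1 * bern N (fun k => F k x) (squash M (x i))) +
  (2^-1 * (sin (x i / M) * bern N (fun k => F k.+1 x) (squash M (x i))) +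
   - 2^-1 * (sin (x i / M) * bern N (fun k => F k x) (squash M (x i)))))).
  apply: trig_add; apply: trig_add; apply: trig_scale; try apply: mulsin;
    exact: IH.
by apply/funext => x; rewrite /squash; field.
Qed.

Definition upd x i t : I -> R := fun j => if j == i then t else x j.

Definition lipschitz1 (L : R) F := forall x y, `|F x - F y| <= L * \sum_i `|x i - y i|.

                                                                                                                  
(** The tensor-product Bernstein operator, one coordinate at a time. The argument [y] stores the
    nodes chosen so far; [M (2 k / N - 1)] is the coordinate corresponding to the binomial frequency
    [k / N]. *)
Fixpoint bern_iter (M : R) (N : nat) (l : seq I) F y x : R :=
  if l is i :: l' then
    bern N (fun k => bern_iter M N l' F (upd y i (M * (2 * k%:R / N%:R - 1))) x)
      (squash M (x i))
  else F y.

Lemma trig_bern_iter M N l F y : trigpoly (bern_iter M N l F y).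
Proof.
elim: l y => [|i l IH] y /=; first exact: trig_cst.
exact: trig_bern.
Qed.

Lemma bern_iter01 M N l F y x : (forall z, 0 <= F z <= 1) ->
  0 <= bern_iter M N l F y x <= 1.
Proof.
move=> F01; elim: l y => [|i l IH] y /=; first exact: F01.
have s01 := squash01 M (x i).
rewrite -(bern_cst N 0 (squash M (x i))) -[X in _ <= _ <= X](bern_cst N 1 (squash M (x i))).
by apply/andP; split; apply: le_bern => // k _; have /andP[] := IH (upd y i (M * (2 * k%:R / N%:R - 1))).
Qed.

Definition sin_on M (l : seq I) y x : I -> R :=
  fun j => if j \in l then M * sin (x j / M) else y j.

(** Each coordinate costs the Lipschitz constant times the mean deviation of a binomial frequency,
    at most [r / N], stretched by [2 M]. The operator thus approximates [F] at the point whose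
    coordinates are [M sin (x j / M)]. *)
Lemma bern_iter_approx M N l F y x L (r : R) : lipschitz1 L F -> 0 <= L -> 0 < M ->
  (0 < N)%N -> 0 < r -> N%:R <= r ^+ 2 ->
  `|bern_iter M N l F y x - F (sin_on M l y x)| <= (size l)%:R * (L * (2 * M * (r / N%:R))).
Proof.
move=> LF L0 M0 N0 r0 Nr; elim: l y => [|i l IH] y /=.
  by rewrite mul0r (_ : sin_on M [::] y x = y) ?subrr ?normr0//.
set s := squash M (x i); have s01 : 0 <= s <= 1 by exact: squash01.
have Nn : N%:R != 0 :> R by rewrite pnatr_eq0 -lt0n.
rewrite -[X in `|_ - X|](bern_cst N (F (sin_on M (i :: l) y x)) s).
rewrite -bernB (le_trans (norm_bern _ _ s01))//.
set e := (L * (2 * M * (r / N%:R))).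
pose D : R := (size l)%:R * e.
apply: (@le_trans _ _ (bern N (fun k => L * (2 * M / N%:R) * `|k%:R - N%:R * s| + D) s)).
  apply: le_bern => // k _; set t := M * _.
  have := IH (upd y i t); set b := bern_iter _ _ _ _ _ _; rewrite -/e -/D => IHb.
  have Fd : `|F (sin_on M l (upd y i t) x) - F (sin_on M (i :: l) y x)| <=
     L * (2 * M / N%:R) * `|k%:R - N%:R * s|.
    rewrite (le_trans (LF _ _))// -mulrA ler_wpM2l//.
    rewrite (bigD1 i)//= big1 ?addr0 => [|j ji]; last first.
      rewrite /sin_on inE (negbTE ji)/= /upd (negbTE ji); case: ifP; by rewrite subrr normr0.
    rewrite /sin_on inE eqxx/= /upd eqxx; case: ifP => _.
      by rewrite subrr normr0 mulr_ge0// ?divr_ge0 ?mulr_ge0// ltW.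
    have -> : t - M * sin (x i / M) = (2 * M / N%:R) * (k%:R - N%:R * s).
      by rewrite /t /s /squash; field.
    by rewrite normrM ger0_norm// divr_ge0// mulr_ge0// ltW.
  rewrite (le_trans (ler_distD (F (sin_on M l (upd y i t) x)) _ _))//.
  by rewrite addrC lerD.
rewrite bernD (bernZ _ (L * (2 * M / N%:R))) bern_cst.
have -> : (size l).+1%:R * e = e + D by rewrite mulrSr mulrDl mul1r addrC.
rewrite lerD2r.
have -> : e = L * (2 * M / N%:R) * r by rewrite /e; ring.
rewrite ler_wpM2l// ?mulr_ge0 ?divr_ge0 ?mulr_ge0 ?(ltW M0)//.
exact: bern_dist.
Qed.

(** The approximant is close to [F] only on the box but lies in [[0, 1]] everywhere, because the
    Bernstein operator is positive. That global bound controls the contribution from outside the box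
    in [levy_approx]. *)
Lemma trig_approx F L (B e : R) : lipschitz1 L F -> (forall x, 0 <= F x <= 1) ->
  0 < B -> 0 < e -> exists Q, [/\ trigpoly Q, forall x, 0 <= Q x <= 1 &
    forall x, (forall i, `|x i| <= B) -> `|F x - Q x| <= e].
Proof.
move=> LF F01 B0 e0.
wlog L0 : L LF / 0 < L.
  move=> h; apply: (h (Num.max L 1)); last by rewrite lt_max ltr01 orbT.
  move=> x y; rewrite (le_trans (LF x y))// ler_wpM2r// ?sumr_ge0// le_max lexx//.
pose n : R := #|I|%:R.
(* Since [|M sin (x / M) - x| <= x^2 / M], this [M] keeps the effect of replacing [x] by the sine
   within [e / 2] on the box. *)
pose M : R := 1 + 2 * n * L * B ^+ 2 / e.
have n0 : 0 <= n by exact: ler0n.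
have M1 : 1 <= M.
  by rewrite lerDl divr_ge0 ?(ltW e0)// !mulr_ge0 ?exprn_ge0 ?(ltW L0) ?(ltW B0).
have M0 : 0 < M by rewrite (lt_le_trans _ M1).
(* With degree [r^2] and [r > a], the Bernstein error [2 n L M / r] is at most [e / 2]. *)
pose a : R := 4 * n * L * M / e + 1.
have a0 : 0 < a by rewrite ltr_wpDl// divr_ge0 ?(ltW e0)// !mulr_ge0 ?(ltW L0) ?(ltW M0).
pose r : nat := (Num.truncn a).+1.
have ar : a < r%:R by exact: truncnS_gt.
have r0 : 0 < r%:R :> R by rewrite ltr0n.
exists (bern_iter M (r ^ 2) (enum I) F (fun=> 0)); split.
- exact: trig_bern_iter.
- by move=> x; exact: bern_iter01.
- move=> x xB.
  have h1 := @bern_iter_approx M (r ^ 2) (enum I) F (fun=> 0) x L r%:R LF (ltW L0) M0.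
  have {h1} := h1 (_ : _) r0 (_ : _); rewrite expn_gt0/= natrX => /(_ isT (lexx _)).
  rewrite -cardE -/n => h1.
  set G := sin_on _ _ _ _ in h1.
  have h2 : `|F x - F G| <= e / 2.
    rewrite (le_trans (LF _ _))//.
    apply: (@le_trans _ _ (L * (n * (B ^+ 2 / M)))).
      rewrite ler_wpM2l ?(ltW L0)//.
      apply: (@le_trans _ _ (\sum_(i : I) (B ^+ 2 / M))); last first.
        by rewrite sumr_const -mulr_natl.
      apply: ler_sum => i _; rewrite /G /sin_on mem_enum.
      have -> : x i - M * sin (x i / M) = - M * (sin (x i / M) - x i / M).
        by field; rewrite gt_eqF.
      rewrite normrM normrN (gtr0_norm M0).
      have := norm_sin_sub (x i / M); rewrite le_min => /andP[h _].
      rewrite (le_trans (ler_wpM2l (ltW M0) h))//.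
      rewrite normrM normfV (gtr0_norm M0) exprMn.
      have -> : M * (`|x i| ^+ 2 * M^-1 ^+ 2) = `|x i| ^+ 2 / M by field; rewrite gt_eqF.
      by rewrite ler_wpM2r ?invr_ge0 ?(ltW M0)// lerXn2r// ?nnegrE// ltW.
    rewrite !mulrA ler_pdivrMr//.
    have : 2 * n * L * B ^+ 2 / e * e <= M * e by rewrite ler_wpM2r ?(ltW e0)// /M lerDr.
    rewrite divfK ?gt_eqF//; lra.
  have h3 : n * (L * (2 * M * (r%:R / r%:R ^+ 2))) <= e / 2.
    have -> : n * (L * (2 * M * (r%:R / r%:R ^+ 2))) = (2 * n * L * M) / r%:R.
      by field; rewrite gt_eqF.
    rewrite ler_pdivrMr//.
    have : a * e <= r%:R * e by rewrite ler_wpM2r// ltW.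
    by rewrite /a mulrDl divfK ?gt_eqF//; lra.
  rewrite (le_trans (ler_distD (F G) _ _))//.
  by rewrite (splitr e) lerD// distrC (le_trans h1).
Qed.

End TrigApprox.

(** * Measurability of Lipschitz functions of random vectors *)

Section LipschitzMeasurable.
Context d (T : measurableType d) (R : realType) (I : finType).

                                                                                                                         
(** [F x < a] holds exactly when some rational point [q] satisfies [F q + K |x - q| < a], so the
    sublevel set is a countable union of measurable sets. *)
Lemma measurable_lipschitz1 (F : (I -> R) -> R) (L : R) (X : T -> I -> R) :
  lipschitz1 L F -> (forall i, measurable_fun setT (fun w => X w i)) ->
  measurable_fun setT (fun w => F (X w)).
Proof.
move=> LF mX; pose K := Num.max L 1.
have K0 : 0 < K by rewrite lt_max ltr01 orbT.
have {}LF x y : F x - F y <= K * \sum_i `|x i - y i|.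
  rewrite (le_trans (ler_norm _))// (le_trans (LF x y))//.
  by rewrite ler_wpM2r ?sumr_ge0// le_max lexx.
apply: (measurability (@RGenInftyO.G R)); first exact: RGenInftyO.measurableE.
move=> _ [_ [a ->] <-]; rewrite setTI.
pose Fq (q : {ffun I -> rat}) w := F (fun i => ratr (q i)) + K * \sum_i `|X w i - ratr (q i)|.
have -> : (fun w => F (X w)) @^-1` `]-oo, a[%classic =
    \bigcup_q [set w | Fq q w < a].
  apply/seteqP; split => w /=.
    rewrite in_itv/= => Fa.
    (* At a rational point within [e] of [X w], both the variation of [F] and the penalty are at
       most [K #|I| e]; together they stay below the gap [a - F (X w)]. *)
    pose e := (a - F (X w)) / (2 * K * (#|I|%:R + 1)).
    have n0 : 0 < #|I|%:R + 1 :> R by rewrite ltr_wpDl.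
    have e0 : 0 < e by rewrite divr_gt0 ?subr_gt0// !mulr_gt0.
    have /choice[q qP] : forall i, exists q : rat, `|X w i - ratr q| < e.
      move=> i; have [|q] := @rat_in_itvoo R (X w i - e) (X w i + e); first by lra.
      by rewrite in_itv/= => /andP[h1 h2]; exists q; rewrite ltr_norml; apply/andP; split; lra.
    exists (finfun q) => //=; rewrite /Fq.
    set y := fun i => _.
    have S : \sum_i `|X w i - ratr (finfun q i)| <= #|I|%:R * e.
      rewrite mulr_natl -sumr_const; apply: ler_sum => i _.
      by rewrite ffunE ltW.
    have h : F y <= F (X w) + K * (#|I|%:R * e).
      rewrite -lerBlDl (le_trans (LF _ _))// ler_wpM2l ?(ltW K0)//.
      by rewrite (le_trans _ S)//; apply: ler_sum => i _; rewrite distrC.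
    apply: (@le_lt_trans _ _ (F (X w) + K * (#|I|%:R * e) + K * (#|I|%:R * e))).
      by rewrite lerD// ler_wpM2l// ltW.
    have E : 2 * K * (#|I|%:R + 1) * e = a - F (X w).
      by rewrite /e mulrC divfK// gt_eqF// !mulr_gt0.
    have := mulr_gt0 K0 e0; rewrite -addrA -ltrBrDl -E.
    lra.
  move=> [q _ /=]; rewrite in_itv/=; apply: le_lt_trans.
  by rewrite -lerBlDl LF.
apply: countable_bigcupT_measurable; first exact: countableP.
move=> q; rewrite (_ : [set w | _] = Fq q @^-1` `]-oo, a[%classic); last first.
  by apply/seteqP; split => w /=; rewrite in_itv.
apply: measurable_preimage => //; apply: measurable_funD => //.
apply: measurable_funM => //; apply: measurable_sum => i.
by apply: measurableT_comp => //; exact: measurable_funB.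
Qed.

End LipschitzMeasurable.

Lemma measurable_cos (R : realType) : measurable_fun setT (@cos R).
Proof. by apply: continuous_measurable_fun; exact: continuous_cos. Qed.

(** * Levy's continuity theorem for Lipschitz test functions *)

Section Levy.
Context (R : realType) (I : finType).
Implicit Types (F Q : (I -> R) -> R).

Lemma trigpoly_bounded Q : trigpoly Q -> exists M, forall x, `|Q x| <= M.
Proof.
elim=> [u c|F G _ [M FM] _ [N GN]|a F _ [M FM]].
- by exists 1 => x; exact: cos_max.
- by exists (M + N) => x; rewrite (le_trans (ler_normD _ _))// lerD.
- by exists (`|a| * M) => x; rewrite normrM ler_wpM2l.
Qed.

Lemma measurable_trigpoly d (T : measurableType d) Q (X : T -> I -> R) :
  trigpoly Q -> (forall i, measurable_fun setT (fun w => X w i)) ->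
  measurable_fun setT (fun w => Q (X w)).
Proof.
move=> tQ mX; elim: tQ => [u c|F G _ mF _ mG|a F _ mF].
- apply: (measurableT_comp (@measurable_cos R)).
  apply: measurable_funD => //; apply: measurable_sum => i.
  exact: measurable_funM.
- exact: measurable_funD.
- exact: measurable_funM.
Qed.

Lemma L1_trigpoly d (T : measurableType d) (P : probability T R) Q (X : T -> I -> R) :
  trigpoly Q -> (forall i, measurable_fun setT (fun w => X w i)) ->
  L1 P (fun w => Q (X w)).
Proof.
move=> tQ mX; have [M QM] := trigpoly_bounded tQ.
by apply: (@L1_bounded _ _ _ _ _ M) => //; exact: measurable_trigpoly.
Qed.

(** Inside the box the error is [e]. Outside it, [|F - Q| <= 1] is dominated by the sum of the
    squared coordinates over [B^2], whose mean is at most [#|I| C / B^2]. *)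
Lemma levy_approx d (T : measurableType d) (P : probability T R) F Q
    (X : T -> I -> R) (L B C e : R) :
  lipschitz1 L F -> (forall x, 0 <= F x <= 1) -> trigpoly Q ->
  (forall x, 0 <= Q x <= 1) -> 0 < B -> 0 <= e ->
  (forall x, (forall i, `|x i| <= B) -> `|F x - Q x| <= e) ->
  (forall i, measurable_fun setT (fun w => X w i)) ->
  (forall i, L1 P (fun w => X w i ^+ 2)) ->
  (forall i, Ex P (fun w => X w i ^+ 2) <= C) ->
  `|Ex P (fun w => F (X w)) - Ex P (fun w => Q (X w))| <= e + #|I|%:R * C / B ^+ 2.
Proof.
move=> LF F01 tQ Q01 B0 e0 FQ mX LX XC.
have LFX : L1 P (fun w => F (X w)).
  apply: (@L1_bounded _ _ _ _ _ 1); first exact: measurable_lipschitz1 LF mX.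
  by move=> w; have /andP[F0 F1] := F01 (X w); rewrite ger0_norm.
have LQX := L1_trigpoly P tQ mX.
have LS : L1 P (fun w => e + B ^- 2 * \sum_i X w i ^+ 2).
  apply: L1D; first exact: (L1_cst P e).
  by apply: L1Z; exact: L1_sum.
rewrite -ExB// (le_trans (normEx_le _ LS _))//; first exact: L1B.
  move=> w; have [h|] := pselect (forall i, `|X w i| <= B).
    rewrite (le_trans (FQ _ h))// lerDl mulr_ge0 ?invr_ge0 ?exprn_ge0 ?(ltW B0)//.
    by apply: sumr_ge0 => i _; exact: sqr_ge0.
  move=> /existsNP[i /negP]; rewrite -ltNge => Bi.
  have h : 1 <= B ^- 2 * \sum_i X w i ^+ 2.
    rewrite mulrC ler_pdivlMr ?exprn_gt0// mul1r (bigD1 i)//=.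
    rewrite (@le_trans _ _ (X w i ^+ 2))//; last first.
      by rewrite lerDl sumr_ge0// => j _; exact: sqr_ge0.
    by rewrite -[leRHS]real_normK ?num_real// lerXn2r ?nnegrE ?(ltW B0)// ltW.
  have := F01 (X w); have := Q01 (X w); rewrite ler_norml; lra.
rewrite (ExD (L1_cst P e)); last by apply: L1Z; exact: L1_sum.
rewrite ExZ; last exact: L1_sum.
rewrite Ex_cst lerD2l// Ex_sum// mulrC ler_wpM2r ?invr_ge0 ?exprn_ge0 ?(ltW B0)//.
by rewrite mulr_natl -sumr_const; exact: ler_sum.
Qed.

(** Convergence of phased cosines extends by linearity to trigonometric polynomials, and the uniform
    second-moment bound [C] provides the tightness that carries it over to [F]. *)
Lemma levy_continuity (J : Type) (G : set_system J) (FG : Filter G)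
    d (T : measurableType d) (P : probability T R)
    d' (T' : measurableType d') (P' : probability T' R)
    F (L C : R) (X : J -> T -> I -> R) (X' : T' -> I -> R) :
  lipschitz1 L F -> (forall x, 0 <= F x <= 1) ->
  (forall j i, measurable_fun setT (fun w => X j w i)) ->
  (forall i, measurable_fun setT (fun w => X' w i)) ->
  (\forall j \near G, forall i, L1 P (fun w => X j w i ^+ 2) /\
     Ex P (fun w => X j w i ^+ 2) <= C) ->
  (forall i, L1 P' (fun w => X' w i ^+ 2) /\ Ex P' (fun w => X' w i ^+ 2) <= C) ->
  (forall (u : I -> R) c, Ex P (fun w => cos (\sum_i u i * X j w i + c)) @[j --> G] -->
     Ex P' (fun w => cos (\sum_i u i * X' w i + c))) ->
  Ex P (fun w => F (X j w)) @[j --> G] --> Ex P' (fun w => F (X' w)).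
Proof.
move=> LF F01 mX mX' XC XC' cvgX.
have cvgQ Q : trigpoly Q ->
    Ex P (fun w => Q (X j w)) @[j --> G] --> Ex P' (fun w => Q (X' w)).
  elim=> [u c|Q1 Q2 t1 IH1 t2 IH2|a Q1 t1 IH1]; first exact: cvgX.
  - rewrite (ExD (L1_trigpoly P' t1 mX') (L1_trigpoly P' t2 mX')).
    under eq_fun => j do rewrite (ExD (L1_trigpoly P t1 (mX j)) (L1_trigpoly P t2 (mX j))).
    exact: cvgD.
  - rewrite (ExZ _ (L1_trigpoly P' t1 mX')).
    under eq_fun => j do rewrite (ExZ _ (L1_trigpoly P t1 (mX j))).
    exact: cvgMr.
apply/cvgrPdist_lt => e e0.
have C0 : 0 <= Num.max C 0 by rewrite le_max lexx orbT.
pose K : R := #|I|%:R * Num.max C 0.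
have K0 : 0 <= K by rewrite mulr_ge0.
(* This makes the mass outside the box at most [e / 6]. Each replacement of [F] by [Q] then costs
   [e / 3], and the convergence for [Q] supplies the last third. *)
pose B := 1 + 6 * K / e.
have B1 : 1 <= B by rewrite lerDl divr_ge0 ?mulr_ge0// ltW.
have B0 : 0 < B by rewrite (lt_le_trans _ B1).
have KB : K / B ^+ 2 <= e / 6.
  rewrite ler_pdivrMr ?exprn_gt0//.
  have : e / 6 * B <= e / 6 * B ^+ 2.
    by rewrite ler_wpM2l ?divr_ge0 ?(ltW e0)// expr2 ler_peMr ?(ltW B0).
  apply: le_trans; rewrite /B mulrDr mulr1.
  have -> : e / 6 * (6 * K / e) = K by field; rewrite gt_eqF.
  by rewrite lerDr divr_ge0// ltW.
have [Q [tQ Q01 FQ]] := trig_approx LF F01 B0 (divr_gt0 e0 (ltr0n R 6)).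
have e60 : 0 <= e / 6 by rewrite divr_ge0// ltW.
have CK a : a <= C -> a <= Num.max C 0 by move=> h; rewrite le_max h.
have H' := levy_approx LF F01 tQ Q01 B0 e60 FQ mX' (fun i => (XC' i).1)
  (fun i => CK _ (XC' i).2).
have e30 : 0 < e / 3 by rewrite divr_gt0.
have /cvgrPdist_lt/(_ _ e30) HQn := cvgQ Q tQ.
near=> j.
have Xj : forall i, L1 P (fun w => X j w i ^+ 2) /\ Ex P (fun w => X j w i ^+ 2) <= C.
  by near: j.
have H := levy_approx LF F01 tQ Q01 B0 e60 FQ (mX j) (fun i => (Xj i).1)
  (fun i => CK _ (Xj i).2).
have HQ : `|Ex P' (fun w => Q (X' w)) - Ex P (fun w => Q (X j w))| < e / 3.
  by near: j.
move: H H'; rewrite -/K => H H'.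
have := ler_distD (Ex P' (fun w => Q (X' w))) (Ex P' (fun w => F (X' w))) (Ex P (fun w => F (X j w))).
have := ler_distD (Ex P (fun w => Q (X j w))) (Ex P' (fun w => Q (X' w))) (Ex P (fun w => F (X j w))).
rewrite [ `|Ex P (fun w => Q (X j w)) - _| ]distrC.
lra.
Unshelve. all: by end_near. Qed.

End Levy.

                                                                  

Lemma measurable_sin (R : realType) : measurable_fun setT (@sin R).
Proof. by apply: continuous_measurable_fun; exact: continuous_sin. Qed.

(** * Dominated convergence for real expectations *)

Section Expectation_convergence.
Context d (T : measurableType d) (R : realType) (P : probability T R).

Lemma Ex_dominated_cvg (f_ : nat -> T -> R) (f g : T -> R) :
  (forall n, measurable_fun setT (f_ n)) -> L1 P g ->
  (forall n w, `|f_ n w| <= g w) -> (forall w, f_ n w @[n --> \oo] --> f w) ->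
  L1 P f /\ Ex P (f_ n) @[n --> \oo] --> Ex P f.
Proof.
move=> mf Lg fg fcvg.
have mlim : measurable_fun setT f by apply: (measurable_fun_cvg mf) => w _; exact: fcvg.
have Lf : L1 P f.
  apply: (L1_le mlim Lg) => w.
  have /cvg_lim <- // : `|f_ n w| @[n --> \oo] --> `|f w|.
    by apply: cvg_norm; exact: fcvg.
  apply: limr_le; first by apply: is_cvg_norm; apply/cvg_ex; eexists; exact: fcvg.
  by apply: nearW => n.
have Lfn n : L1 P (f_ n) by exact: L1_le Lg (fg n).
split=> //; apply: fine_cvg; rewrite -/(Ex P f) -Ex_EFin//.
apply: (@dominated_cvg _ _ _ P _ measurableT _ _ (EFin \o g)) => //.
- by move=> n; exact/measurable_EFinP.
- by move=> w _; apply: cvg_EFin; [exact: nearW|exact: fcvg].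
- by move=> n w _; rewrite /= lee_fin.
Qed.

End Expectation_convergence.

(** * Lindeberg's method with phased cosines *)

Section Lindeberg.
Context d (T : measurableType d) (R : realType) (P : probability T R).

                                                                                                                  
                                                                                                                        
(** Uniformity in the phase [c] is the role usually played by complex exponentials. If [S] is
    independent of [X i], averaging [cos (c + S + X i)] over [X i] alone is the hypothesis at phase
    [c + S], which yields [b i * cos (c + S)] up to [e i]; the induction hypothesis handles the
    rest. Factors in [[0, 1]] keep earlier errors from growing. *)
Lemma Ex_cos_fsum (I : choiceType) (X : I -> T -> R) (s : seq I) (b e : I -> R) :
  (forall i, measurable_fun setT (X i)) -> independent_RVs P X -> uniq s ->
  (forall i, i \in s -> 0 <= b i <= 1) ->
  (forall i c, i \in s -> `|Ex P (fun w => cos (c + X i w)) - b i * cos c| <= e i) ->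
  forall c, `|Ex P (fun w => cos (c + fsum X s w)) - (\prod_(i <- s) b i) * cos c| <=
    \sum_(i <- s) e i.
Proof.
move=> mX iX; elim: s => [_ _ _ c|i s IH /[dup] uis /= /andP[si us] b01 be c].
  rewrite !big_nil mul1r (_ : (fun _ => _) = (fun=> cos c)) ?Ex_cst ?subrr ?normr0//.
  by apply/funext => w; rewrite /fsum big_nil addr0.
have {}IH : `|Ex P (fun w => cos (c + fsum X s w)) - (\prod_(i <- s) b i) * cos c| <=
    \sum_(i <- s) e i.
  by apply: IH => // [j js|j c' js]; [apply: b01|apply: be]; rewrite inE js orbT.
have mS : measurable_fun setT (fsum X s) by exact: measurable_sum.
have mc : measurable_fun setT (fun y : R => c + y) by exact: measurable_funD.
have mcc : measurable_fun setT (fun y : R => cos (c + y)) := measurableT_comp (@measurable_cos R) mc.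
have mcs : measurable_fun setT (fun y : R => sin (c + y)) := measurableT_comp (@measurable_sin R) mc.
have Lc f : measurable_fun setT f -> L1 P (fun w => cos (f w)).
  move=> mf; apply: (@L1_bounded _ _ _ _ _ 1) => [|w]; last exact: cos_max.
  exact: (measurableT_comp (@measurable_cos R)).
have Ls f : measurable_fun setT f -> L1 P (fun w => sin (f w)).
  move=> mf; apply: (@L1_bounded _ _ _ _ _ 1) => [|w]; last exact: sin_max.
  exact: (measurableT_comp (@measurable_sin R)).
have mcS : measurable_fun setT (fun w => c + fsum X s w) by exact: measurable_funD.
have iS := indep2_fsum mX iX uis.
have [Lcc Ecc] := indep2_ExM (measurableT_comp (@measurable_cos R) mcS)
  (measurableT_comp (@measurable_cos R) (mX i))
  (indep2_comp mcc (@measurable_cos R) iS) (Lc _ mcS) (Lc _ (mX i)).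
have [Lss Ess] := indep2_ExM (measurableT_comp (@measurable_sin R) mcS)
  (measurableT_comp (@measurable_sin R) (mX i))
  (indep2_comp mcs (@measurable_sin R) iS) (Ls _ mcS) (Ls _ (mX i)).
set al := Ex P (cos \o X i) in Ecc; set be' := Ex P (sin \o X i) in Ess.
have LcX : L1 P (cos \o X i) := Lc _ (mX i).
have LsX : L1 P (sin \o X i) := Ls _ (mX i).
have LcS := Lc _ mcS; have LsS := Ls _ mcS.
have phase y : Ex P (fun w => cos (y + X i w)) = al * cos y - be' * sin y.
  rewrite -[al * _]mulrC -[be' * _]mulrC -(ExZ _ LcX) -(ExZ _ LsX).
  by rewrite -(ExB (L1Z _ LcX) (L1Z _ LsX)); apply: eq_Ex => w; rewrite cosD.
have E1 : Ex P (fun w => cos (c + fsum X (i :: s) w)) =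
    Ex P (fun w => al * cos (c + fsum X s w) - be' * sin (c + fsum X s w)).
  rewrite (ExB (L1Z _ LcS) (L1Z _ LsS)) (ExZ _ LcS) (ExZ _ LsS).
  rewrite [al * _]mulrC [be' * _]mulrC -Ecc -Ess -(ExB Lcc Lss).
  by apply: eq_Ex => w; rewrite /fsum big_cons addrCA addrC cosD.
rewrite E1 !big_cons.
have h1 : `|Ex P (fun w => al * cos (c + fsum X s w) - be' * sin (c + fsum X s w)) -
    b i * Ex P (fun w => cos (c + fsum X s w))| <= e i.
  rewrite -(ExZ _ LcS) -(ExB (L1B (L1Z _ LcS) (L1Z _ LsS)) (L1Z _ LcS)).
  apply: normEx_bounded.
    exact: (L1_measurable (L1B (L1B (L1Z _ LcS) (L1Z _ LsS)) (L1Z _ LcS))).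
  by move=> w; rewrite -phase be// mem_head.
have /andP[b0 b1] : 0 <= b i <= 1 by rewrite b01// mem_head.
have h2 : `|b i * Ex P (fun w => cos (c + fsum X s w)) - (b i * \prod_(j <- s) b j) * cos c| <=
    \sum_(j <- s) e j.
  by rewrite -mulrA -mulrBr normrM ger0_norm// (le_trans _ IH)// ler_piMl.
by rewrite (le_trans (ler_distD (b i * Ex P (fun w => cos (c + fsum X s w))) _ _))// lerD.
Qed.

Lemma norm_expRN_sub (y : R) : 0 <= y -> `|expR (- y) - (1 - y)| <= y ^+ 2 / 2.
Proof.
move=> y0; have h := expR_ge1Dx (- y); rewrite ger0_norm ?subr_ge0//.
rewrite -subr_ge0.
apply: (@ge0_is_derive _ (fun y => y ^+ 2 / 2 - (expR (- y) - (1 - y)))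
  (fun y => y - (1 - expR (- y)))) => //.
- by move=> z; apply: is_derive_eq; rewrite /GRing.scale/=; field.
- by move=> z z0; have := expR_ge1Dx (- z); lra.
- by rewrite oppr0 expR0 expr0n/=; ring.
Qed.

(** Expand the cosine at [c]: the linear term vanishes in mean, the quadratic one gives [1 - v / 2],
    and this differs from [expR (- (v / 2))] by order [v^2]. Errors are stated through a majorant
    [Y] so that they can be uniform over a family of variables [X]. *)
Lemma Ex_cos_step (X Y : T -> R) : measurable_fun setT X -> measurable_fun setT Y ->
  L1 P (fun w => Y w ^+ 2) -> (forall w, `|X w| <= Y w) -> Ex P X = 0 -> forall c,
  `|Ex P (fun w => cos (c + X w)) - expR (- (Ex P (fun w => X w ^+ 2) / 2)) * cos c| <=
   2 * Ex P (fun w => Num.min (Y w ^+ 2) (Y w ^+ 3)) + Ex P (fun w => Y w ^+ 2) ^+ 2.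
Proof.
move=> mX mY LY XY X0 c.
have Y0 w : 0 <= Y w by rewrite (le_trans _ (XY w)).
have LX : L1 P (fun w => X w ^+ 2).
  apply: (L1_le _ LY); first exact: measurable_funX.
  by move=> w; rewrite normrX lerXn2r ?nnegrE.
have L1X : L1 P X := L1_of_sq mX LX.
set v := Ex P (fun w => X w ^+ 2).
have v0 : 0 <= v by apply: Ex_ge0 => w; exact: sqr_ge0.
have vY : v <= Ex P (fun w => Y w ^+ 2).
  by apply: le_Ex => // w; rewrite -[leLHS]real_normK ?num_real// lerXn2r ?nnegrE.
have Lm : L1 P (fun w => Num.min (Y w ^+ 2) (Y w ^+ 3)).
  apply: (L1_le _ LY).
    by apply: measurable_minr; exact: measurable_funX.
  move=> w; rewrite ger0_norm; first by rewrite ge_min lexx.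
  by rewrite le_min !exprn_ge0.
have Lcos : L1 P (fun w => cos (c + X w)).
  apply: (@L1_bounded _ _ _ _ _ 1) => [|w]; last exact: cos_max.
  by apply: (measurableT_comp (@measurable_cos R)); exact: measurable_funD.
have Lt : L1 P (fun w => cos c - X w * sin c - X w ^+ 2 / 2 * cos c).
  apply: L1B; last first.
    by apply: (L1_ext _ (L1Z (2^-1 * cos c) LX)) => w; ring.
  apply: L1B; first exact: (L1_cst P (cos c)).
  by apply: (L1_ext _ (L1Z (sin c) L1X)) => w; ring.
have Et : Ex P (fun w => cos c - X w * sin c - X w ^+ 2 / 2 * cos c) = (1 - v / 2) * cos c.
  transitivity (Ex P (fun w => (cos c - sin c * X w) - (2^-1 * cos c) * X w ^+ 2)).
    by apply: eq_Ex => w; ring.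
  rewrite (ExB (L1B (L1_cst P (cos c)) (L1Z _ L1X)) (L1Z _ LX)).
  rewrite (ExB (L1_cst P (cos c)) (L1Z _ L1X)) (ExZ _ LX) (ExZ _ L1X).
  by rewrite Ex_cst X0 -/v; field.
have h1 : `|Ex P (fun w => cos (c + X w)) - (1 - v / 2) * cos c| <=
    2 * Ex P (fun w => Num.min (Y w ^+ 2) (Y w ^+ 3)).
  rewrite -Et -(ExB Lcos Lt) -(ExZ _ Lm); apply: normEx_le; [exact: L1B|exact: L1Z|].
  move=> w; rewrite (le_trans (norm_cosD_sub _ _))// ler_wpM2l//.
  by rewrite le_min !ge_min !lerXn2r ?nnegrE ?orbT.
have h2 : `|(1 - v / 2) * cos c - expR (- (v / 2)) * cos c| <= Ex P (fun w => Y w ^+ 2) ^+ 2.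
  rewrite -mulrBl normrM distrC (@le_trans _ _ `|expR (- (v / 2)) - (1 - v / 2)|)//.
    by rewrite ler_piMr// cos_max.
  rewrite (le_trans (norm_expRN_sub _)) ?divr_ge0//.
  rewrite (@le_trans _ _ (v ^+ 2))// ?lerXn2r ?nnegrE// ?(le_trans v0)//.
  by have := sqr_ge0 v; rewrite exprMn; lra.
by rewrite (le_trans (ler_distD ((1 - v / 2) * cos c) _ _))// lerD.
Qed.

(** The expectation equals [t^2] times that of [min (Y^2, t Y^3)], which tends to 0 with [t] by
    domination by [Y^2]. This is Lindeberg's condition for a single square-integrable variable. *)
Lemma min_cube_small (Y : T -> R) (eta : R) : measurable_fun setT Y ->
  L1 P (fun w => Y w ^+ 2) -> (forall w, 0 <= Y w) -> 0 < eta ->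
  exists2 delta, 0 < delta & forall t, 0 <= t <= delta ->
    Ex P (fun w => Num.min ((t * Y w) ^+ 2) ((t * Y w) ^+ 3)) <= eta * t ^+ 2.
Proof.
move=> mY LY Y0 eta0.
pose g (t : R) w := Num.min (Y w ^+ 2) (t * Y w ^+ 3).
have mg t : measurable_fun setT (g t).
  apply: measurable_minr; first exact: measurable_funX.
  by apply: measurable_funM => //; exact: measurable_funX.
have g_le (t : R) w : 0 <= t -> `|g t w| <= Y w ^+ 2.
  move=> t0; rewrite ger0_norm /g; first by rewrite ge_min lexx.
  by rewrite le_min exprn_ge0 ?mulr_ge0 ?exprn_ge0.
have g0 w : g (n.+1%:R^-1) w @[n --> \oo] --> (0 : R).
  have h : n.+1%:R^-1 * Y w ^+ 3 @[n --> \oo] --> (0 : R).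
    by rewrite -(mul0r (Y w ^+ 3)); apply: cvgMl; exact: cvg_harmonic.
  apply: (squeeze_cvgr _ (cvg_cst 0) h); apply: nearW => n.
  by rewrite /g le_min exprn_ge0 ?mulr_ge0 ?exprn_ge0//= ge_min lexx orbT.
have nn n : 0 <= n.+1%:R^-1 :> R by rewrite invr_ge0.
have [_] := @Ex_dominated_cvg _ _ _ P (fun n => g (n.+1%:R^-1)) (fun=> 0)
  (fun w => Y w ^+ 2) (fun n => mg _) LY (fun n w => g_le _ w (nn n)) g0.
rewrite Ex_cst => /cvgrPdist_lt/(_ _ eta0)[n _ /(_ n (leqnn n))].
rewrite sub0r normrN => h.
exists (n.+1%:R^-1) => // t /andP[t0 tn].
have Lg r : 0 <= r -> L1 P (g r) by move=> r0; exact: L1_le LY (g_le _ ^~ r0).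
have -> : (fun w => Num.min ((t * Y w) ^+ 2) ((t * Y w) ^+ 3)) =
    (fun w => t ^+ 2 * g t w).
  by apply/funext => w; rewrite /g minr_pMr ?exprn_ge0//; congr Num.min; ring.
rewrite (ExZ _ (Lg _ t0)) mulrC ler_wpM2r ?exprn_ge0//.
apply: (@le_trans _ _ (Ex P (g n.+1%:R^-1))).
  apply: le_Ex; [exact: Lg|exact: Lg|].
  move=> w; rewrite /g le_min !ge_min lexx/=.
  by rewrite ler_wpM2r ?orbT// exprn_ge0.
by rewrite (le_trans (ler_norm _))// ltW.
Qed.

End Lindeberg.

                                           

(** * Integrals against centred normal laws *)

Section Normal.
Context (R : realType).
Local Notation mu := (@lebesgue_measure R).
Local Notation N01 := (normal_prob 0 1 : probability (measurableTypeR R) R).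

(** The Radon-Nikodym derivative of the normal law agrees almost everywhere with [normal_pdf],
    because both have the same integrals over measurable sets. *)
Lemma ge0_integral_normal_prob (s : R) (f : R -> \bar R) : measurable_fun setT f ->
  (forall x, (0 <= f x)%E) ->
  (\int[normal_prob 0 s]_x f x = \int[mu]_x (f x * (normal_pdf 0 s x)%:E))%E.
Proof.
move=> mf f0.
have mpdf : measurable_fun setT (fun x => (normal_pdf 0 s x)%:E).
  by apply/measurable_EFinP; exact: measurable_normal_pdf.
have dom := @normal_prob_dominates R 0 s.
rewrite -(Radon_Nikodym_SigmaFinite.change_of_variables dom)//.
have iRN := Radon_Nikodym_SigmaFinite.f_integrable dom.
apply: ae_eq_integral => //.
- by apply: emeasurable_funM => //; exact: (measurable_int mu).
- exact: emeasurable_funM.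
- apply: ae_eqe_mul2l; apply: integral_ae_eq => //.
  by move=> E _ mE; rewrite -(Radon_Nikodym_SigmaFinite.f_integral dom).
Qed.

Lemma normal_pdf_scale (s x : R) : 0 < s ->
  normal_pdf 0 s (s * x) * s = normal_pdf 0 1 x.
Proof.
move=> s0; rewrite !normal_pdfE ?gt_eqF ?oner_eq0//.
rewrite /normal_peak /normal_fun !subr0 expr1n mul1r.
rewrite -mulrnAr.
rewrite sqrtrM ?sqr_ge0// sqrtr_sqr gtr0_norm//.
have -> : - (s * x) ^+ 2 / (s ^+ 2 *+ 2) = - x ^+ 2 / 2.
  by field; rewrite gt_eqF.
rewrite invfM; set a := Num.sqrt _; set b := expR _.
by rewrite mulrC !mulrA divff ?gt_eqF// mul1r.
Qed.

Lemma ge0_integral_normal_scale (s : R) (G : R -> R) : 0 < s -> continuous G ->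
  (forall x, 0 <= G x) ->
  (\int[normal_prob 0 s]_x (G x)%:E = \int[N01]_x (G (s * x))%:E)%E.
Proof.
move=> s0 cG G0.
have cGs : continuous (fun x => G (s * x)).
  by move=> x; apply: continuous_comp; [exact: mulrl_continuous|exact: cG].
have mG : measurable_fun setT (fun x => (G x)%:E).
  by apply/measurable_EFinP; exact: continuous_measurable_fun.
have mGs : measurable_fun setT (fun x => (G (s * x))%:E).
  by apply/measurable_EFinP; exact: continuous_measurable_fun.
rewrite (ge0_integral_normal_prob s mG); last by move=> x; rewrite lee_fin.
rewrite (ge0_integral_normal_prob 1 mGs); last by move=> x; rewrite lee_fin.
have dF (x : R) : is_derive x (1 : R) (fun y : R => s * y) s.
  by apply: is_derive_eq; rewrite /GRing.scale/= mulr1.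
have F'E : ((fun y : R => s * y)^`())%classic = cst s.
  by apply/funext => x; rewrite derive1E; exact: derive_val.
have := @increasing_ge0_integration_by_substitutionT R (fun y => s * y)
  (fun x => G x * normal_pdf 0 s x).
rewrite F'E.
under eq_integral do rewrite EFinM.
move=> ->//.
- apply: eq_integral => x _; rewrite /= -EFinM; congr (_%:E).
  by rewrite -(normal_pdf_scale x s0) mulrA.
- by move=> x y xy; rewrite ltr_pM2l.
- by move=> x; exact: cvg_cst.
- exact: is_cvg_cst.
- exact: is_cvg_cst.
- apply/gt0_cvgMrNy => //.
- apply/gt0_cvgMry => //.
- move=> x; apply: cvgM; first exact: cG.
  by apply: continuous_normal_pdf; rewrite gt_eqF.
- by move=> x; rewrite mulr_ge0// normal_pdf_ge0.
Qed.

Lemma normal_pdfN (x : R) : normal_pdf 0 1 (- x) = normal_pdf 0 1 x.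
Proof. by rewrite !normal_pdfE ?oner_eq0// /normal_fun !subr0 sqrrN. Qed.

Lemma ge0_integral_normal_sym (G : R -> R) : measurable_fun setT G ->
  (forall x, 0 <= G x) ->
  (\int[N01]_x (G x)%:E = \int[N01]_x (G (- x))%:E)%E.
Proof.
move=> mG G0.
have mN : measurable_fun setT (-%R : measurableTypeR R -> measurableTypeR R).
  exact: oppr_measurable.
have mG1 : measurable_fun setT (fun x => (G x)%:E) by exact/measurable_EFinP.
have mG2 : measurable_fun setT (fun x : R => (G (- x))%:E).
  by apply/measurable_EFinP; exact: (measurableT_comp mG mN).
rewrite (ge0_integral_normal_prob 1 mG1); last by move=> x; rewrite lee_fin.
rewrite (ge0_integral_normal_prob 1 mG2); last by move=> x; rewrite lee_fin.
transitivity (\int[pushforward mu (-%R : _ -> measurableTypeR R)]_x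
    ((G x)%:E * (normal_pdf 0 1 x)%:E))%E.
  by apply: eq_measure_integral => A mA _; exact/esym/lebesgue_measureN.
have mGp : measurable_fun setT (fun x => ((G x)%:E * (normal_pdf 0 1 x)%:E)%E).
  apply: emeasurable_funM => //; apply/measurable_EFinP.
  exact: measurable_normal_pdf.
apply: (etrans (ge0_integral_pushforward mN mu measurableT mGp _)).
  by move=> x _; rewrite mule_ge0// lee_fin ?normal_pdf_ge0.
by apply: eq_integral => x _; rewrite /= normal_pdfN.
Qed.

End Normal.

(** * Moments of the standard normal law *)

Section NormalMoments.
Context (R : realType).
Local Notation N01 := (normal_prob 0 1 : probability (measurableTypeR R) R).

Lemma normal_pdf_tilt (s x : R) : 0 < s ->
  expR ((1 - s ^- 2) / 2 * x ^+ 2) * normal_pdf 0 1 x = s * normal_pdf 0 s x.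
Proof.
move=> s0; have E := normal_pdf_scale (x / s) s0.
have sn : s != 0 by rewrite gt_eqF.
rewrite [s * (x / s)]mulrC divfK// in E.
rewrite [RHS]mulrC E !normal_pdfE ?oner_eq0//.
rewrite mulrCA; congr (_ * _); rewrite /normal_fun !subr0 expr1n -expRD.
by congr expR; field.
Qed.

                                                                                                                                                                 
(** Tilting the standard normal density by this exponential gives [s] times the density of standard
    deviation [s]. The case [s > 1] bounds even moments; [s] slightly below 1 yields the
    variance. *)
Lemma N01_exp_sqr (s : R) : 0 < s ->
  let f := fun x : R => expR ((1 - s ^- 2) / 2 * x ^+ 2) in
  L1 N01 f /\ Ex N01 f = s.
Proof.
move=> s0 f.
have mf : measurable_fun setT f.
  by apply: (measurableT_comp (@measurable_expR R)); exact: measurable_funM.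
have mfE : measurable_fun setT (EFin \o f) by exact/measurable_EFinP.
have I : (\int[N01]_x (f x)%:E = s%:E)%E.
  rewrite (ge0_integral_normal_prob 1 mfE); last by move=> x; rewrite lee_fin expR_ge0.
  transitivity (\int[lebesgue_measure]_x (s%:E * (normal_pdf 0 s x)%:E))%E.
    by apply: eq_integral => x _; rewrite /= -!EFinM normal_pdf_tilt.
  have mp : measurable_fun setT (fun x => (normal_pdf 0 s x)%:E).
    by apply/measurable_EFinP; exact: measurable_normal_pdf.
  rewrite ge0_integralZl//.
  - by rewrite integral_normal_pdf mule1.
  - by move=> x _; rewrite lee_fin normal_pdf_ge0.
  - by rewrite lee_fin ltW.
have Lf : L1 N01 f.
  apply/integrableP; split => //.
  under eq_integral do rewrite gee0_abs ?lee_fin ?expR_ge0//.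
  by rewrite I ltry.
by split=> //; apply: EFin_inj; rewrite -Ex_EFin.
Qed.

Lemma expR_ge_sqr (t : R) : 0 <= t -> t ^+ 2 / 4 <= expR t.
Proof.
move=> t0; have h := expR_ge1Dx (t / 2).
have -> : expR t = expR (t / 2) ^+ 2 by rewrite -expRM_natl; congr expR; field.
have -> : t ^+ 2 / 4 = (t / 2) ^+ 2 by field.
by rewrite lerXn2r ?nnegrE ?expR_ge0 ?divr_ge0//; lra.
Qed.

Lemma L1_N01_pow4 : L1 N01 (fun x : R => (x ^+ 2) ^+ 2).
Proof.
have [L _] := @N01_exp_sqr 2 (ltac:(by [])).
apply: (L1_le _ (L1Z 64 L)); first by do 2 apply: measurable_funX.
move=> x; rewrite ger0_norm ?sqr_ge0//.
have y0 : 0 <= (1 - 2 ^- 2) / 2 * x ^+ 2 by rewrite mulr_ge0 ?sqr_ge0//; lra.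
have := expR_ge_sqr y0; set e := expR _; rewrite exprMn.
have := sqr_ge0 (x ^+ 2); set z := (x ^+ 2) ^+ 2.
have -> : ((1 - 2 ^- 2) / 2) ^+ 2 = 9 / 64 :> R by field.
lra.
Qed.

Lemma L1_N01_sqr : L1 N01 (fun x : R => x ^+ 2).
Proof. by apply: L1_of_sq; [exact: measurable_funX|exact: L1_N01_pow4]. Qed.

(** Differentiate [N01_exp_sqr] at [s = 1] by a squeeze. With [s = 1 - dl] and [a = (s^-2 - 1) / 2],
    the bounds [1 - y <= expR (- y) <= 1 - y + y^2 / 2] at [y = a x^2] give
    [dl / a <= v <= dl / a + a K / 2], where [dl / a] tends to 1 and [a] to 0. *)
Lemma Ex_N01_sqr : Ex N01 (fun x : R => x ^+ 2) = 1.
Proof.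
pose v := Ex N01 (fun x : R => x ^+ 2); pose K := Ex N01 (fun x : R => (x ^+ 2) ^+ 2).
have K0 : 0 <= K by apply: Ex_ge0 => x; exact: sqr_ge0.
have main (dl : R) : 0 < dl <= 2^-1 -> 1 - 2 * dl <= v <= 1 + 4 * dl * K.
  move=> /andP[d0 d1]; pose s : R := 1 - dl.
  have s0 : 0 < s by rewrite /s; lra.
  have [L E] := N01_exp_sqr s0.
  pose a := (s ^- 2 - 1) / 2.
  have aE : a = dl * (2 - dl) / (2 * s ^+ 2).
    by rewrite /a /s; field; rewrite -/s gt_eqF.
  have a0 : 0 < a by rewrite aE divr_gt0// mulr_gt0 ?exprn_gt0//; lra.
  have a4 : a <= 4 * dl.
    rewrite aE ler_pdivrMr; last by rewrite mulr_gt0 ?exprn_gt0.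
    have h : 1 / 4 <= s ^+ 2.
      have -> : 1 / 4 = (2^-1) ^+ 2 :> R by field.
      by rewrite lerXn2r ?nnegrE ?(ltW s0)// /s; lra.
    have : dl * (1/4) <= dl * s ^+ 2 by rewrite ler_wpM2l// ltW.
    have := mulr_gt0 d0 d0; lra.
  have fE x : expR ((1 - s ^- 2) / 2 * x ^+ 2) = expR (- (a * x ^+ 2)).
    by congr expR; rewrite /a; field; rewrite gt_eqF.
  have Lc := L1_cst N01 (1 : R).
  have La : L1 N01 (fun x : R => 1 - a * x ^+ 2) by apply: L1B => //; exact/L1Z/L1_N01_sqr.
  have Lb : L1 N01 (fun x : R => 1 - a * x ^+ 2 + a ^+ 2 / 2 * (x ^+ 2) ^+ 2).
    by apply: L1D => //; exact/L1Z/L1_N01_pow4.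
  have Ea : Ex N01 (fun x : R => 1 - a * x ^+ 2) = 1 - a * v.
    by rewrite (ExB Lc (L1Z a L1_N01_sqr)) (ExZ _ L1_N01_sqr) Ex_cst.
  have Eb : Ex N01 (fun x : R => 1 - a * x ^+ 2 + a ^+ 2 / 2 * (x ^+ 2) ^+ 2) =
      1 - a * v + a ^+ 2 / 2 * K.
    by rewrite (ExD La (L1Z (a ^+ 2 / 2) L1_N01_pow4)) Ea (ExZ _ L1_N01_pow4).
  have h1 : 1 - a * v <= s.
    rewrite -E -Ea; apply: le_Ex => // x; rewrite fE.
    by have := expR_ge1Dx (- (a * x ^+ 2)).
  have h2 : s <= 1 - a * v + a ^+ 2 / 2 * K.
    rewrite -E -Eb; apply: le_Ex => // x; rewrite fE.
    have y0 : 0 <= a * x ^+ 2 by rewrite mulr_ge0 ?sqr_ge0// ltW.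
    have := norm_expRN_sub y0; rewrite ler_norml exprMn => /andP[_].
    set u := expR _; lra.
  have dla : dl / a = 2 * s ^+ 2 / (2 - dl).
    by rewrite aE; field; rewrite !gt_eqF//=; lra.
  have h3 : dl / a <= 1.
    rewrite dla ler_pdivrMr; last lra.
    have dd : dl * dl <= dl * 2^-1 by rewrite ler_wpM2l// ltW.
    rewrite /s; lra.
  have h4 : 1 - 2 * dl <= dl / a.
    rewrite dla ler_pdivlMr; last lra.
    rewrite /s; have := mulr_gt0 d0 d0; lra.
  apply/andP; split.
    rewrite (le_trans h4)// ler_pdivrMr// mulrC; rewrite /s in h1; lra.
  have : v <= dl / a + a / 2 * K.
    rewrite -(ler_pM2l a0) mulrDr.
    have -> : a * (dl / a) = dl by field; rewrite gt_eqF.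
    have -> : a * (a / 2 * K) = a ^+ 2 / 2 * K by field.
    by rewrite /s in h2; lra.
  have : a / 2 * K <= 4 * dl * K by rewrite ler_wpM2r//; lra.
  lra.
apply/eqP; rewrite eq_le -/v; apply/andP; split.
  apply/ler_addgt0Pl => e e0.
  pose dl := Num.min 2^-1 (e / (4 * (K + 1))).
  have K1 : 0 < 4 * (K + 1) by lra.
  have d0 : 0 < dl by rewrite lt_min invr_gt0 ltr0n/= divr_gt0.
  have /main/andP[_ h] : 0 < dl <= 2^-1 by rewrite d0 ge_min lexx.
  have : dl * (4 * (K + 1)) <= e by rewrite -ler_pdivlMr// ge_min lexx orbT.
  lra.
apply/ler_addgt0Pl => e e0.
pose dl := Num.min 2^-1 (e / 2).
have d0 : 0 < dl by rewrite lt_min invr_gt0 ltr0n/= divr_gt0.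
have /main/andP[h _] : 0 < dl <= 2^-1 by rewrite d0 ge_min lexx.
have : dl <= e / 2 by rewrite ge_min lexx orbT.
lra.
Qed.

(** Symmetry of the law is available for nonnegative integrands, so it is applied to [|f| + f],
    whose reflection is [|f| - f]. *)
Lemma Ex_N01_odd (f : R -> R) : measurable_fun setT f -> (forall x, f (- x) = - f x) ->
  L1 N01 f -> Ex N01 f = 0.
Proof.
move=> mf fN Lf.
have mg : measurable_fun setT (fun x : R => `|f x| + f x).
  by apply: measurable_funD => //; exact: measurableT_comp.
have g0 x : 0 <= `|f x| + f x by have := lerNnormlW (lexx `|f x|); lra.
have := ge0_integral_normal_sym mg g0.
under [X in _ = X -> _]eq_integral do rewrite fN normrN.
have La := L1_abs Lf.
rewrite !Ex_EFin; [|exact: (L1B La Lf)|exact: (L1D La Lf)].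
move=> [].
rewrite (ExD La Lf) (ExB La Lf); lra.
Qed.

End NormalMoments.

(** * Almost sure equality, and independence of derived variables *)

Section ExAlmostEverywhere.
Context d (T : measurableType d) (R : realType) (P : probability T R).

Lemma Ex_ae_eq (f g : T -> R) : measurable_fun setT f -> measurable_fun setT g ->
  {ae P, forall w, f w = g w} -> Ex P f = Ex P g.
Proof.
move=> mf mg fg; congr fine; apply: ae_eq_integral => //; try exact/measurable_EFinP.
by apply: filterS fg => w + _ => /= ->.
Qed.

End ExAlmostEverywhere.

Section IndependentRVs.
Context d (T : measurableType d) (R : realType) (P : probability T R).

Lemma independent_RVs_sub (I : choiceType) (F : I -> set_system T) (X : I -> T -> R) :
  independent_classes P F ->
  (forall i (A : set R), measurable A -> F i (X i @^-1` A)) -> independent_RVs P X.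
Proof.
move=> iF XF J A AX; apply: iF => i iJ.
by have [B mB <-] := AX i iJ; rewrite setTI; exact: XF.
Qed.

Lemma independent_RVs_comp (I : choiceType) d' (E : measurableType d') (X : I -> T -> E)
    (f : I -> E -> R) : (forall i, measurable_fun setT (f i)) ->
  independent_RVs P X -> independent_RVs P (fun i w => f i (X i w)).
Proof.
move=> mf iX; apply: (independent_RVs_sub iX) => i A mA.
exists (f i @^-1` A) => //; last by rewrite setTI.
by rewrite -[X in measurable X]setTI; exact: mf.
Qed.

End IndependentRVs.

(** * Moments of centred Gaussian variables *)

Section GaussianVariable.
Context d (T : measurableType d) (R : realType) (P : probability T R).
Local Notation N01 := (normal_prob 0 1 : probability (measurableTypeR R) R).

Definition gaussian_rv (X : T -> R) (s : R) : Prop :=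
  measurable_fun setT X /\ forall A : set R, measurable A -> P (X @^-1` A) = normal_prob 0 s A.

Lemma gaussian_transfer (X : T -> R) (s : R) (G : R -> R) : gaussian_rv X s -> 0 < s ->
  continuous G -> (forall x, 0 <= G x) -> L1 N01 (fun x => G (s * x)) ->
  L1 P (fun w => G (X w)) /\ Ex P (fun w => G (X w)) = Ex N01 (fun x => G (s * x)).
Proof.
move=> [mX PX] s0 cG G0 LG.
have mG : measurable_fun setT (EFin \o G).
  by apply/measurable_EFinP; exact: continuous_measurable_fun.
have E : (\int[P]_w (G (X w))%:E = \int[N01]_x (G (s * x))%:E)%E.
  rewrite -(ge0_integral_normal_scale s0 cG G0).
  have mX' : measurable_fun setT (X : T -> measurableTypeR R) by exact: mX.
  have mG' : measurable_fun (setT : set (measurableTypeR R)) (EFin \o G) by exact: mG.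
  apply: (etrans (esym (ge0_integral_pushforward mX' P measurableT mG' _))).
    by move=> x _; rewrite /= lee_fin.
  by apply: eq_measure_integral => A mA _; exact: PX.
have mGX : measurable_fun setT (fun w => G (X w)).
  by apply: measurableT_comp => //; exact: continuous_measurable_fun.
have LX : L1 P (fun w => G (X w)).
  apply/integrableP; split; first exact/measurable_EFinP.
  under eq_integral do rewrite gee0_abs ?lee_fin//.
  by rewrite E Ex_EFin// ltry.
by split=> //; apply: EFin_inj; rewrite -!Ex_EFin.
Qed.

Lemma gaussian_sqr (X : T -> R) (s : R) : gaussian_rv X s -> 0 < s ->
  L1 P (fun w => X w ^+ 2) /\ Ex P (fun w => X w ^+ 2) = s ^+ 2.
Proof.
move=> gX s0.
have E : (fun x : R => (s * x) ^+ 2) = (fun x => s ^+ 2 * x ^+ 2).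
  by apply/funext => x; rewrite exprMn.
have [||| L ->] := @gaussian_transfer X s (fun x => x ^+ 2) gX s0.
- exact: sqr_continuous.
- by move=> x; exact: sqr_ge0.
- by rewrite E; apply: L1Z; exact: L1_N01_sqr.
by rewrite E ExZ ?Ex_N01_sqr ?mulr1//; exact: L1_N01_sqr.
Qed.

(** [gaussian_transfer] speaks of nonnegative functions; the mean is recovered as the difference of
    the expectations of [|x| + x] and [|x|]. *)
Lemma gaussian_mean (X : T -> R) (s : R) : gaussian_rv X s -> 0 < s -> Ex P X = 0.
Proof.
move=> gX s0; have [L _] := gaussian_sqr gX s0.
have LX := L1_of_sq gX.1 L.
have Lid : L1 N01 (fun x : R => x).
  by apply: L1_of_sq; [exact: measurable_id|exact: L1_N01_sqr].
have Labs := L1_abs Lid.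
have Eabs : (fun x : R => `|s * x|) = (fun x => s * `|x|).
  by apply/funext => x; rewrite normrM gtr0_norm.
have Esum : (fun x : R => `|s * x| + s * x) = (fun x => s * `|x| + s * x).
  by apply/funext => x; rewrite normrM gtr0_norm.
have [||| L1' E1] := @gaussian_transfer X s (fun x => `|x|) gX s0.
- exact: norm_continuous.
- by move=> x; exact: normr_ge0.
- by rewrite Eabs; exact: L1Z.
have [||| L2' E2] := @gaussian_transfer X s (fun x => `|x| + x) gX s0.
- by move=> x; apply: cvgD; [exact: norm_continuous|exact: cvg_id].
- by move=> x; have := lerNnormlW (lexx `|x|); lra.
- by rewrite Esum; apply: L1D; exact: L1Z.
move: E2; rewrite (ExD L1' LX) E1 Esum Eabs (ExD (L1Z s Labs) (L1Z s Lid)).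
have -> : Ex N01 (fun x : R => s * x) = 0.
  by rewrite (ExZ s Lid) Ex_N01_odd ?mulr0.
by rewrite addr0 => /(congr1 (fun z => z - Ex N01 (fun x : R => s * `|x|))); rewrite addrAC subrr add0r.
Qed.

Lemma gaussian_min_cube (X : T -> R) (s a : R) : gaussian_rv X s -> 0 < s -> 0 <= a ->
  Ex P (fun w => Num.min ((a * `|X w|) ^+ 2) ((a * `|X w|) ^+ 3)) =
  Ex N01 (fun x => Num.min ((a * s * `|x|) ^+ 2) ((a * s * `|x|) ^+ 3)).
Proof.
move=> gX s0 a0.
have E : (fun x : R => Num.min ((a * `|s * x|) ^+ 2) ((a * `|s * x|) ^+ 3)) =
   (fun x => Num.min ((a * s * `|x|) ^+ 2) ((a * s * `|x|) ^+ 3)).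
  by apply/funext => x; rewrite normrM (gtr0_norm s0) mulrA.
have as0 : 0 <= a * s by rewrite mulr_ge0// ltW.
have [||| L ->] := @gaussian_transfer X s
  (fun x => Num.min ((a * `|x|) ^+ 2) ((a * `|x|) ^+ 3)) gX s0.
- have cX n (x : R) : {for x, continuous (fun y : R => (a * `|y|) ^+ n)}.
    apply: (@continuous_comp _ _ _ (fun y : R => a * `|y|) (fun y : R => y ^+ n)).
      by apply: cvgMr; exact: norm_continuous.
    exact: exprn_continuous.
  by move=> x; exact: (@continuous_min R R (fun y : R => (a * `|y|) ^+ 2)
    (fun y : R => (a * `|y|) ^+ 3) x (cX 2%N x) (cX 3%N x)).
- by move=> x; rewrite le_min !exprn_ge0 ?mulr_ge0.
- rewrite E; apply: (L1_le _ (L1Z ((a * s) ^+ 2) (L1_N01_sqr R))).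
    apply: measurable_minr; apply: measurable_funX; apply: measurable_funM => //;
      exact: measurableT_comp.
  move=> x; rewrite ger0_norm; last by rewrite le_min !exprn_ge0 ?(mulr_ge0 as0).
  by rewrite ge_min exprMn real_normK ?num_real// lexx.
by rewrite E.
Qed.

End GaussianVariable.

(** * Characteristic function of Brownian increments *)

Section BrownianMotion.
Context d (T : measurableType d) (R : realType) (P : probability T R).
Variable B : R -> T -> R.
Hypothesis hB : standard_BM P B.
Local Notation N01 := (normal_prob 0 1 : probability (measurableTypeR R) R).

Lemma BM_increment_gaussian s t : 0 <= s -> s < t ->
  gaussian_rv P (fun w => B t w - B s w) (Num.sqrt (t - s)).
Proof.
move=> s0 st; split; last by move=> A mA; exact: (BM_gaussian_increments hB).
by apply: measurable_funB; apply: (BM_measurable hB) => //; rewrite (le_trans s0)// ltW.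
Qed.

Lemma BM_increment_cos_small (u eta : R) : 0 < eta -> exists2 h0 : R, 0 < h0 &
  forall s t c, 0 <= s -> s < t -> t - s <= h0 ->
  `|Ex P (fun w => cos (c + u * (B t w - B s w))) -
    expR (- (u ^+ 2 * (t - s) / 2)) * cos c| <= eta * (t - s).
Proof.
move=> eta0; pose a := `|u|; have a0 : 0 <= a by exact: normr_ge0.
have a20 : 0 <= a ^+ 2 by rewrite exprn_ge0.
pose e1 := eta / (4 * (a ^+ 2 + 1)).
have e10 : 0 < e1 by rewrite divr_gt0// mulr_gt0// ltr_wpDl.
have e1E : 2 * (e1 * a ^+ 2) <= eta / 2.
  have : e1 * (4 * (a ^+ 2 + 1)) = eta by rewrite /e1 divfK// gt_eqF// mulr_gt0// ltr_wpDl.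
  have := ltW e10; lra.
have Lsq : L1 N01 (fun x : R => `|x| ^+ 2).
  by apply: (L1_ext _ (L1_N01_sqr R)) => x; rewrite real_normK ?num_real.
have mab : measurable_fun (setT : set (measurableTypeR R)) (fun x : R => `|x|).
  exact: normr_measurable.
have [dl dl0 hdl] := min_cube_small mab Lsq (fun x => normr_ge0 x) e10.
(* The first bound gives [a sqrt (t - s) <= dl], as [min_cube_small] demands; the second gives
   [a^4 (t - s) <= eta / 2], for the squared-variance term. *)
pose h0 := Num.min ((dl / (a + 1)) ^+ 2) (eta / (2 * (a ^+ 4 + 1))).
have a1 : 0 < a + 1 by rewrite ltr_wpDl.
have a41 : 0 < a ^+ 4 + 1 by rewrite ltr_wpDl// exprn_ge0.
exists h0; first by rewrite lt_min exprn_gt0 ?divr_gt0// mulr_gt0.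
move=> s t c s0 st; rewrite le_min => /andP[h1 h2].
have ts : 0 < t - s by rewrite subr_gt0.
have gX := BM_increment_gaussian s0 st.
set sg := Num.sqrt (t - s) in gX.
have sg0 : 0 < sg by rewrite sqrtr_gt0.
have sg2 : sg ^+ 2 = t - s by rewrite sqr_sqrtr// ltW.
have [LX EX] := gaussian_sqr gX sg0; rewrite sg2 in EX.
pose X w := B t w - B s w.
have mX : measurable_fun setT X := gX.1.
have muX : measurable_fun setT (fun w => u * X w) by exact: measurable_funM.
have mY : measurable_fun setT (fun w => a * `|X w|).
  by apply: measurable_funM => //; exact: measurableT_comp.
have Ysq : (fun w => (a * `|X w|) ^+ 2) = (fun w => a ^+ 2 * X w ^+ 2).
  by apply/funext => w; rewrite exprMn (real_normK (num_real (X w))).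
have LY : L1 P (fun w => (a * `|X w|) ^+ 2) by rewrite Ysq; exact: L1Z.
have EY : Ex P (fun w => (a * `|X w|) ^+ 2) = a ^+ 2 * (t - s).
  by rewrite Ysq (ExZ _ LX) EX.
have EuX2 : Ex P (fun w => (u * X w) ^+ 2) = u ^+ 2 * (t - s).
  rewrite -EX -(ExZ _ LX); apply: eq_Ex => w; exact: exprMn.
have EuX : Ex P (fun w => u * X w) = 0.
  by rewrite (ExZ _ (L1_of_sq mX LX)) (gaussian_mean gX sg0) mulr0.
have := Ex_cos_step muX mY LY (fun w => _) EuX c.
rewrite EuX2 EY (gaussian_min_cube gX sg0 a0) => H.
apply: (le_trans (H _)); first by move=> w; rewrite normrM.
have asg : 0 <= a * sg <= dl.
  rewrite mulr_ge0 ?(ltW sg0)//=.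
  have : sg <= dl / (a + 1).
    by rewrite -(@ler_pXn2r _ 2) ?nnegrE ?(ltW sg0) ?sg2// divr_ge0// ltW.
  rewrite ler_pdivlMr// mulrDr mulr1; have := ltW sg0; lra.
have := hdl _ asg; rewrite exprMn sg2 => H2.
have h3 : (a ^+ 2 * (t - s)) ^+ 2 <= eta / 2 * (t - s).
  have -> : (a ^+ 2 * (t - s)) ^+ 2 = (a ^+ 4 * (t - s)) * (t - s) by ring.
  rewrite ler_wpM2r ?(ltW ts)//.
  have : (t - s) * (2 * (a ^+ 4 + 1)) <= eta by rewrite -ler_pdivlMr// mulr_gt0.
  have := ltW ts; lra.
have := ler_wpM2r (ltW ts) e1E.
lra.
Qed.

(** Cut [[s, t]] into [n] equal pieces. The short increments are independent and each contributes
    its exponential factor up to an error proportional to its length, so the errors add up to an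
    arbitrary [e] while the factors multiply to the exact exponential. *)
Lemma BM_increment_cos u s t c : 0 <= s -> s < t ->
  Ex P (fun w => cos (c + u * (B t w - B s w))) = expR (- (u ^+ 2 * (t - s) / 2)) * cos c.
Proof.
move=> s0 st; have ts : 0 < t - s by rewrite subr_gt0.
apply/eqP; rewrite -subr_eq0 -normr_eq0 eq_le normr_ge0 andbT.
apply/ler_addgt0Pl => e e0; rewrite addr0.
have e1 : 0 < e / (t - s) by rewrite divr_gt0.
have [h0 h00 H] := BM_increment_cos_small u e1.
pose n := (Num.truncn ((t - s) / h0)).+1.
have n0 : 0 < n%:R :> R by rewrite ltr0n.
have nh : (t - s) / n%:R <= h0.
  by rewrite ler_pdivrMr// mulrC -ler_pdivrMr// ltW// truncnS_gt.
pose tt (i : nat) := s + i%:R * ((t - s) / n%:R).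
have ttS i : tt i.+1 - tt i = (t - s) / n%:R by rewrite /tt mulrSr; ring.
have tt0 i : 0 <= tt i by rewrite addr_ge0// mulr_ge0// divr_ge0// ltW.
have ttlt i : tt i < tt i.+1 by rewrite -subr_gt0 ttS divr_gt0.
have ttnd : nondecreasing_seq tt by apply/nondecreasing_seqP => i; exact/ltW.
have iI := BM_independent_increments hB (tt0 0%N) ttnd.
pose X i w := u * (B (tt i.+1) w - B (tt i) w).
have mI i : measurable_fun setT (fun w => B (tt i.+1) w - B (tt i) w).
  by apply: measurable_funB; exact: (BM_measurable hB).
have mX i : measurable_fun setT (X i) by exact: measurable_funM.
have iX : independent_RVs P X.
  by apply: (@independent_RVs_comp _ _ _ P _ _ _ _ (fun _ x => u * x)) => // _; exact: measurable_funM.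
pose b := expR (- (u ^+ 2 * ((t - s) / n%:R) / 2)).
have b01 : 0 <= b <= 1.
  rewrite expR_ge0/= /b -[leRHS]expR0 ler_expR oppr_le0.
  by rewrite divr_ge0// mulr_ge0 ?sqr_ge0// divr_ge0// ltW.
have := @Ex_cos_fsum _ _ _ P _ X (iota 0 n) (fun=> b)
  (fun=> e / (t - s) * ((t - s) / n%:R)) mX iX (iota_uniq _ _) (fun _ _ => b01).
have h i c' : i \in iota 0 n ->
    `|Ex P (fun w => cos (c' + X i w)) - b * cos c'| <= e / (t - s) * ((t - s) / n%:R).
  by move=> _; have := H _ _ c' (tt0 i) (ttlt i); rewrite ttS; exact.
move=> /(_ h c).
have -> : \sum_(i <- iota 0 n) (e / (t - s) * ((t - s) / n%:R)) = e.
  rewrite big_const_seq count_predT size_iota iter_addr_0 -mulr_natl.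
  by field; rewrite !gt_eqF.
have -> : \prod_(i <- iota 0 n) b = expR (- (u ^+ 2 * (t - s) / 2)).
  rewrite big_const_seq count_predT size_iota iter_mulr_1 -expRM_natl.
  by congr expR; field; rewrite gt_eqF.
congr (`|Ex P _ - _| <= _); apply/funext => w; congr (cos (c + _)).
rewrite /fsum /X -mulr_sumr; congr (_ * _).
have := @telescope_sumr R 0 n (fun i => B (tt i) w) (leq0n n).
rewrite /index_iota subn0 => ->.
by rewrite /tt mul0r addr0 mulrC divfK ?gt_eqF// subrKC.
Qed.

End BrownianMotion.

(** * Quadratic forms in indicators of initial segments *)

Section IndicatorSums.
Context (R : realType).

Lemma sum_nat_lt (N m : nat) (D : nat -> R) : (m <= N)%N ->
  \sum_(0 <= i < N) (i < m)%:R * D i = \sum_(0 <= i < m) D i.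
Proof.
move=> mN; rewrite (@big_cat_nat _ _ _ m)//=.
have -> : \sum_(m <= i < N) (i < m)%:R * D i = 0.
  by rewrite big_nat big1// => i /andP[mi _]; rewrite ltnNge mi/= mul0r.
rewrite addr0 big_nat [RHS]big_nat; apply: eq_bigr => i /andP[_ im].
by rewrite im mul1r.
Qed.

(** Expanding the square turns products of indicators into indicators of minima. This is where the
    covariance [min (s, t)] comes from, both for Brownian increments and for steps of the walk. *)
Lemma sum_indicator_sqr (N K : nat) (n : nat -> nat) (D u : nat -> R) :
  (forall k, (k < K)%N -> (n k <= N)%N) ->
  \sum_(0 <= i < N) D i * (\sum_(0 <= k < K) u k * (i < n k)%:R) ^+ 2 =
  \sum_(0 <= k < K) \sum_(0 <= l < K) u k * u l * \sum_(0 <= i < minn (n k) (n l)) D i.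
Proof.
move=> nN.
transitivity (\sum_(0 <= i < N) \sum_(0 <= k < K) \sum_(0 <= l < K)
    u k * u l * ((i < minn (n k) (n l))%:R * D i)).
  apply: eq_bigr => i _; rewrite expr2 mulr_suml mulr_sumr; apply: eq_bigr => k _.
  rewrite mulr_sumr mulr_sumr; apply: eq_bigr => l _.
  by rewrite leq_min -mulnb natrM; ring.
rewrite exchange_big/=; rewrite big_nat [RHS]big_nat; apply: eq_bigr => k /andP[_ kK].
rewrite exchange_big/=; rewrite big_nat [RHS]big_nat; apply: eq_bigr => l /andP[_ lK].
by rewrite -mulr_sumr sum_nat_lt// geq_min nN.
Qed.

End IndicatorSums.

(** * Finite-dimensional distributions of Brownian motion *)

Section BrownianFdd.
Context d (T : measurableType d) (R : realType) (P : probability T R).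
Variables (tau : nat -> R) (K : nat).
Hypothesis tau0 : 0 < tau 0%N.
Hypothesis tauS : forall i, tau i < tau i.+1.

(** The variance of the sum of [u k * B (tau k)]: since [tau] increases, [tau (minn k l)] is the
    covariance of the two values. *)
Definition gram (u : nat -> R) : R :=
  \sum_(0 <= k < K) \sum_(0 <= l < K) u k * u l * tau (minn k l).

Lemma BM_fdd_cos (B : R -> T -> R) (u : nat -> R) (c : R) : standard_BM P B ->
  Ex P (fun w => cos (c + \sum_(0 <= k < K) u k * (B (tau k) w - B 0 w))) =
  expR (- (gram u / 2)) * cos c /\ 0 <= gram u.
Proof.
(* The time 0 is put in front of [tau], so [B (tau k) - B 0] is the sum of the first [k + 1]
   increments; hence the indices [k.+1] below. *)
move=> hB; pose t (i : nat) := if i is j.+1 then tau j else 0.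
have tS i : t i < t i.+1 by case: i => [|i] /=.
have tnd : nondecreasing_seq t by apply/nondecreasing_seqP => i; exact/ltW.
have t0 i : 0 <= t i by have := tnd 0%N i (leq0n i).
pose a i := \sum_(0 <= k < K) u k * (i < k.+1)%:R.
have gE : gram u = \sum_(0 <= i < K) (t i.+1 - t i) * a i ^+ 2.
  rewrite sum_indicator_sqr; last by move=> k.
  apply: eq_bigr => k _; apply: eq_bigr => l _.
  by rewrite telescope_sumr ?leq0n// minnSS/= subr0.
split; last first.
  by rewrite gE sumr_ge0// => i _; rewrite mulr_ge0 ?sqr_ge0// subr_ge0 ltW.
pose X i w := a i * (B (t i.+1) w - B (t i) w).
have mI i : measurable_fun setT (fun w => B (t i.+1) w - B (t i) w).
  by apply: measurable_funB; exact: (BM_measurable hB).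
have mX i : measurable_fun setT (X i) by exact: measurable_funM.
have iX : independent_RVs P X.
  apply: (@independent_RVs_comp _ _ _ P _ _ _ _ (fun i x => a i * x)).
    by move=> i; exact: measurable_funM.
  exact: (BM_independent_increments hB).
pose b i := expR (- (a i ^+ 2 * (t i.+1 - t i) / 2)).
have b01 i : 0 <= b i <= 1.
  rewrite expR_ge0/= /b -[leRHS]expR0 ler_expR oppr_le0.
  by rewrite divr_ge0// mulr_ge0 ?sqr_ge0// subr_ge0 ltW.
have := @Ex_cos_fsum _ _ _ P _ X (index_iota 0 K) b (fun=> 0) mX iX (iota_uniq _ _)
  (fun i _ => b01 i).
have h i c' : i \in index_iota 0 K ->
    `|Ex P (fun w => cos (c' + X i w)) - b i * cos c'| <= 0.
  by move=> _; rewrite /X (BM_increment_cos hB)// subrr normr0.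
move=> /(_ h c); rewrite [X in _ <= X -> _]big1// normr_le0 subr_eq0 => /eqP.
have -> : \prod_(i <- index_iota 0 K) b i = expR (- (gram u / 2)).
  rewrite -(expR_sum (index_iota 0 K) xpredT (fun i => - (a i ^+ 2 * (t i.+1 - t i) / 2))).
  rewrite sumrN -mulr_suml gE; congr (expR (- (_ / 2))).
  by apply: eq_bigr => i _; rewrite mulrC.
move=> <-; apply: eq_Ex => w; congr (cos (c + _)).
rewrite /fsum /X.
transitivity (\sum_(0 <= k < K) \sum_(0 <= i < K) u k * ((i < k.+1)%:R * (B (t i.+1) w - B (t i) w))).
  rewrite big_nat [RHS]big_nat; apply: eq_bigr => k /andP[_ kK].
  rewrite -mulr_sumr sum_nat_lt// (@telescope_sumr _ _ _ (fun i => B (t i) w))//.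
rewrite exchange_big/=; apply: eq_bigr => i _.
by rewrite mulr_suml; apply: eq_bigr => k _; rewrite mulrA.
Qed.

Variables (p : nat) (W : R -> T -> 'cV[R]_p).
Hypothesis hW : standard_BM_vector P W.

Lemma tau_gt0 i : 0 < tau i.
Proof. by elim: i => // i IH; exact: lt_trans (tauS i). Qed.

Lemma measurable_BMV t (j : 'I_p) : 0 <= t -> measurable_fun setT (fun w => W t w j 0).
Proof. by move=> t0; exact: (BM_measurable (BMV_coord hW j)). Qed.

(** The coordinates are independent and each has an exact factor, so [Ex_cos_fsum] applies over the
    coordinates with zero errors. [W 0] is subtracted along the way and removed at the end, where it
    vanishes almost surely. *)
Lemma BMV_fdd_cos (u : nat -> 'I_p -> R) (c : R) :
  Ex P (fun w => cos (c + \sum_(j < p) \sum_(0 <= k < K) u k j * W (tau k) w j 0)) =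
  expR (- ((\sum_(j < p) gram (u ^~ j)) / 2)) * cos c.
Proof.
pose X j w := \sum_(0 <= k < K) u k j * (W (tau k) w j 0 - W 0 w j 0).
have tau_ge0 k : 0 <= tau k by exact/ltW/tau_gt0.
have mX j : measurable_fun setT (X j).
  apply: measurable_sum => k; apply: measurable_funM => //.
  by apply: measurable_funB; exact: measurable_BMV.
have iX : independent_RVs P X.
  apply: (independent_RVs_sub (BMV_independent hW)) => j A mA.
  set G := \bigcup_(t in _) _.
  have mW t : 0 <= t -> @measurable_fun _ _ (g_sigma_algebraType G) R setT (fun w => W t w j 0).
    move=> t0 _ C mC; apply: sub_sigma_algebra; exists t; first by rewrite /= in_itv/= t0.
    by exists C.
  have : @measurable_fun _ _ (g_sigma_algebraType G) R setT (X j).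
    apply: measurable_sum => k; apply: measurable_funM => //.
    by apply: measurable_funB; exact: mW.
  by move=> /(_ measurableT _ mA); rewrite setTI.
pose b j := expR (- (gram (u ^~ j) / 2)).
have bE j c' : Ex P (fun w => cos (c' + X j w)) = b j * cos c'.
  by have [] := BM_fdd_cos (u ^~ j) c' (BMV_coord hW j).
have b01 j : 0 <= b j <= 1.
  rewrite expR_ge0/= /b -[leRHS]expR0 ler_expR oppr_le0 divr_ge0//.
  by have [] := BM_fdd_cos (u ^~ j) 0 (BMV_coord hW j).
have := @Ex_cos_fsum _ _ _ P _ X (index_enum 'I_p) b (fun=> 0) mX iX
  (index_enum_uniq _) (fun i _ => b01 i).
have h j c' : j \in index_enum 'I_p ->
    `|Ex P (fun w => cos (c' + X j w)) - b j * cos c'| <= 0.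
  by move=> _; rewrite bE subrr normr0.
move=> /(_ h c); rewrite [X in _ <= X -> _]big1// normr_le0 subr_eq0 => /eqP.
have -> : \prod_(j <- index_enum 'I_p) b j = expR (- ((\sum_(j < p) gram (u ^~ j)) / 2)).
  rewrite -(expR_sum (index_enum 'I_p) xpredT (fun j => - (gram (u ^~ j) / 2))).
  by rewrite sumrN -mulr_suml.
move=> <-; apply: Ex_ae_eq.
- apply: (measurableT_comp (@measurable_cos R)); apply: measurable_funD => //.
  apply: measurable_sum => j; apply: measurable_sum => k; apply: measurable_funM => //.
  exact: measurable_BMV.
- apply: (measurableT_comp (@measurable_cos R)); apply: measurable_funD => //.
  exact: measurable_sum.
have W0 : {ae P, forall w, forall j : 'I_p, W 0 w j 0 = 0}.
  by apply: filter_forall => j; exact: (BM_start (BMV_coord hW j)).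
apply: filterS W0 => w W0; congr (cos (c + _)).
apply: eq_bigr => j _; apply: eq_bigr => k _; by rewrite W0 subr0.
Qed.

End BrownianFdd.

(** * First and second moments of the Brownian vector *)

Section BrownianMoments.
Context d (T : measurableType d) (R : realType) (P : probability T R).

Lemma L1_ae_eq (f g : T -> R) : measurable_fun setT f -> L1 P g ->
  {ae P, forall w, f w = g w} -> L1 P f.
Proof.
move=> mf Lg fg; have mg := L1_measurable Lg.
apply/integrableP; split; first exact/measurable_EFinP.
have [_ fin] := integrableP _ _ _ Lg.
rewrite (ae_eq_integral (abse \o (EFin \o g)))//.
- by apply: measurableT_comp => //; exact/measurable_EFinP.
- by apply: measurableT_comp => //; exact/measurable_EFinP.
- by apply: filterS fg => w + _ => /= ->.
Qed.

Variables (p : nat) (W : R -> T -> 'cV[R]_p).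
Hypothesis hW : standard_BM_vector P W.

Lemma BMV_moments t (j : 'I_p) : 0 < t ->
  [/\ L1 P (fun w => W t w j 0 ^+ 2), Ex P (fun w => W t w j 0 ^+ 2) = t &
      Ex P (fun w => W t w j 0) = 0].
Proof.
move=> t0; have mW s : 0 <= s -> measurable_fun setT (fun w => W s w j 0).
  by move=> s0; exact: (BM_measurable (BMV_coord hW j)).
have gX := BM_increment_gaussian (BMV_coord hW j) (lexx 0) t0.
rewrite subr0 in gX; have s0 : 0 < Num.sqrt t by rewrite sqrtr_gt0.
have [L E] := gaussian_sqr gX s0; rewrite sqr_sqrtr ?(ltW t0)// in E.
have M := gaussian_mean gX s0.
have W0 := BM_start (BMV_coord hW j); rewrite /coordinate in L E M W0.
have mWt := mW _ (ltW t0); have mW0 := mW _ (lexx 0).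
have ae2 : {ae P, forall w, W t w j 0 ^+ 2 = (W t w j 0 - W 0 w j 0) ^+ 2}.
  by apply: filterS W0 => w ->; rewrite subr0.
have ae1 : {ae P, forall w, W t w j 0 = W t w j 0 - W 0 w j 0}.
  by apply: filterS W0 => w ->; rewrite subr0.
split.
- by apply: L1_ae_eq ae2 => //; exact: measurable_funX.
- rewrite -[RHS]E; apply: Ex_ae_eq ae2; apply: measurable_funX => //.
  exact: measurable_funB.
- by rewrite -[RHS]M; apply: Ex_ae_eq ae1 => //; exact: measurable_funB.
Qed.

Lemma BMV_cross_moment t (i j : 'I_p) : 0 < t ->
  L1 P (fun w => W t w i 0 * W t w j 0) /\
  Ex P (fun w => W t w i 0 * W t w j 0) = t * (i == j)%:R.
Proof.
move=> t0; have mW k : measurable_fun setT (fun w => W t w k 0).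
  by apply: (BM_measurable (BMV_coord hW k)); exact: ltW.
have [Li Ei Mi] := BMV_moments i t0; have [Lj Ej Mj] := BMV_moments j t0.
have [<-|ij] := eqVneq i j.
  rewrite mulr1; split; first by apply: (L1_ext _ Li) => w; rewrite expr2.
  by rewrite -[RHS]Ei; apply: eq_Ex => w; rewrite expr2.
pose X (k : 'I_p) w := W t w k 0.
have iX : independent_RVs P X.
  apply: (independent_RVs_sub (BMV_independent hW)) => k A mA.
  apply: sub_sigma_algebra; exists t; first by rewrite /= in_itv/= ltW.
  by exists A => //; rewrite setTI.
have uji : uniq [:: j; i] by rewrite /= inE eq_sym ij.
have := indep2_fsum mW iX uji.
rewrite (_ : fsum X [:: i] = X i); last by apply/funext => w; rewrite /fsum big_seq1.
move=> I2; have [L ->] := indep2_ExM (mW i) (mW j) I2 (L1_of_sq (mW i) Li) (L1_of_sq (mW j) Lj).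
by split=> //; rewrite Mi mul0r mulr0.
Qed.

End BrownianMoments.

                        

(** * The random walk of the [Z i]: moments and one-step estimate *)

Section RandomWalk.
Context d (T : measurableType d) (R : realType) (P : probability T R).

Lemma Ex_fsum_sqr (I : choiceType) (X : I -> T -> R) (s : seq I) :
  (forall i, measurable_fun setT (X i)) -> independent_RVs P X -> uniq s ->
  (forall i, L1 P (fun w => X i w ^+ 2)) -> (forall i, Ex P (X i) = 0) ->
  (forall i, Ex P (fun w => X i w ^+ 2) = 1) ->
  L1 P (fun w => fsum X s w ^+ 2) /\ Ex P (fun w => fsum X s w ^+ 2) = (size s)%:R.
Proof.
move=> mX iX + LX X0 X1; elim: s => [_|i s IH /[dup] uis /= /andP[si us]].
  have E : (fun w => fsum X [::] w ^+ 2) = fun=> 0.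
    by apply/funext => w; rewrite /fsum big_nil expr0n.
  by rewrite E Ex_cst; split => //; exact: (L1_cst P 0).
have [LS ES] := IH us.
have mS : measurable_fun setT (fsum X s) by exact: measurable_sum.
have L1X := L1_of_sq (mX i) (LX i); have L1S := L1_of_sq mS LS.
have [LM EM] := indep2_ExM mS (mX i) (indep2_fsum mX iX uis) L1S L1X.
have E : (fun w => fsum X (i :: s) w ^+ 2) =
    (fun w => (X i w ^+ 2 + fsum X s w ^+ 2) + 2 * (fsum X s w * X i w)).
  by apply/funext => w; rewrite /fsum big_cons; ring.
rewrite E; split; first by apply: L1D; [exact: L1D|exact: L1Z].
rewrite (ExD (L1D (LX i) LS) (L1Z 2 LM)) (ExD (LX i) LS) (ExZ _ LM) EM X0 X1 ES.
by rewrite mulr0 mulr0 addr0 -natr1 addrC.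
Qed.

Variables (p : nat) (Z : nat -> T -> 'cV[R]_p).
Hypothesis hZiid : iid P (Z : nat -> T -> borelV R p).
Hypothesis hZstd : forall i, standardized P (Z i).

Lemma measurable_coord (j : 'I_p) :
  measurable_fun setT ((fun v : 'cV[R]_p => v j 0) : borelV R p -> R).
Proof.
apply: (measurability (@RGenOpens.G R)); first exact: RGenOpens.measurableE.
move=> _ [_ [a [b ->]] <-]; rewrite setTI; apply: sub_sigma_algebra.
apply: open_comp; last exact: interval_open.
by move=> v _; exact: coord_continuous.
Qed.

Lemma measurable_Z i j : measurable_fun setT (fun w => Z i w j 0).
Proof. exact: (measurableT_comp (measurable_coord j) (iid_measurable hZiid i)). Qed.

Lemma L1_Z2 i j : L1 P (fun w => Z i w j 0 ^+ 2).
Proof. by have [h _ _] := hZstd i; exact: (Lfun2_integrable_sqr (h j)). Qed.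

Lemma L1_Z i j : L1 P (fun w => Z i w j 0).
Proof. by apply: L1_of_sq; [exact: measurable_Z|exact: L1_Z2]. Qed.

Lemma Ex_Z i j : Ex P (fun w => Z i w j 0) = 0.
Proof.
have [_ /(_ j) + _] := hZstd i; rewrite unlock.
by rewrite /coordinate Ex_EFin; [case|exact: L1_Z].
Qed.

Lemma L1_ZZ i j k : L1 P (fun w => Z i w j 0 * Z i w k 0).
Proof. by apply: L1_mul_sq; [exact: measurable_Z|exact: measurable_Z|exact: L1_Z2|exact: L1_Z2]. Qed.

Lemma Ex_ZZ i j k : Ex P (fun w => Z i w j 0 * Z i w k 0) = (j == k)%:R.
Proof.
have [h E /(_ j k)] := hZstd i.
rewrite covarianceE; last 3 first.
- by apply: Lfun_subset12 => //; exact: fin_num_measure.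
- by apply: Lfun_subset12 => //; exact: fin_num_measure.
- exact: Lfun2_mul_Lfun1.
rewrite !E mule0 sube0 mxE unlock.
have -> : (\int[P]_w ((coordinate (Z i) j * coordinate (Z i) k)%R w)%:E =
   \int[P]_w (Z i w j 0 * Z i w k 0)%:E)%E by [].
by rewrite Ex_EFin; [case|exact: L1_ZZ].
Qed.

Definition walk (n : nat) (j : 'I_p) : T -> R := fun w => \sum_(0 <= i < n) Z i w j 0.

Lemma measurable_walk n j : measurable_fun setT (walk n j).
Proof. by apply: measurable_sum => i; exact: measurable_Z. Qed.

Lemma independent_RVs_Z (f : nat -> 'cV[R]_p -> R) :
  (forall n, measurable_fun setT (f n : borelV R p -> R)) ->
  independent_RVs P (fun n w => f n (Z n w)).
Proof. by move=> mf; exact: (independent_RVs_comp mf (iid_independent hZiid)). Qed.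

Lemma walk_increment_sqr m n j : (m <= n)%N ->
  L1 P (fun w => (walk n j w - walk m j w) ^+ 2) /\
  Ex P (fun w => (walk n j w - walk m j w) ^+ 2) = (n - m)%:R.
Proof.
move=> mn; pose X i w := Z i w j 0.
have iX : independent_RVs P X by apply: (independent_RVs_Z (f := fun _ v => v j 0)) => _; exact: measurable_coord.
have := @Ex_fsum_sqr _ X (index_iota m n) (fun i => measurable_Z i j) iX (iota_uniq _ _)
  (fun i => L1_Z2 i j) (fun i => Ex_Z i j) _.
have X1 i : Ex P (fun w => X i w ^+ 2) = 1.
  by have := Ex_ZZ i j j; rewrite eqxx => E; rewrite -[RHS]E; apply: eq_Ex => w; rewrite expr2.
move=> /(_ X1); rewrite size_iota.
have -> : (fun w => fsum X (index_iota m n) w ^+ 2) =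
    (fun w => (walk n j w - walk m j w) ^+ 2) => //.
apply/funext => w; congr (_ ^+ 2); rewrite /fsum /walk.
by rewrite [X in _ = X - _](@big_cat_nat _ _ _ m)//= addrAC subrr add0r.
Qed.

Lemma walk_sqr n j : L1 P (fun w => walk n j w ^+ 2) /\ Ex P (fun w => walk n j w ^+ 2) = n%:R.
Proof.
have := walk_increment_sqr j (leq0n n); rewrite subn0.
have -> // : (fun w => (walk n j w - walk 0 j w) ^+ 2) = (fun w => walk n j w ^+ 2).
by apply/funext => w; rewrite /walk [in X in _ - X]big_nil subr0.
Qed.

Lemma Ex_identical (f : 'cV[R]_p -> R) n :
  measurable_fun setT (f : borelV R p -> R) -> (forall v, 0 <= f v) ->
  Ex P (fun w => f (Z n w)) = Ex P (fun w => f (Z 0%N w)).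
Proof.
move=> mf f0; have mZ i := iid_measurable hZiid i.
have mfE : measurable_fun setT (EFin \o f : borelV R p -> \bar R) by exact/measurable_EFinP.
have E i : (\int[P]_w (f (Z i w))%:E =
    \int[pushforward P (Z i : T -> borelV R p)]_v (f v)%:E)%E.
  apply: esym; apply: (etrans (ge0_integral_pushforward (mZ i) P measurableT mfE _)) => //.
  by move=> v _; rewrite /= lee_fin.
rewrite /Ex /Rintegral !E; congr fine.
by apply: eq_measure_integral => A mA _; exact: (iid_identical hZiid).
Qed.

Definition norm1 (v : 'cV[R]_p) : R := \sum_j `|v j 0|.

Lemma measurable_norm1 : measurable_fun setT (norm1 : borelV R p -> R).
Proof.
apply: measurable_sum => j; apply: (@measurableT_comp _ _ _ _ _ _ (fun x : R => `|x|)) => //.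
exact: measurable_coord.
Qed.

Lemma norm1_ge0 v : 0 <= norm1 v.
Proof. by apply: sumr_ge0. Qed.

Lemma L1_norm1 n : L1 P (fun w => norm1 (Z n w) ^+ 2).
Proof.
have E : (fun w => norm1 (Z n w) ^+ 2) =
    (fun w => \sum_j \sum_k `|Z n w j 0| * `|Z n w k 0|).
  by apply/funext => w; rewrite /norm1 expr2 mulr_suml; apply: eq_bigr => j _; rewrite mulr_sumr.
rewrite E; apply: L1_sum => j; apply: L1_sum => k.
by apply: (L1_ext _ (L1_abs (L1_ZZ n j k))) => w; rewrite normrM.
Qed.

(** The projection [e v . Z n] is majorized by [e V1] times the [l^1] norm of [Z n], whose law does
    not depend on [n]. The threshold [e0] is therefore uniform in [n], in [v] and in the phase. *)
Lemma walk_step_cos (V eta : R) : 0 <= V -> 0 < eta ->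
  exists2 e0 : R, 0 < e0 & forall n (v : 'I_p -> R) (e c : R),
    (forall j, `|v j| <= V) -> 0 < e <= e0 ->
    `|Ex P (fun w => cos (c + e * \sum_j v j * Z n w j 0)) -
      expR (- (e ^+ 2 * (\sum_j v j ^+ 2) / 2)) * cos c| <= eta * e ^+ 2.
Proof.
move=> V0 eta0.
pose V1 := V + 1; have V10 : 0 < V1 by rewrite /V1; lra.
pose M := Ex P (fun w => norm1 (Z 0%N w) ^+ 2).
have M0 : 0 <= M by apply: Ex_ge0 => w; exact: sqr_ge0.
have mN n : measurable_fun setT (fun w => norm1 (Z n w)).
  exact: (measurableT_comp measurable_norm1 (iid_measurable hZiid n)).
have e10 : 0 < eta / (4 * V1 ^+ 2) by rewrite divr_gt0// mulr_gt0// exprn_gt0.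
have [dl dl0 hdl] := min_cube_small (mN 0%N) (L1_norm1 0%N) (fun w => norm1_ge0 _) e10.
pose a := V1 ^+ 4 * M ^+ 2 + 1.
have a0 : 0 < a by rewrite ltr_wpDl// mulr_ge0// exprn_ge0// ltW.
(* The three bounds serve, in order, [min_cube_small] at [t = e V1], the inequality [e^2 <= e], and
   the squared-variance term. *)
pose e0 := Num.min (dl / V1) (Num.min 1 (eta / (2 * a))).
exists e0; first by rewrite !lt_min ltr01 !divr_gt0//= mulr_gt0.
move=> n v e c vV /andP[e_gt0]; rewrite !le_min => /and3P[h1 h2 h3].
pose X w := e * \sum_j v j * Z n w j 0.
pose t := e * V1.
have t0 : 0 < t by rewrite mulr_gt0.
have tdl : 0 <= t <= dl by rewrite (ltW t0)/= /t -ler_pdivlMr.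
pose Y w := t * norm1 (Z n w).
have mX : measurable_fun setT X.
  apply: measurable_funM => //; apply: measurable_sum => j.
  by apply: measurable_funM => //; exact: measurable_Z.
have mY : measurable_fun setT Y by exact: measurable_funM.
have YE : (fun w => Y w ^+ 2) = (fun w => t ^+ 2 * norm1 (Z n w) ^+ 2).
  by apply/funext => w; rewrite exprMn.
have LY : L1 P (fun w => Y w ^+ 2) by rewrite YE; apply: L1Z; exact: L1_norm1.
have EY : Ex P (fun w => Y w ^+ 2) = t ^+ 2 * M.
  rewrite YE (ExZ _ (L1_norm1 n)); congr (_ * _).
  apply: (@Ex_identical (fun v => norm1 v ^+ 2)) => [|u]; last exact: sqr_ge0.
  by apply: measurable_funX; exact: measurable_norm1.
have XY w : `|X w| <= Y w.
  rewrite /X /Y /t normrM gtr0_norm// -mulrA ler_wpM2l ?(ltW e_gt0)// /norm1 mulr_sumr.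
  rewrite (le_trans (ler_norm_sum _ _ _))//; apply: ler_sum => j _.
  by rewrite normrM ler_wpM2r// (le_trans (vV j))// /V1; lra.
have LvZ j : L1 P (fun w => v j * Z n w j 0) by apply: L1Z; exact: L1_Z.
have X0 : Ex P X = 0.
  rewrite /X ExZ; last exact: L1_sum.
  by rewrite Ex_sum// big1 ?mulr0// => j _; rewrite ExZ ?Ex_Z ?mulr0//; exact: L1_Z.
have X2 : Ex P (fun w => X w ^+ 2) = e ^+ 2 * \sum_j v j ^+ 2.
  have E : (fun w => X w ^+ 2) =
      (fun w => e ^+ 2 * \sum_j \sum_k v j * v k * (Z n w j 0 * Z n w k 0)).
    apply/funext => w; rewrite /X exprMn; congr (_ * _).
    rewrite expr2 mulr_suml; apply: eq_bigr => j _; rewrite mulr_sumr; apply: eq_bigr => k _.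
    by rewrite mulrACA.
  have LL j k : L1 P (fun w => v j * v k * (Z n w j 0 * Z n w k 0)).
    by apply: L1Z; exact: L1_ZZ.
  rewrite E ExZ; last by apply: L1_sum => j; exact: L1_sum.
  congr (_ * _); rewrite Ex_sum; last by move=> j; exact: L1_sum.
  apply: eq_bigr => j _; rewrite Ex_sum// (bigD1 j)//= big1 ?addr0.
    by rewrite ExZ ?Ex_ZZ ?eqxx ?mulr1//; exact: L1_ZZ.
  move=> k kj; rewrite ExZ ?Ex_ZZ; last exact: L1_ZZ.
  by rewrite eq_sym (negbTE kj) mulr0.
have := Ex_cos_step mX mY LY XY X0 c; rewrite X2 EY => H; apply: (le_trans H).
have -> : Ex P (fun w => Num.min (Y w ^+ 2) (Y w ^+ 3)) =
    Ex P (fun w => Num.min ((t * norm1 (Z 0%N w)) ^+ 2) ((t * norm1 (Z 0%N w)) ^+ 3)).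
  apply: (@Ex_identical (fun v => Num.min ((t * norm1 v) ^+ 2) ((t * norm1 v) ^+ 3))).
    apply: measurable_minr; apply: measurable_funX; apply: measurable_funM => //;
      exact: measurable_norm1.
  by move=> u; rewrite le_min !exprn_ge0// mulr_ge0 ?norm1_ge0// ltW.
have H2 := hdl _ tdl.
have -> : eta * e ^+ 2 = eta / 2 * e ^+ 2 + eta / 2 * e ^+ 2 by field.
apply: lerD.
  rewrite (le_trans (ler_wpM2l _ H2))// /t le_eqVlt; apply/orP; left; apply/eqP.
  by field; rewrite gt_eqF.
have -> : (t ^+ 2 * M) ^+ 2 = (e ^+ 2 * (V1 ^+ 4 * M ^+ 2)) * e ^+ 2 by rewrite /t; ring.
rewrite ler_wpM2r ?sqr_ge0//.
have e2 : e ^+ 2 <= e by rewrite expr2 ler_piMl// ltW.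
have : e * (2 * a) <= eta by rewrite -ler_pdivlMr// mulr_gt0.
have : e ^+ 2 * (V1 ^+ 4 * M ^+ 2) <= e * (V1 ^+ 4 * M ^+ 2).
  by rewrite ler_wpM2r// mulr_ge0// exprn_ge0// ltW.
rewrite /a; lra.
Qed.

End RandomWalk.

(** * Walk index of a Brownian time *)

Section GridIndex.
Context (R : realType).
Implicit Types t e : R.

(** For [t >= 0], the least [n] with [t < e^2 n]. It is always positive, so index 0 never enters a
    range starting at some [gidx]. *)
Definition gidx t e : nat := (Num.truncn (t / e ^+ 2)).+1.

Lemma gidx_gt t e : 0 < e -> t < e ^+ 2 * (gidx t e)%:R.
Proof.
move=> e0; rewrite mulrC -ltr_pdivrMr ?exprn_gt0//; exact: truncnS_gt.
Qed.

Lemma gidx_le t e : 0 <= t -> 0 < e -> e ^+ 2 * (gidx t e)%:R <= t + e ^+ 2.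
Proof.
move=> t0 e0; have e20 : 0 < e ^+ 2 by rewrite exprn_gt0.
rewrite /gidx -natr1 mulrDr mulr1 lerD2r mulrC -ler_pdivlMr//.
by have /andP[] := truncn_itv (divr_ge0 t0 (ltW e20)).
Qed.

Lemma le_gidx e : 0 < e -> {homo gidx ^~ e : s t / s <= t >-> (s <= t)%N}.
Proof.
by move=> e0 s t st; rewrite ltnS; apply: le_truncn; rewrite ler_wpM2r// invr_ge0 exprn_ge0 ?ltW.
Qed.

Lemma near0_right (Q : R -> Prop) (dl : R) : 0 < dl ->
  (forall e, 0 < e -> e < dl -> Q e) -> \forall e \near 0^'+, Q e.
Proof.
by move=> d0 H; near=> e; apply: H; near: e; [exact: nbhs_right_gt|exact: nbhs_right_lt].
Unshelve. all: by end_near. Qed.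

Lemma cvg_sqr0 : (fun e : R => e ^+ 2) e @[e --> 0^'+] --> (0 : R).
Proof.
apply: cvg_at_right_filter; rewrite [X in _ --> X](_ : _ = (0 : R) ^+ 2).
  exact: exprn_continuous.
by rewrite expr0n.
Qed.

Lemma cvg_gidx t : 0 <= t -> e ^+ 2 * (gidx t e)%:R @[e --> 0^'+] --> t.
Proof.
move=> t0; have h : t + e ^+ 2 @[e --> 0^'+] --> t.
  by rewrite -[X in _ --> X]addr0; apply: cvgD; [exact: cvg_cst|exact: cvg_sqr0].
apply: (squeeze_cvgr _ (cvg_cst t) h).
by apply: (near0_right ltr01) => e e0 _; rewrite (ltW (gidx_gt _ _)) ?gidx_le.
Qed.

End GridIndex.

(** * Characteristic functions of finitely many walk positions *)

Section WalkFdd.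
Context d (T : measurableType d) (R : realType) (P : probability T R).
Variables (p : nat) (Z : nat -> T -> 'cV[R]_p).
Hypothesis hZiid : iid P (Z : nat -> T -> borelV R p).
Hypothesis hZstd : forall i, standardized P (Z i).
Variables (tau : nat -> R) (K : nat).
Hypothesis tau0 : 0 < tau 0%N.
Hypothesis tauS : forall i, tau i < tau i.+1.

Let tnd : {homo tau : i j / (i <= j)%N >-> i <= j}.
Proof. by apply/nondecreasing_seqP => i; exact/ltW. Qed.

(** A combination of walk positions is a sum of independent steps, step [n] being projected on the
    sum of the [u k] with [n < gidx (tau k) e]. There are about [tau K / e^2] relevant steps, each
    with an error [eta e^2], and the product of the factors has as exponent a discretized Gram form
    that converges to [gram]. *)
Lemma walk_fdd_cos (u : nat -> 'I_p -> R) (c : R) :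
  Ex P (fun w => cos (c + \sum_(j < p) \sum_(0 <= k < K)
     u k j * (e * walk Z (gidx (tau k) e) j w))) @[e --> 0^'+] -->
  expR (- ((\sum_(j < p) gram tau K (u ^~ j)) / 2)) * cos c.
Proof.
have tge0 k : 0 <= tau k by exact/ltW/tau_gt0.
pose dgram (e : R) (j : 'I_p) := \sum_(0 <= k < K) \sum_(0 <= l < K)
   u k j * u l j * (e ^+ 2 * (gidx (tau (minn k l)) e)%:R).
have cvgB : expR (- ((\sum_(j < p) dgram e j) / 2)) * cos c @[e --> 0^'+] -->
    expR (- ((\sum_(j < p) gram tau K (u ^~ j)) / 2)) * cos c.
  apply: cvgMl; apply: (@cvg_comp _ _ _ (fun e => - ((\sum_(j < p) dgram e j) / 2)) expR _ _ _ _ (@continuous_expR R _)).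
  apply: cvgN; apply: cvgMl; apply: cvg_big => [|j _]; first exact: add_continuous.
  apply: cvg_big => [|k _]; first exact: add_continuous.
  apply: cvg_big => [|l _]; first exact: add_continuous.
  by apply: cvgMr; exact: cvg_gidx.
apply: cvg_sub0 cvgB.
apply/cvgrPdist_lt => /= a a0.
pose V := \sum_(j < p) \sum_(0 <= k < K) `|u k j|.
have V0 : 0 <= V by apply: sumr_ge0 => j _; apply: sumr_ge0.
(* The total error [eta e^2 N] is at most [eta (tau K + 1) = a / 2]. *)
pose eta := a / (2 * (tau K + 1)).
have tK1 : 0 < tau K + 1 by rewrite ltr_wpDl.
have eta0 : 0 < eta by rewrite divr_gt0// mulr_gt0.
have [e0 e00 He0] := walk_step_cos hZiid hZstd V0 eta0.
apply: (@near0_right _ _ (Num.min e0 1)); first by rewrite lt_min e00 ltr01.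
move=> e e_gt0; rewrite lt_min => /andP[ee0 e1].
rewrite !fctE sub0r normrN.
pose N := gidx (tau K) e.
pose nk k := gidx (tau k) e.
have nkN k : (k <= K)%N -> (nk k <= N)%N by move=> kK; apply: le_gidx => //; exact: tnd.
pose v n (j : 'I_p) := \sum_(0 <= k < K) u k j * (n < nk k)%:R.
have vV n j : `|v n j| <= V.
  rewrite /V (bigD1 j)//= -[leLHS]addr0 lerD ?sumr_ge0// => [|k _]; last exact: sumr_ge0.
  rewrite (le_trans (ler_norm_sum _ _ _))//; apply: ler_sum => k _.
  by rewrite normrM ler_piMr// ger0_norm// lern1 leq_b1.
pose X n w := e * \sum_j v n j * Z n w j 0.
have mX n : measurable_fun setT (X n).
  apply: measurable_funM => //; apply: measurable_sum => j.
  by apply: measurable_funM => //; exact: (measurable_Z hZiid).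
have iX : independent_RVs P X.
  apply: (independent_RVs_Z hZiid (f := fun n z => e * \sum_j v n j * z j 0)) => n.
  apply: measurable_funM => //; apply: measurable_sum => j.
  by apply: measurable_funM => //; exact: measurable_coord.
pose b n := expR (- (e ^+ 2 * (\sum_j v n j ^+ 2) / 2)).
have b01 n : 0 <= b n <= 1.
  rewrite expR_ge0/= /b -[leRHS]expR0 ler_expR oppr_le0.
  by rewrite divr_ge0// mulr_ge0 ?sqr_ge0// sumr_ge0// => j _; exact: sqr_ge0.
have e0e : 0 < e <= e0 by rewrite e_gt0 ltW.
have := @Ex_cos_fsum _ _ _ P _ X (index_iota 0 N) b (fun=> eta * e ^+ 2) mX iX
  (iota_uniq _ _) (fun n _ => b01 n).
have h n c' : n \in index_iota 0 N ->
   `|Ex P (fun w => cos (c' + X n w)) - b n * cos c'| <= eta * e ^+ 2.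
  by move=> _; exact: (He0 n (v n) e c' (vV n) e0e).
move=> /(_ h c).
have -> : \prod_(n <- index_iota 0 N) b n = expR (- ((\sum_(j < p) dgram e j) / 2)).
  rewrite -(expR_sum (index_iota 0 N) xpredT (fun n => - (e ^+ 2 * (\sum_j v n j ^+ 2) / 2))).
  rewrite sumrN -mulr_suml; congr (expR (- (_ / 2))).
  transitivity (\sum_(j < p) \sum_(0 <= n < N) e ^+ 2 * v n j ^+ 2).
    by rewrite exchange_big/=; apply: eq_bigr => n _; rewrite mulr_sumr.
  apply: eq_bigr => j _; rewrite sum_indicator_sqr; last by move=> k kK; exact/nkN/ltnW.
  apply: eq_bigr => k _; apply: eq_bigr => l _; congr (_ * _).
  rewrite sumr_const_nat subn0 -[LHS]mulr_natr; congr (_ * _%:R).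
  have [kl|lk] := leqP k l.
    by rewrite (minn_idPl _)//; apply: le_gidx => //; exact: tnd.
  by rewrite (minn_idPr _)//; apply: le_gidx => //; exact/tnd/ltnW.
have -> : \sum_(n <- index_iota 0 N) (eta * e ^+ 2) = eta * (e ^+ 2 * N%:R).
  by rewrite sumr_const_nat subn0 -[LHS]mulr_natr mulrA.
have -> : (fun w => cos (c + fsum X (index_iota 0 N) w)) =
    (fun w => cos (c + \sum_(j < p) \sum_(0 <= k < K) u k j * (e * walk Z (gidx (tau k) e) j w))).
  apply/funext => w; congr (cos (c + _)).
  transitivity (\sum_(0 <= n < N) \sum_(j < p) \sum_(0 <= k < K)
      u k j * (e * ((n < nk k)%:R * Z n w j 0))).
    rewrite /fsum; apply: eq_bigr => n _; rewrite /X mulr_sumr; apply: eq_bigr => j _.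
    by rewrite /v mulr_suml mulr_sumr; apply: eq_bigr => k _; ring.
  rewrite exchange_big/=; apply: eq_bigr => j _; rewrite exchange_big/= big_nat [RHS]big_nat.
  apply: eq_bigr => k /andP[_ kK]; rewrite -!mulr_sumr sum_nat_lt//.
  exact/nkN/ltnW.
move=> H; apply: (le_lt_trans H).
have : e ^+ 2 * N%:R <= tau K + 1.
  rewrite (le_trans (gidx_le (tge0 K) e_gt0))// lerD2l expr2.
  by rewrite mulr_ile1// ltW.
move=> /(ler_wpM2l (ltW eta0)) H2; apply: (le_lt_trans H2).
have -> : eta * (tau K + 1) = a / 2 by rewrite /eta; field; rewrite gt_eqF.
lra.
Qed.

End WalkFdd.

(** * Finite-dimensional central limit theorem and Brownian scaling *)

Section WalkFddConvergence.
Context d (T : measurableType d) (R : realType) (P : probability T R).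
Variables (p : nat) (Z : nat -> T -> 'cV[R]_p).
Hypothesis hZiid : iid P (Z : nat -> T -> borelV R p).
Hypothesis hZstd : forall i, standardized P (Z i).
Context d' (T' : measurableType d') (P' : probability T' R).
Variable W : R -> T' -> 'cV[R]_p.
Hypothesis hW : standard_BM_vector P' W.

Lemma walk_fdd_cvg (tau : nat -> R) (K : nat) (F : ('I_K * 'I_p -> R) -> R) (L : R) :
  0 < tau 0%N -> (forall i, tau i < tau i.+1) ->
  lipschitz1 L F -> (forall x, 0 <= F x <= 1) ->
  Ex P (fun w => F (fun kj => e * walk Z (gidx (tau kj.1) e) kj.2 w)) @[e --> 0^'+] -->
  Ex P' (fun w => F (fun kj => W (tau kj.1) w kj.2 0)).
Proof.
move=> tau0 tauS LF F01.
have tgt0 k : 0 < tau k by exact: tau_gt0.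
have tnd : {homo tau : i j / (i <= j)%N >-> i <= j}.
  by apply/nondecreasing_seqP => i; exact/ltW.
(* Translates the coefficients indexed by pairs, as in [levy_continuity], into the double sums of
   the cosine lemmas; [u'] is extended by 0 outside the range of [k]. *)
have reindex (u : 'I_K * 'I_p -> R) :
    exists u' : nat -> 'I_p -> R, forall f : nat -> 'I_p -> R,
      \sum_kj u kj * f kj.1 kj.2 = \sum_(j < p) \sum_(0 <= k < K) u' k j * f k j.
  exists (fun k j => oapp (fun k' : 'I_K => u (k', j)) 0 (insub k)) => f.
  transitivity (\sum_(k < K) \sum_(j < p) u (k, j) * f k j).
    by rewrite pair_bigA; apply: eq_bigr => -[].
  rewrite exchange_big/=.
  by apply: eq_bigr => j _; rewrite big_mkord; apply: eq_bigr => k _; rewrite valK.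
apply: (@levy_continuity _ _ _ _ (at_right_proper_filter 0) _ _ P _ _ P' F L (tau K + 1)
  (fun e w kj => e * walk Z (gidx (tau kj.1) e) kj.2 w)
  (fun w kj => W (tau kj.1) w kj.2 0) LF F01).
- by move=> e kj; apply: measurable_funM => //; exact: (measurable_walk hZiid).
- by move=> kj; apply: (measurable_BMV hW); exact: ltW.
- apply: (@near0_right _ _ 1) => // e e0 e1 [k j] /=.
  have [Lw Ew] := walk_sqr hZiid hZstd (gidx (tau k) e) j.
  have E : (fun w => (e * walk Z (gidx (tau k) e) j w) ^+ 2) =
      (fun w => e ^+ 2 * walk Z (gidx (tau k) e) j w ^+ 2).
    by apply/funext => w; rewrite exprMn.
  rewrite E; split; first exact: L1Z.
  rewrite (ExZ _ Lw) Ew (le_trans (gidx_le (ltW (tgt0 k)) e0))// lerD//.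
    by apply: tnd; exact: ltnW.
  by rewrite expr2 mulr_ile1// ltW.
- move=> [k j] /=; have [Lw Ew _] := BMV_moments hW j (tgt0 k).
  split=> //; rewrite Ew (le_trans (tnd _ _ (ltnW (ltn_ord k))))// lerDl//.
move=> u c; have [u' Hu] := reindex u.
have -> : Ex P' (fun w => cos (\sum_i u i * W (tau i.1) w i.2 0 + c)) =
    expR (- ((\sum_(j < p) gram tau K (u' ^~ j)) / 2)) * cos c.
  rewrite -(BMV_fdd_cos K tau0 tauS hW); apply: eq_Ex => w.
  by rewrite addrC (Hu (fun k j => W (tau k) w j 0)).
have := @walk_fdd_cos _ _ _ P p Z hZiid hZstd tau K tau0 tauS u' c.
have -> : (fun e => Ex P (fun w => cos (c + \sum_(j < p) \sum_(0 <= k < K)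
     u' k j * (e * walk Z (gidx (tau k) e) j w)))) =
   (fun e => Ex P (fun w => cos (\sum_i u i * (e * walk Z (gidx (tau i.1) e) i.2 w) + c))).
  apply/funext => e; apply: eq_Ex => w.
  by rewrite addrC (Hu (fun k j => e * walk Z (gidx (tau k) e) j w)).
exact.
Qed.

(** Both vectors have the same expectations of phased cosines. Applying [levy_continuity] to a
    constant family turns that into equality of expectations, by uniqueness of limits. *)
Lemma BMV_scaling (F : ('I_p -> R) -> R) (L t : R) : 0 < t ->
  lipschitz1 L F -> (forall x, 0 <= F x <= 1) ->
  Ex P' (fun w => F (fun j => (Num.sqrt t)^-1 * W t w j 0)) = Ex P' (fun w => F (fun j => W 1 w j 0)).
Proof.
move=> t0 LF F01; set r := Num.sqrt t.
have r0 : 0 < r by rewrite sqrtr_gt0.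
have r2 : r ^+ 2 = t by rewrite sqr_sqrtr// ltW.
have one_time s u c : 0 < s -> Ex P' (fun w => cos (\sum_(j < p) u j * W s w j 0 + c)) =
    expR (- ((\sum_(j < p) u j ^+ 2 * s) / 2)) * cos c.
  move=> s0.
  have tS i : s * i.+1%:R < s * i.+2%:R by rewrite ltr_pM2l// ltr_nat.
  have t00 : 0 < s * 1%:R by rewrite mulr1.
  have := @BMV_fdd_cos _ _ _ P' (fun i => s * i.+1%:R) 1 t00 tS _ W hW (fun _ j => u j) c.
  have -> : \sum_(j < p) gram (fun i => s * i.+1%:R) 1 (fun=> u j) = \sum_(j < p) u j ^+ 2 * s.
    by apply: eq_bigr => j _; rewrite /gram !big_nat1 minnn mulr1 expr2.
  move=> <-; apply: eq_Ex => w; rewrite addrC; congr (cos (c + _)).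
  by apply: eq_bigr => j _; rewrite big_nat1 mulr1.
pose X (w : T') j := r^-1 * W t w j 0.
have mX j : measurable_fun setT (fun w => X w j).
  by apply: measurable_funM => //; apply: (measurable_BMV hW); exact: ltW.
have mW1 j : measurable_fun setT (fun w => W 1 w j 0).
  by apply: (measurable_BMV hW).
have X2 j : L1 P' (fun w => X w j ^+ 2) /\ Ex P' (fun w => X w j ^+ 2) <= 1.
  have [Lw Ew _] := BMV_moments hW j t0.
  have E : (fun w => X w j ^+ 2) = (fun w => t^-1 * W t w j 0 ^+ 2).
    by apply/funext => w; rewrite /X exprMn exprVn r2.
  by rewrite E; split; [exact: L1Z|rewrite (ExZ _ Lw) Ew mulVf// gt_eqF].
have W12 j : L1 P' (fun w => W 1 w j 0 ^+ 2) /\ Ex P' (fun w => W 1 w j 0 ^+ 2) <= 1.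
  by have [Lw Ew _] := BMV_moments hW j ltr01; rewrite Ew.
have := @levy_continuity _ 'I_p nat \oo _ _ _ P' _ _ P' F L 1
  (fun=> X) (fun w j => W 1 w j 0) LF F01 (fun=> mX) mW1 (nearW _ (fun=> X2)) W12.
have charE u c : Ex P' (fun w => cos (\sum_j u j * X w j + c)) =
    Ex P' (fun w => cos (\sum_j u j * W 1 w j 0 + c)).
  rewrite one_time//; have := one_time t (fun j => u j * r^-1) c t0.
  have -> : \sum_(j < p) (u j * r^-1) ^+ 2 * t = \sum_(j < p) u j ^+ 2 * 1.
    by apply: eq_bigr => j _; rewrite -r2; field; rewrite gt_eqF.
  by move=> <-; apply: eq_Ex => w; congr (cos (_ + c)); apply: eq_bigr => j _; rewrite /X mulrA.
have H u c : (fun j : nat => Ex P' (fun w => cos (\sum_i u i * X w i + c))) @ \oo -->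
    Ex P' (fun w => cos (\sum_i u i * W 1 w i 0 + c)).
  by rewrite charE; exact: cvg_cst.
move=> /(_ _ _ H) h; have := h _ _ => /(cvg_lim (@Rhausdorff R)) <-; exact/esym/lim_cst.
Qed.

End WalkFddConvergence.

                                              

(** * The distance function and its composition with [S] *)

Section Distance.
Context (R : realType) (p : nat) (dist : 'cV[R]_p -> R).
Hypothesis hdist : is_distance dist.

Lemma dist0 : dist 0 = 0.
Proof. exact/(dist_eq0 hdist). Qed.

Lemma distN x : dist (- x) = dist x.
Proof. by rewrite -scaleN1r (dist_scale hdist) normrN1 mul1r. Qed.

Lemma dist_ge0 x : 0 <= dist x.
Proof. by have := dist_triangle hdist x (- x); rewrite subrr dist0 distN; lra. Qed.

Lemma norm_dist_sub x y : `|dist x - dist y| <= dist (x - y).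
Proof.
have h u v : dist u <= dist (u - v) + dist v by rewrite -{1}(subrK v u) (dist_triangle hdist).
by have := h x y; have := h y x; rewrite -opprB distN ler_norml; lra.
Qed.

Lemma dist_mulmx_bound (S : 'M[R]_p) :
  exists2 c, 0 < c & forall v, dist (S *m v) <= c * \sum_(j < p) `|v j 0|.
Proof.
have [c0 hc] := dist_bound hdist.
pose s := \sum_(i < p) \sum_(j < p) `|S i j|.
have s0 : 0 <= s by apply: sumr_ge0 => i _; apply: sumr_ge0.
exists (`|c0| * s + 1); first by rewrite ltr_wpDl// mulr_ge0.
move=> v; apply: (le_trans (hc _)).
have v0 : 0 <= \sum_(j < p) `|v j 0| by exact: sumr_ge0.
have h : \sum_(i < p) `|(S *m v) i 0| <= s * \sum_(j < p) `|v j 0|.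
  rewrite mulr_suml; apply: ler_sum => i _; rewrite mxE mulr_suml.
  rewrite (le_trans (ler_norm_sum _ _ _))//; apply: ler_sum => j _; rewrite normrM ler_wpM2l//.
  by rewrite (bigD1 j)//= lerDl sumr_ge0.
rewrite (le_trans (ler_wpM2r _ (ler_norm c0)))//; first exact: sumr_ge0.
rewrite (le_trans (ler_wpM2l _ h))// mulrA mulrDl lerDl mul1r.
exact: v0.
Qed.

Definition distS (S : 'M[R]_p) (x : 'I_p -> R) : R := dist (S *m \col_j x j).

Lemma distS_lipschitz (S : 'M[R]_p) : exists2 c, 0 < c & lipschitz1 c (distS S).
Proof.
have [c c0 hc] := dist_mulmx_bound S; exists c => // x y.
rewrite (le_trans (norm_dist_sub _ _))// -mulmxBr (le_trans (hc _))//.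
by rewrite ler_wpM2l ?(ltW c0)//; apply: ler_sum => j _; rewrite !mxE.
Qed.

Lemma distS_ge0 (S : 'M[R]_p) x : 0 <= distS S x.
Proof. exact: dist_ge0. Qed.

Lemma distSZ (S : 'M[R]_p) (a : R) x : distS S (fun j => a * x j) = `|a| * distS S x.
Proof.
rewrite /distS -(dist_scale hdist) scalemxAr; congr (dist (S *m _)).
by apply/colP => j; rewrite !mxE.
Qed.

Lemma distS_col (S : 'M[R]_p) (v : 'cV[R]_p) : distS S (fun j => v j 0) = dist (S *m v).
Proof. by congr (dist (_ *m _)); apply/colP => j; rewrite mxE. Qed.

Lemma measurable_dist d (T : measurableType d) (X : T -> 'cV[R]_p) :
  (forall j, measurable_fun setT (fun w => X w j 0)) ->
  measurable_fun setT (fun w => dist (X w)).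
Proof.
move=> mX; have [c _ hc] := distS_lipschitz 1%:M.
have -> : (fun w => dist (X w)) = (fun w => distS 1%:M (fun j => X w j 0)).
  by apply/funext => w; rewrite distS_col mul1mx.
exact: (measurable_lipschitz1 hc mX).
Qed.

End Distance.

Lemma lipschitz1_comp (R : realType) (I : finType) (L c : R) (f : R -> R) (D : (I -> R) -> R) :
  0 <= L -> (forall x y, `|f x - f y| <= L * `|x - y|) -> lipschitz1 c D ->
  lipschitz1 (L * c) (f \o D).
Proof.
by move=> L0 fL Dc x y; rewrite (le_trans (fL _ _))// -mulrA ler_wpM2l.
Qed.

(** * Mean oscillation of the scaled walk within a block *)

Section WalkModulus.
Context d (T : measurableType d) (R : realType) (P : probability T R).
Variables (p : nat) (Z : nat -> T -> 'cV[R]_p).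
Hypothesis hZiid : iid P (Z : nat -> T -> borelV R p).
Hypothesis hZstd : forall i, standardized P (Z i).

Lemma Ex_walk_increment_le m n j (s : R) : (m <= n)%N -> 0 < s -> (n - m)%:R <= s ^+ 2 ->
  L1 P (fun w => walk Z n j w - walk Z m j w) /\
  Ex P (fun w => `|walk Z n j w - walk Z m j w|) <= s.
Proof.
move=> mn s0 h; have [L E] := walk_increment_sqr hZiid hZstd j mn.
have mf : measurable_fun setT (fun w => walk Z n j w - walk Z m j w).
  by apply: measurable_funB; exact: (measurable_walk hZiid).
by split; [exact: L1_of_sq|apply: Ex_norm_le => //; rewrite E].
Qed.

Lemma Ex_walk_le n j (s : R) : 0 < s -> n%:R <= s ^+ 2 ->
  L1 P (walk Z n j) /\ Ex P (fun w => `|walk Z n j w|) <= s.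
Proof.
move=> s0 h; have := @Ex_walk_increment_le 0 n j s (leq0n n) s0.
rewrite subn0 => /(_ h).
have -> // : (fun w => walk Z n j w - walk Z 0 j w) = walk Z n j.
  by apply/funext => w; rewrite /walk [in X in _ - X]big_nil subr0.
have -> // : (fun w => `|walk Z n j w - walk Z 0 j w|) = (fun w => `|walk Z n j w|).
by apply/funext => w; rewrite /walk [in X in _ - X]big_nil subr0.
Qed.

(** The difference is [c1 (walk n - walk m) - c2 (walk m)]. Over a time span [r^2] the increment has
    mean size at most [r / e], and [walk m] at most [B / e]; the coefficients turn these into the
    two terms of the bound, using that all times are at least [a]. *)
Lemma Ex_walk_modulus (a B r e t : R) (m n : nat) (j : 'I_p) :
  0 < a -> a <= t -> 0 < e -> 0 < r -> 0 < B -> (m <= n)%N ->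
  t < e ^+ 2 * m%:R -> e ^+ 2 * n%:R <= t + r ^+ 2 -> e ^+ 2 * m%:R <= B ^+ 2 ->
  L1 P (fun w => `|(e * n%:R)^-1 * walk Z n j w - t^-1 * (e * walk Z m j w)|) /\
  Ex P (fun w => `|(e * n%:R)^-1 * walk Z n j w - t^-1 * (e * walk Z m j w)|) <=
    r / a + r ^+ 2 * B / a ^+ 2.
Proof.
move=> a0 at_ e0 r0 B0 mn tm nt mB.
have t0 : 0 < t by exact: lt_le_trans at_.
have e20 : 0 < e ^+ 2 by rewrite exprn_gt0.
have mnR : (m%:R : R) <= n%:R by rewrite ler_nat.
have en : t < e ^+ 2 * n%:R by rewrite (lt_le_trans tm)// ler_pM2l.
have n0 : (0 : R) < n%:R by rewrite -(pmulr_rgt0 _ e20) (lt_trans t0).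
have [|Lw Ew] := @Ex_walk_increment_le m n j (r / e) mn (divr_gt0 r0 e0).
  by rewrite expr_div_n ler_pdivlMr// natrB// mulrC mulrBr lerBlDr (le_trans nt)// addrC lerD2l ltW.
have [|Lm Em] := @Ex_walk_le m j (B / e) (divr_gt0 B0 e0).
  by rewrite expr_div_n ler_pdivlMr// mulrC.
pose c1 := (e * n%:R)^-1; pose c2 := e * (e ^+ 2 * n%:R - t) / (e ^+ 2 * n%:R * t).
have c10 : 0 <= c1 by rewrite invr_ge0 mulr_ge0// ltW.
have c20 : 0 <= c2.
  apply: divr_ge0; first by rewrite mulr_ge0 ?(ltW e0)// subr_ge0 ltW.
  by rewrite mulr_ge0 ?(ltW t0)// mulr_ge0 ?(ltW n0)// ltW.
have q w : `|(e * n%:R)^-1 * walk Z n j w - t^-1 * (e * walk Z m j w)| <=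
    c1 * `|walk Z n j w - walk Z m j w| + c2 * `|walk Z m j w|.
  have -> : (e * n%:R)^-1 * walk Z n j w - t^-1 * (e * walk Z m j w) =
      c1 * (walk Z n j w - walk Z m j w) - c2 * walk Z m j w.
    by rewrite /c1 /c2; field; rewrite !gt_eqF.
  by rewrite (le_trans (ler_normB _ _))// (normrM c1) (normrM c2) (ger0_norm c10) (ger0_norm c20).
have LA : L1 P (fun w => c1 * `|walk Z n j w - walk Z m j w|) by exact/L1Z/L1_abs.
have LB : L1 P (fun w => c2 * `|walk Z m j w|) by exact/L1Z/L1_abs.
have Lq : L1 P (fun w => `|(e * n%:R)^-1 * walk Z n j w - t^-1 * (e * walk Z m j w)|).
  apply/L1_abs/L1B; last by apply/L1Z/L1Z.
  apply: L1Z; apply: L1_of_sq; first exact: (measurable_walk hZiid).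
  by have [] := walk_sqr hZiid hZstd n j.
split=> //; apply: (le_trans (le_Ex Lq (L1D LA LB) q)).
rewrite ExD// !ExZ//; try exact: L1_abs.
apply: lerD.
  apply: (le_trans (ler_wpM2l c10 Ew)).
  have -> : c1 * (r / e) = r / (e ^+ 2 * n%:R).
    by rewrite /c1; field; rewrite !gt_eqF.
  rewrite ler_wpM2l ?(ltW r0)// lef_pV2 ?posrE ?(lt_trans t0 en)//.
  by rewrite (le_trans at_)// ltW.
apply: (le_trans (ler_wpM2l c20 Em)).
have -> : c2 * (B / e) = (e ^+ 2 * n%:R - t) * B / (e ^+ 2 * n%:R * t).
  by rewrite /c2; field; rewrite !gt_eqF.
apply: ler_pM.
- by rewrite mulr_ge0 ?(ltW B0)// subr_ge0 ltW.
- by rewrite invr_ge0 mulr_ge0// ltW// (lt_trans t0).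
- by rewrite ler_wpM2r ?(ltW B0)// lerBlDl.
rewrite lef_pV2 ?posrE ?exprn_gt0 ?mulr_gt0//.
by rewrite expr2 ler_pM// ?ltW// ?(le_lt_trans at_).
Qed.

End WalkModulus.

(** * Riemann sums as expectations under a uniform law *)

Section RiemannSums.
Context (R : realType) (a b : R) (ab : a < b).
Notation mu := (@lebesgue_measure R).
Notation U := (uniform_prob ab).

Let ba0 : 0 < b - a. Proof. by rewrite subr_gt0. Qed.

Lemma Ex_uniform (f : R -> R) : measurable_fun setT f -> (forall x, 0 <= f x <= 1) ->
  (b - a) * Ex U f = \int[mu]_(x in `[a, b]) f x.
Proof.
move=> mf f01; have Lf : L1 U f.
  by apply: (@L1_bounded _ _ _ U _ 1) => // x; have /andP[? ?] := f01 x; rewrite ger0_norm.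
have := integral_uniform ab (f := EFin \o f) (proj2 (measurable_EFinP _ _) mf).
have h x : (0 <= (EFin \o f) x)%E by rewrite lee_fin; have /andP[] := f01 x.
move=> /(_ h); rewrite Ex_EFin// => E.
have : ((b - a)%:E * (Ex U f)%:E = \int[mu]_(x in `[a, b]) (f x)%:E)%E.
  by rewrite E muleA -EFinM mulfV ?gt_eqF// mul1e.
by rewrite -EFinM /Rintegral => <-.
Qed.

Lemma Pr_uniform (c d : R) : a <= c -> c <= d -> d <= b -> Pr U `[c, d[ = (d - c) / (b - a).
Proof.
move=> ac cd db.
apply: (mulfI (lt0r_neq0 ba0)); rewrite mulrCA mulfV ?gt_eqF// mulr1.
rewrite -Ex_indic//; rewrite Ex_uniform//; last first.
  by move=> x; rewrite indicE; case: (_ \in _); rewrite ?ler01 ?lexx.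
rewrite /Rintegral integral_indic//= setIidl; last first.
  by move=> x /=; rewrite !in_itv/= => /andP[cx xd]; rewrite (le_trans ac)// ltW// (lt_le_trans xd).
rewrite lebesgue_measure_itv/= lte_fin; case: ltP => //= dc.
by apply/esym/eqP; rewrite subr_eq0; apply/eqP/le_anti; rewrite dc cd.
Qed.

Definition grid (K k : nat) : R := a + (b - a) / K.+1%:R * k%:R.

Lemma gridS K k : grid K k.+1 = grid K k + (b - a) / K.+1%:R.
Proof. by rewrite /grid -natr1; ring. Qed.

Lemma gridK K : grid K K.+1 = b.
Proof. by rewrite /grid divfK// subrKC. Qed.

Lemma grid_lt K k : grid K k < grid K k.+1.
Proof. by rewrite gridS ltrDl divr_gt0. Qed.

Lemma le_grid K : {homo grid K : i j / (i <= j)%N >-> i <= j}.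
Proof. by apply/nondecreasing_seqP => i; exact/ltW/grid_lt. Qed.

(** A Riemann sum is [b - a] times the uniform expectation of a step function equal to [phi] at the
    left end of each cell; continuity gives pointwise convergence and boundedness the domination. *)
Lemma riemann_sum_cvg (phi : R -> R) : (forall t, 0 <= phi t <= 1) ->
  (forall t, a <= t -> {for t, continuous phi}) ->
  \sum_(0 <= k < K.+1) (b - a) / K.+1%:R * phi (grid K k) @[K --> \oo] -->
  \int[mu]_(t in `[a, b[) phi t.
Proof.
move=> phi01 cphi.
pose f t := phi t * \1_(`[a, b[%classic) t.
pose s K t := \sum_(0 <= k < K.+1) phi (grid K k) * \1_(`[grid K k, grid K k.+1[%classic) t.
have ms K : measurable_fun setT (s K).
  by apply: measurable_sum => k; apply: measurable_funM => //; exact: measurable_indic.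
(* The cell containing [t] is found by truncation; all other indicators vanish there. *)
have s_in K t : a <= t < b -> exists k : nat,
    [/\ (k <= K)%N, grid K k <= t < grid K k.+1 & s K t = phi (grid K k)].
  move=> /andP[at_ tb]; pose D := (b - a) / K.+1%:R.
  have D0 : 0 < D by rewrite divr_gt0.
  pose k := Num.truncn ((t - a) / D).
  have /andP[k1 k2] : k%:R <= (t - a) / D < k.+1%:R.
    by apply: truncn_itv; rewrite divr_ge0 ?subr_ge0// ltW.
  have kt : grid K k <= t < grid K k.+1.
    rewrite /grid -/D -lerBrDl -ltrBlDl [D * _]mulrC [D * _]mulrC -ler_pdivlMr// k1.
    by rewrite -ltr_pdivrMr.
  have kK : (k <= K)%N.
    rewrite leqNgt; apply/negP => /(@le_grid K); rewrite gridK => bk.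
    by have /andP[/(le_trans bk)] := kt; rewrite leNgt tb.
  exists k; split=> //; rewrite /s big_mkord (bigD1 (Ordinal (kK : (k < K.+1)%N)))//= big1 => [|i /eqP ik].
    by rewrite addr0 indicE mem_set ?mulr1//= in_itv.
  rewrite indicE memNset ?mulr0//= in_itv/= => /andP[i1 i2]; apply: ik; apply/val_inj => /=.
  have /andP[k3 k4] := kt.
  have [ik|ki|//] := ltngtP (i : nat) k.
    by have := le_lt_trans (le_trans (@le_grid K _ _ ik) k3) i2; rewrite ltxx.
  by have := le_lt_trans (le_trans (@le_grid K _ _ ki) i1) k4; rewrite ltxx.
have s_out K t : ~~ (a <= t < b) -> s K t = 0.
  move=> tab; rewrite /s big_nat big1// => k /andP[_ kK].
  rewrite indicE memNset ?mulr0//= in_itv/= => /andP[h1 h2]; move/negP : tab; apply.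
  rewrite (le_trans _ h1) ?(lt_le_trans h2)//.
    by rewrite -(gridK K); exact: le_grid.
  by rewrite -[leLHS]addr0 -[0](mulr0 ((b - a) / K.+1%:R)); exact: (@le_grid K 0).
have s01 K t : 0 <= s K t <= 1.
  have [h|h] := boolP (a <= t < b); last by rewrite s_out// lexx ler01.
  by have [k [_ _ ->]] := s_in K t h.
have f_in t : a <= t < b -> f t = phi t.
  by move=> h; rewrite /f indicE mem_set ?mulr1//= in_itv.
have f_out t : ~~ (a <= t < b) -> f t = 0.
  by move=> h; rewrite /f indicE memNset ?mulr0//= in_itv/=; exact/negP.
have f01 t : 0 <= f t <= 1.
  have [h|h] := boolP (a <= t < b); last by rewrite f_out// lexx ler01.
  by rewrite f_in.
have cvg_s t : s K t @[K --> \oo] --> f t.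
  have [h|h] := boolP (a <= t < b); last first.
    rewrite f_out//; rewrite (_ : s ^~ t = fun=> 0); first exact: cvg_cst.
    by apply/funext => K; rewrite s_out.
  rewrite f_in//; apply/cvgrPdist_lt => /= x x0; have /andP[at_ _] := h.
  have /cvgrPdist_lt/(_ _ x0)/nbhs_ballP[dl /= dl0 Hdl] := cphi t at_.
  have : \forall K \near \oo, (b - a) / K.+1%:R < dl.
    have : (fun K : nat => (b - a) * K.+1%:R^-1) @ \oo --> (b - a) * 0.
      by apply: cvgMr; exact: cvg_harmonic.
    rewrite mulr0 => /cvgrPdist_lt/(_ _ dl0); apply: filterS => K.
    by rewrite sub0r normrN ger0_norm// divr_ge0// ltW.
  apply: filterS => K HK; have [k [_ /andP[k1 k2] ->]] := s_in K t h.
  apply: Hdl; rewrite /ball/= ger0_norm ?subr_ge0// (le_lt_trans _ HK)//.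
  by rewrite lerBlDl -gridS ltW.
have [Lf cvgE] := @Ex_dominated_cvg _ _ _ U s f (fun=> 1) ms (L1_cst U 1)
  (fun K t => let: conj h1 h2 := andP (s01 K t) in eq_ind_r (fun x => x <= 1) h2 (ger0_norm h1)) cvg_s.
have -> : \int[mu]_(t in `[a, b[) phi t = (b - a) * Ex U f.
  rewrite Ex_uniform//; last exact: (L1_measurable Lf).
  rewrite /Rintegral; congr fine.
  rewrite (_ : `[a, b[%classic = `[a, b]%classic `&` `[a, b[%classic); last first.
    by rewrite setIidr// => x /=; rewrite !in_itv/= => /andP[-> /ltW].
  rewrite integral_mkcondr; apply: eq_integral => t _; rewrite patchE mem_setE in_itv/=.
  by case: ifPn => h; [rewrite f_in|rewrite f_out].
have <- : (fun K => (b - a) * Ex U (s K)) =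
    (fun K : nat => \sum_(0 <= k < K.+1) (b - a) / K.+1%:R * phi (grid K k)).
  apply/funext => K; rewrite Ex_sum; last first.
    by move=> k; apply/L1Z/L1_indic.
  rewrite mulr_sumr big_nat [RHS]big_nat; apply: eq_bigr => k /andP[_ kK].
  rewrite ExZ; last exact: L1_indic.
  rewrite Ex_indic// Pr_uniform; last 3 first.
  - by rewrite -[leLHS]addr0 -[0](mulr0 ((b - a) / K.+1%:R)); exact: (@le_grid K 0).
  - exact/ltW/grid_lt.
  - by rewrite -(gridK K); exact: le_grid.
  have -> : grid K k.+1 - grid K k = (b - a) / K.+1%:R by rewrite gridS addrAC subrr add0r.
  by move: ((b - a) / K.+1%:R) => D; field; rewrite gt_eqF.
by apply: cvgMr.
Qed.

End RiemannSums.

Lemma lipschitz1_cvg (R : realType) (I : finType) (J : Type) (G : set_system J) (FG : Filter G)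
    (L : R) (F : (I -> R) -> R) (x : J -> I -> R) (y : I -> R) :
  lipschitz1 L F -> (forall i, x j i @[j --> G] --> y i) -> F (x j) @[j --> G] --> F y.
Proof.
move=> LF xy.
have h : L * \sum_i `|y i - x j i| @[j --> G] --> L * \sum_i `|y i - y i|.
  apply: cvgMr; apply: cvg_big => [|i _]; first exact: add_continuous.
  by apply: cvg_norm; apply: cvgB => //; exact: cvg_cst.
have h2 : L * \sum_i `|y i - x j i| @[j --> G] --> (0 : R).
  by move: h; rewrite [X in _ * X]big1 ?mulr0// => i _; rewrite subrr normr0.
apply/cvgrPdist_lt => /= e e0; have /cvgrPdist_lt/(_ _ e0) := h2.
apply: filterS => j; rewrite sub0r normrN => /(le_lt_trans _); apply.
by rewrite (le_trans (LF _ _))// ler_norm.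
Qed.

Lemma continuous_BMV d (T : measurableType d) (R : realType) (P : probability T R) (p : nat)
    (W : R -> T -> 'cV[R]_p) (t : R) (j : 'I_p) (w : T) :
  standard_BM_vector P W -> 0 < t -> {for t, continuous (fun t => W t w j 0)}.
Proof.
move=> hW t0; have /continuous_within_itvcyP[+ _] := @BM_continuous _ _ _ _ _ (BMV_coord hW j) w.
by apply; rewrite in_itv/= t0.
Qed.

(** * Comparison of a sum over indices with a sum over blocks *)

Section Blocks.
Context (R : realType) (nk : nat -> nat) (nkS : forall k, (nk k <= nk k.+1)%N).

Let nk0 N : (nk 0 <= nk N)%N.
Proof. by elim: N => // N IH; exact: leq_trans (nkS N). Qed.

Lemma sum_blocks (x : nat -> R) N :
  \sum_(0 <= k < N) \sum_(nk k <= n < nk k.+1) x n = \sum_(nk 0 <= n < nk N) x n.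
Proof.
elim: N => [|N IH]; first by rewrite !big_geq.
by rewrite big_nat_recr//= IH [RHS](big_cat_nat (n := nk N)).
Qed.

(** Two errors: replacing each [x n] by the block value [c k], and replacing the scaled block length
    by [D], which costs at most [s] per block. *)
Lemma block_riemann_le N (x c : nat -> R) (s D : R) : 0 <= s ->
  (forall k, 0 <= c k <= 1) ->
  (forall k, `|s * (nk k.+1 - nk k)%:R - D| <= s) ->
  `|s * (\sum_(nk 0 <= n < nk N) x n) - \sum_(0 <= k < N) D * c k| <=
  s * (\sum_(0 <= k < N) \sum_(nk k <= n < nk k.+1) `|x n - c k|) + s * N%:R.
Proof.
move=> s0 c01 hD; rewrite -sum_blocks mulr_sumr -sumrB.
have -> : s * N%:R = \sum_(0 <= k < N) s by rewrite sumr_const_nat subn0 mulr_natr.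
rewrite mulr_sumr -big_split/= (le_trans (ler_norm_sum _ _ _))//; apply: ler_sum => k _.
have -> : s * (\sum_(nk k <= n < nk k.+1) x n) - D * c k =
    s * (\sum_(nk k <= n < nk k.+1) (x n - c k)) + (s * (nk k.+1 - nk k)%:R - D) * c k.
  by rewrite sumrB sumr_const_nat -[c k *+ _]mulr_natr; ring.
rewrite (le_trans (ler_normD _ _))// lerD//.
  by rewrite normrM ger0_norm// ler_wpM2l// ler_norm_sum.
have /andP[c0 c1] := c01 k.
by rewrite normrM (ger0_norm c0) (le_trans (ler_wpM2l _ c1))// mulr1.
Qed.

End Blocks.

(** * Convergence of smoothed exceedance times on a compact window *)

Section CentralLimit.
Context d (T : measurableType d) (R : realType) (P : probability T R).
Variables (p : nat) (Z : nat -> T -> 'cV[R]_p).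
Hypothesis hZiid : iid P (Z : nat -> T -> borelV R p).
Hypothesis hZstd : forall i, standardized P (Z i).
Context d' (T' : measurableType d') (P' : probability T' R).
Variable W : R -> T' -> 'cV[R]_p.
Hypothesis hW : standard_BM_vector P' W.
Variables (D : ('I_p -> R) -> R) (Lc : R).
Hypothesis hD : lipschitz1 Lc D.
Hypothesis Lc0 : 0 < Lc.
Variable Y : R -> nat -> T -> R.
Hypothesis mY : forall e n, (0 < n)%N -> measurable_fun setT (Y e n).
Hypothesis hY : forall a rho eta : R, 0 < a -> 0 < rho -> 0 < eta ->
  \forall e \near 0^'+, exists A : set T, [/\ measurable A, Pr P A <= eta &
    forall w, ~ A w -> forall n, (gidx a e <= n)%N ->
      `|Y e n w - D (fun j => (e * n%:R)^-1 * walk Z n j w)| <= rho].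
Variables (f g : R -> R) (Lf Lg : R).
Hypothesis Lf0 : 0 < Lf.
Hypothesis fL : forall x y, `|f x - f y| <= Lf * `|x - y|.
Hypothesis f01 : forall x, 0 <= f x <= 1.
Hypothesis Lg0 : 0 < Lg.
Hypothesis gL : forall x y, `|g x - g y| <= Lg * `|x - y|.
Hypothesis g01 : forall x, 0 <= g x <= 1.
Variables (a b : R).
Hypothesis a0 : 0 < a.
Hypothesis ab : a < b.

Let b0 : 0 < b. Proof. exact: lt_trans ab. Qed.
Let b10 : 0 < b + 1. Proof. by rewrite ltr_wpDl// ltW. Qed.

(** Here [Y e n] stands for the scaled error, close to [D] of the scaled walk by [hY], and [f] for a
    Lipschitz substitute of the indicator of [[1, +oo[]; the outer test function is [g]. *)
Definition late_count (e : R) (w : T) : R :=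
  e ^+ 2 * \sum_(gidx a e <= n < gidx b e) f (Y e n w).

Definition grid_value (K : nat) (x : 'I_K.+1 * 'I_p -> R) : R :=
  \sum_(k < K.+1) (b - a) / K.+1%:R * f (D (fun j => (grid a b K k)^-1 * x (k, j))).

Definition limit_time (w : T') : R :=
  \int[lebesgue_measure]_(t in `[a, b[) f (D (fun j => t^-1 * W t w j 0)).

Lemma lipschitz_measurable (h : R -> R) (L : R) : (forall x y, `|h x - h y| <= L * `|x - y|) ->
  measurable_fun setT h.
Proof.
move=> hL; have h1 : lipschitz1 L (fun x : unit -> R => h (x tt)).
  by move=> x y; rewrite (eq_bigl (pred1 tt)) ?big_pred1_eq ?hL//; case.
have := @measurable_lipschitz1 _ _ R unit _ L (fun x _ => x) h1.
exact.
Qed.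

Lemma measurable_late_count e : measurable_fun setT (late_count e).
Proof.
apply: measurable_funM => //.
(* [mY] concerns positive indices; the range starts at a positive [gidx], so the shift [n.-1.+1]
   changes nothing there. *)
rewrite (_ : (fun _ => _) = (fun w => \sum_(gidx a e <= n < gidx b e) f (Y e n.-1.+1 w))).
  apply: measurable_sum => n; apply: measurableT_comp; first exact: lipschitz_measurable fL.
  exact: mY.
apply/funext => w; apply: eq_big_nat => n /andP[+ _].
by rewrite /gidx; case: n.
Qed.

Let tau0 K : 0 < grid a b K 0.
Proof. by rewrite /grid mulr0 addr0. Qed.

Let a_grid K k : a <= grid a b K k.
Proof. by rewrite -[leLHS]addr0 -[0](mulr0 ((b - a) / K.+1%:R)); exact: (@le_grid _ _ _ ab K 0). Qed.

Let tau_gt0' K k : 0 < grid a b K k.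
Proof. exact: lt_le_trans (a_grid K k). Qed.

(** The terms of the bound are, in order: the exceptional event of [hY], the error [rho] of [Y]
    outside it, the rounding of block lengths, and the oscillation of the scaled walk within a
    block. The last is controlled only in mean, which suffices since [g] is Lipschitz and the
    comparison is between expectations. *)
Lemma late_count_discretized (K : nat) (r rho eta : R) : 0 < r -> 0 < rho -> 0 < eta ->
  (b - a) / K.+1%:R <= r ^+ 2 ->
  \forall e \near 0^'+,
   `|Ex P (fun w => g (late_count e w)) -
     Ex P (fun w => g (@grid_value K (fun kj => e * walk Z (gidx (grid a b K kj.1) e) kj.2 w)))| <=
   eta + Lg * (Lf * (rho * (b + 1)) + e ^+ 2 * K.+1%:R
              + Lf * Lc * ((b + 1) * (p%:R * (r / a + r ^+ 2 * (b + 1) / a ^+ 2)))).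
Proof.
move=> r0 rho0 eta0 Kr.
pose tau := grid a b K; pose Dl := (b - a) / K.+1%:R.
near=> e.
have e0 : 0 < e by near: e; exact: nbhs_right_gt.
have e1 : e < 1 by near: e; exact: nbhs_right_lt.
have [A [mA PA hA]] : exists A : set T, [/\ measurable A, Pr P A <= eta &
    forall w, ~ A w -> forall n, (gidx a e <= n)%N ->
      `|Y e n w - D (fun j => (e * n%:R)^-1 * walk Z n j w)| <= rho].
  by near: e; exact: hY.
have e20 : 0 < e ^+ 2 by rewrite exprn_gt0.
have e21 : e ^+ 2 <= 1 by rewrite expr2 mulr_ile1// ltW.
pose nk k := gidx (tau k) e.
have nkS k : (nk k <= nk k.+1)%N by apply: le_gidx => //; exact/ltW/grid_lt.
pose kap := r / a + r ^+ 2 * (b + 1) / a ^+ 2.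
have kap0 : 0 <= kap.
  by rewrite addr_ge0// divr_ge0 ?mulr_ge0 ?sqr_ge0// ltW.
pose q k n j w := `|(e * n%:R)^-1 * walk Z n j w - (tau k)^-1 * (e * walk Z (nk k) j w)|.
have Lq k n j : L1 P (q k n j).
  have Lw m i : L1 P (walk Z m i).
    apply: L1_of_sq; first exact: (measurable_walk hZiid).
    by have [] := walk_sqr hZiid hZstd m i.
  by apply/L1_abs/L1B; [exact/L1Z|exact/L1Z/L1Z].
have Eq k n j : (k < K.+1)%N -> (nk k <= n < nk k.+1)%N -> Ex P (q k n j) <= kap.
  move=> kK /andP[kn nk1].
  have := @Ex_walk_modulus _ _ _ P _ _ hZiid hZstd a (b + 1) r e (tau k) (nk k) n j a0 (a_grid K k) e0 r0 b10 kn (gidx_gt _ e0).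
  case=> //.
    have : e ^+ 2 * n.+1%:R <= tau k.+1 + e ^+ 2.
      apply: (le_trans _ (gidx_le (ltW (tau_gt0' K k.+1)) e0)).
      by rewrite ler_pM2l// ler_nat.
    rewrite -natr1 mulrDr mulr1 lerD2r => /le_trans; apply.
    by rewrite /tau gridS lerD2l.
  apply: (le_trans (gidx_le (ltW (tau_gt0' K k)) e0)).
  have kb : grid a b K k <= b by rewrite -[leRHS](gridK a b K); apply: (@le_grid _ _ _ ab) => //; exact: ltnW.
  apply: (le_trans (lerD kb e21)); rewrite expr2 ler_peMr ?(ltW b10)// lerDr.
  exact: ltW.
pose qs w := \sum_(0 <= k < K.+1) \sum_(nk k <= n < nk k.+1) \sum_(j < p) q k n j w.
have Lqs : L1 P qs by apply: L1_sum => k; apply: L1_sum => n; exact: L1_sum.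
have qs0 w : 0 <= qs w.
  by apply: sumr_ge0 => k _; apply: sumr_ge0 => n _; apply: sumr_ge0 => j _; exact: normr_ge0.
have nkb : e ^+ 2 * (nk K.+1)%:R <= b + 1.
  by rewrite /nk /tau gridK (le_trans (gidx_le (ltW b0) e0))// lerD2l.
have card_le c : 0 <= c -> e ^+ 2 * (\sum_(nk 0 <= n < nk K.+1) c) <= (b + 1) * c.
  move=> c0; rewrite sumr_const_nat -[c *+ _]mulr_natl mulrA ler_wpM2r// (le_trans _ nkb)//.
  by rewrite ler_pM2l// ler_nat leq_subr.
have Eqs : e ^+ 2 * Ex P qs <= (b + 1) * (p%:R * kap).
  apply: (le_trans _ (card_le _ (mulr_ge0 (ler0n _ p) kap0))).
  rewrite ler_pM2l// -(sum_blocks nkS) Ex_sum; last by move=> k; apply: L1_sum => n; exact: L1_sum.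
  apply: ler_sum_nat => k /andP[_ kK]; rewrite Ex_sum; last by move=> n; exact: L1_sum.
  apply: ler_sum_nat => n hn; rewrite Ex_sum//.
  apply: (le_trans (ler_sum _ (fun j _ => Eq k n j kK hn))).
  by rewrite sumr_const card_ord mulr_natl.
pose X w (kj : 'I_K.+1 * 'I_p) := e * walk Z (gidx (grid a b K kj.1) e) kj.2 w.
pose C1 := Lf * (rho * (b + 1)) + e ^+ 2 * K.+1%:R.
have C10 : 0 <= C1.
  by rewrite addr_ge0// ?mulr_ge0 ?ltW.
have key w : ~ A w -> `|late_count e w - @grid_value K (X w)| <= C1 + Lf * Lc * (e ^+ 2 * qs w).
  move=> Aw.
  have := @block_riemann_le _ nk nkS K.+1 (fun n => f (Y e n w))
    (fun k => f (D (fun j => (tau k)^-1 * (e * walk Z (nk k) j w)))) (e ^+ 2) Dl (ltW e20)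
    (fun k => f01 _).
  have hDl k : `|e ^+ 2 * (nk k.+1 - nk k)%:R - Dl| <= e ^+ 2.
    have l1 := gidx_gt (tau k) e0; have l2 := gidx_gt (tau k.+1) e0.
    have l3 := gidx_le (ltW (tau_gt0' K k)) e0; have l4 := gidx_le (ltW (tau_gt0' K k.+1)) e0.
    have l5 : tau k.+1 = tau k + Dl by exact: gridS.
    rewrite natrB// mulrBr -/(nk k) in l1 l2 l3 l4 *.
    rewrite ler_norml; move: l1 l2 l3 l4; rewrite -/(nk k) -/(nk k.+1) -/tau l5.
    move: (e ^+ 2 * (nk k)%:R) (e ^+ 2 * (nk k.+1)%:R) => x y; lra.
  move=> /(_ hDl).
  have -> : nk K.+1 = gidx b e by rewrite /nk /tau gridK.
  have -> : nk 0%N = gidx a e by rewrite /nk /tau /grid mulr0 addr0.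
  rewrite big_mkord => /le_trans; apply.
  have hq : \sum_(0 <= k < K.+1) \sum_(nk k <= n < nk k.+1)
      `|f (Y e n w) - f (D (fun j => (tau k)^-1 * (e * walk Z (nk k) j w)))| <=
      (\sum_(nk 0 <= n < nk K.+1) Lf * rho) + Lf * Lc * qs w.
    rewrite -(sum_blocks nkS) /qs mulr_sumr -big_split/=.
    apply: ler_sum_nat => k _; rewrite mulr_sumr -big_split/=.
    apply: ler_sum_nat => n /andP[kn _].
    apply: (le_trans (fL _ _)); rewrite -mulrA -mulrDr ler_wpM2l ?(ltW Lf0)//.
    rewrite -(subrK (D (fun j => (e * n%:R)^-1 * walk Z n j w)) (Y e n w)) -addrA.
    rewrite (le_trans (ler_normD _ _))// lerD ?hD ?hA//.
    exact: (leq_trans (le_gidx e0 (a_grid K k)) kn).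
  rewrite /C1 addrAC lerD2r (le_trans (ler_wpM2l (ltW e20) hq))// mulrDr.
  rewrite lerD//; last by rewrite mulrCA.
  by rewrite (le_trans (card_le _ _)) ?mulr_ge0 ?(ltW Lf0) ?(ltW rho0)// [leLHS]mulrC mulrA.
have LH : L1 P (fun w => \1_A w + Lg * (C1 + Lf * Lc * (e ^+ 2 * qs w))).
  apply: L1D; first exact: L1_indic.
  by apply/L1Z/L1D; [exact: L1_cst|exact/L1Z/L1Z].
have LV : L1 P (fun w => g (late_count e w)).
  apply: (@L1_bounded _ _ _ _ _ 1) => [|w]; last by have /andP[? ?] := g01 (late_count e w); rewrite ger0_norm.
  by apply: measurableT_comp; [exact: lipschitz_measurable gL|exact: measurable_late_count].
have LG : L1 P (fun w => g (@grid_value K (X w))).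
  apply: (@L1_bounded _ _ _ _ _ 1) => [|w]; last by have /andP[? ?] := g01 (@grid_value K (X w)); rewrite ger0_norm.
  apply: measurableT_comp; first exact: lipschitz_measurable gL.
  apply: measurable_sum => k; apply: measurable_funM => //.
  apply: measurableT_comp; first exact: lipschitz_measurable fL.
  apply: (measurable_lipschitz1 hD) => j; apply: measurable_funM => //.
  by apply: measurable_funM => //; exact: (measurable_walk hZiid).
rewrite -ExB//.
have hk w : `|g (late_count e w) - g (@grid_value K (X w))| <= \1_A w + Lg * (C1 + Lf * Lc * (e ^+ 2 * qs w)).
  have R0 : 0 <= Lg * (C1 + Lf * Lc * (e ^+ 2 * qs w)).
    apply: mulr_ge0; first exact: ltW.
    apply: addr_ge0 => //; apply: mulr_ge0; first by apply: mulr_ge0; exact: ltW.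
    by apply: mulr_ge0 => //; exact: ltW.
  rewrite indicE; have [wA|wA] := boolP (w \in A).
    apply: (@le_trans _ _ 1); last by rewrite lerDl.
    by have := g01 (late_count e w); have := g01 (@grid_value K (X w)); rewrite ler_norml; lra.
  rewrite add0r (le_trans (gL _ _))// ler_wpM2l ?(ltW Lg0)//; apply: key.
  by move: wA; rewrite notin_setE.
apply: (le_trans (normEx_le (L1B LV LG) LH hk)).
rewrite ExD; [|exact: L1_indic|by apply/L1Z/L1D; [exact: L1_cst|exact/L1Z/L1Z]].
rewrite Ex_indic// lerD// ExZ; last by apply: L1D; [exact: L1_cst|exact/L1Z/L1Z].
rewrite ler_wpM2l ?(ltW Lg0)// ExD; [|exact: L1_cst|exact/L1Z/L1Z].
rewrite Ex_cst lerD2l ExZ; last exact: L1Z.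
by rewrite ExZ// ler_wpM2l//; apply: mulr_ge0; exact: ltW.
Unshelve. all: by end_near.
Qed.

Lemma grid_value_lipschitz K :
  lipschitz1 (Lg * ((b - a) / K.+1%:R * (Lf * (Lc * a^-1)))) (fun x => g (@grid_value K x)).
Proof.
move=> x y; rewrite (le_trans (gL _ _))// -mulrA ler_wpM2l ?(ltW Lg0)//.
rewrite /grid_value -sumrB (le_trans (ler_norm_sum _ _ _))//.
have -> : \sum_kj `|x kj - y kj| = \sum_(k < K.+1) \sum_(j < p) `|x (k, j) - y (k, j)|.
  by rewrite pair_bigA; apply: eq_bigr => -[].
have Dl0 : 0 <= (b - a) / K.+1%:R by rewrite divr_ge0// subr_ge0 ltW.
rewrite -mulrA 2!mulr_sumr; apply: ler_sum => k _; rewrite -mulrBr normrM (ger0_norm Dl0) ler_wpM2l//.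
rewrite (le_trans (fL _ _))// -mulrA ler_wpM2l ?(ltW Lf0)//.
rewrite (le_trans (hD _ _))// -mulrA ler_wpM2l ?(ltW Lc0)// mulr_sumr; apply: ler_sum => j _.
rewrite -mulrBr normrM ger0_norm ?invr_ge0 ?(ltW (tau_gt0' K k))// ler_wpM2r//.
by rewrite lef_pV2 ?posrE.
Qed.

Lemma grid_value_cvg w :
  @grid_value K (fun kj => W (grid a b K kj.1) w kj.2 0) @[K --> \oo] --> limit_time w.
Proof.
have h := @riemann_sum_cvg _ _ _ ab (fun t => f (D (fun j => t^-1 * W t w j 0))) (fun t => f01 _).
rewrite (_ : (fun K => _) = (fun K => \sum_(0 <= k < K.+1) (b - a) / K.+1%:R *
    f (D (fun j => (grid a b K k)^-1 * W (grid a b K k) w j 0)))); last first.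
  by apply/funext => K; rewrite big_mkord.
apply: h => t at_; have t0 : 0 < t by exact: lt_le_trans at_.
apply: (@lipschitz1_cvg R 'I_p R (nbhs t) _ (Lf * Lc) (f \o D)
  (fun s j => s^-1 * W s w j 0) (fun j => t^-1 * W t w j 0)); last first.
  move=> j; apply: cvgM; first by apply: continuousV; rewrite ?gt_eqF.
  exact: (continuous_BMV hW).
by apply: lipschitz1_comp => //; exact: ltW.
Qed.

Let grid_value_ge0 K x : 0 <= @grid_value K x <= b - a.
Proof.
have Dl0 : 0 <= (b - a) / K.+1%:R by rewrite divr_ge0// subr_ge0 ltW.
apply/andP; split.
  by apply: sumr_ge0 => k _; rewrite mulr_ge0//; have /andP[] := f01 (D (fun j => (grid a b K k)^-1 * x (k, j))).
apply: (@le_trans _ _ (\sum_(k < K.+1) (b - a) / K.+1%:R)).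
  apply: ler_sum => k _; rewrite ler_piMr//.
  by have /andP[] := f01 (D (fun j => (grid a b K k)^-1 * x (k, j))).
by rewrite sumr_const card_ord -[leLHS]mulr_natr divfK.
Qed.

Let measurable_grid_value K :
  measurable_fun setT (fun w => @grid_value K (fun kj => W (grid a b K kj.1) w kj.2 0)).
Proof.
apply: measurable_sum => k; apply: measurable_funM => //.
apply: measurableT_comp; first exact: lipschitz_measurable fL.
apply: (measurable_lipschitz1 hD) => j; apply: measurable_funM => //.
by apply: (measurable_BMV hW); exact: ltW.
Qed.

Lemma measurable_limit_time : measurable_fun setT limit_time.
Proof.
have [|/L1_measurable//] := @Ex_dominated_cvg _ _ _ P' _ _ (fun=> b - a) measurable_grid_value (L1_cst _ _) _ grid_value_cvg.
move=> K w; have /andP[h1 h2] := @grid_value_ge0 K (fun kj => W (grid a b K kj.1) w kj.2 0).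
by rewrite ger0_norm.
Qed.

(** A three-way comparison: the sum with its grid version, the grid version of the walk with that of
    [W], and the latter with the time integral. The mesh is chosen before [e], which is possible
    because the oscillation bound depends on [e] only through the mesh parameter [r]. The errors are
    four times [x / 8], then [x / 4] and [x / 4]. *)
Lemma late_count_cvg :
  Ex P (fun w => g (late_count e w)) @[e --> 0^'+] --> Ex P' (fun w => g (limit_time w)).
Proof.
have cg : continuous g.
  move=> x; apply: (@lipschitz1_cvg R unit R (nbhs x) _ Lg (fun x => g (x tt)) (fun y _ => y) (fun=> x)) => //.
  by move=> u v; rewrite (eq_bigl (pred1 tt)) ?big_pred1_eq ?gL//; case.
have gn x : `|g x| <= 1 by have /andP[h1 h2] := g01 x; rewrite ger0_norm.
have [||_ cvgK] := @Ex_dominated_cvg _ _ _ P'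
  (fun K w => g (@grid_value K (fun kj => W (grid a b K kj.1) w kj.2 0)))
  (fun w => g (limit_time w)) (fun=> 1) _ (L1_cst _ 1) (fun K w => gn _).
- by move=> K; apply: measurableT_comp; [exact: lipschitz_measurable gL|exact: measurable_grid_value].
- by move=> w; apply: (cvg_comp _ _ (grid_value_cvg (w := w))); exact: cg.
apply/cvgrPdist_lt => /= x x0.
pose C2 := a^-1 + (b + 1) / a ^+ 2; pose M := Lg * (Lf * Lc * ((b + 1) * (p%:R * C2))).
have C20 : 0 <= C2 by rewrite addr_ge0// ?divr_ge0 ?invr_ge0// ?exprn_ge0 ?(ltW a0)// ltW.
have M0 : 0 <= M.
  apply: mulr_ge0; first exact: ltW.
  apply: mulr_ge0; first by apply: mulr_ge0; exact: ltW.
  by apply: mulr_ge0; [exact: ltW|exact: mulr_ge0].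
(* As [r <= 1], the oscillation term is at most [r M], hence at most [x / 8]. *)
pose r := Num.min 1 (x / 8 / (M + 1)).
have M1 : 0 < M + 1 by rewrite ltr_wpDl.
have r0 : 0 < r by rewrite lt_min ltr01 !divr_gt0.
have r1 : r <= 1 by rewrite ge_min lexx.
have Mr : Lg * (Lf * Lc * ((b + 1) * (p%:R * (r / a + r ^+ 2 * (b + 1) / a ^+ 2)))) <= x / 8.
  have h : r / a + r ^+ 2 * (b + 1) / a ^+ 2 <= r * C2.
    have -> : r * C2 = r / a + r * ((b + 1) / a ^+ 2) by rewrite /C2 mulrDr.
    rewrite lerD2l -[leLHS]mulrA ler_wpM2r//.
      by rewrite divr_ge0 ?(ltW b10)// exprn_ge0 ?(ltW a0).
    by rewrite expr2 ler_piMr// ltW.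
  apply: (@le_trans _ _ (r * M)).
    have -> : r * M = Lg * (Lf * Lc * ((b + 1) * (p%:R * (r * C2)))) by rewrite /M; ring.
    apply: ler_wpM2l; first exact: ltW.
    apply: ler_wpM2l; first by apply: mulr_ge0; exact: ltW.
    by apply: ler_wpM2l; [exact: ltW|exact: ler_wpM2l].
  apply: (@le_trans _ _ (x / 8 / (M + 1) * (M + 1))); last by rewrite divfK// gt_eqF.
  by rewrite ler_pM ?(ltW r0)// ?ge_min ?lexx ?orbT// lerDl.
have [K [Kr KE]] : exists K : nat, (b - a) / K.+1%:R <= r ^+ 2 /\
    `|Ex P' (fun w => g (limit_time w)) -
      Ex P' (fun w => g (@grid_value K (fun kj => W (grid a b K kj.1) w kj.2 0)))| < x / 4.
  have x4 : 0 < x / 4 by rewrite divr_gt0.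
  have r20 : 0 < r ^+ 2 by rewrite exprn_gt0.
  have /cvgrPdist_lt/(_ _ x4) H1 := cvgK.
  have : (fun K : nat => (b - a) * K.+1%:R^-1) @ \oo --> (b - a) * 0.
    by apply: cvgMr; exact: cvg_harmonic.
  rewrite mulr0 => /cvgrPdist_lt/(_ _ r20) H2.
  have [K [h1 h2]] := filter_ex (filterI H1 H2).
  exists K; split=> //; apply/ltW/(le_lt_trans _ h2).
  by rewrite sub0r normrN ger0_norm// divr_ge0// subr_ge0 ltW.
have /cvgrPdist_lt/(_ (x / 4)) := @walk_fdd_cvg _ _ _ P _ _ hZiid hZstd _ _ P' _ hW (grid a b K) K.+1 _ _
  (tau0 K) (grid_lt ab K) (@grid_value_lipschitz K) (fun x => g01 _).
have x4 : 0 < x / 4 by rewrite divr_gt0.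
have x8 : 0 < x / 8 by rewrite divr_gt0.
move=> /(_ x4) H1.
pose rho := x / 8 / (Lg * (Lf * (b + 1))).
have LL : 0 < Lg * (Lf * (b + 1)) by rewrite mulr_gt0// mulr_gt0.
have rho0 : 0 < rho by rewrite divr_gt0.
have H2 := late_count_discretized r0 rho0 x8 Kr.
near=> e.
have H3 : Lg * (e ^+ 2 * K.+1%:R) <= x / 8.
  near: e; have LK : 0 < Lg * K.+1%:R by rewrite mulr_gt0.
  apply: (@near0_right _ _ (Num.min 1 (x / 8 / (Lg * K.+1%:R)))).
    by rewrite lt_min ltr01 divr_gt0.
  move=> e e0; rewrite lt_min => /andP[e1 ex].
  apply: (@le_trans _ _ (e * (Lg * K.+1%:R))).
    by rewrite mulrCA ler_pM2r// expr2 ler_piMl// ltW.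
  by rewrite -ler_pdivlMr// ltW.
have h1 : `|Ex P' (fun w => g (@grid_value K (fun kj => W (grid a b K kj.1) w kj.2 0))) -
     Ex P (fun w => g (@grid_value K (fun kj => e * walk Z (gidx (grid a b K kj.1) e) kj.2 w)))| < x / 4.
  by near: e.
have : `|Ex P (fun w => g (late_count e w)) -
     Ex P (fun w => g (@grid_value K (fun kj => e * walk Z (gidx (grid a b K kj.1) e) kj.2 w)))| <=
   x / 8 + Lg * (Lf * (rho * (b + 1)) + e ^+ 2 * K.+1%:R
              + Lf * Lc * ((b + 1) * (p%:R * (r / a + r ^+ 2 * (b + 1) / a ^+ 2)))).
  by near: e.
have Erho : Lg * (Lf * (rho * (b + 1))) = x / 8.
  transitivity (rho * (Lg * (Lf * (b + 1)))); first by ring.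
  by rewrite divfK// gt_eqF.
rewrite [Lg * (_ + _)]mulrDr [Lg * (_ + _)]mulrDr Erho; move: H3 h1 KE Mr.
move: (Lg * (e ^+ 2 * _)) (Lg * (Lf * Lc * _)) => y1 y2.
set v1 := Ex P' _; set v2 := Ex P _; set v3 := Ex P' _; set v4 := Ex P _.
move: v1 v2 v3 v4 => v1 v2 v3 v4.
by rewrite !ltr_norml !ler_norml; lra.
Unshelve. all: by end_near.
Qed.

End CentralLimit.

                                            

(** * Lipschitz ramps approximating indicators of half-lines *)

Section Ramp.
Context (R : realType).
Implicit Types u v x y c : R.

Definition clamp x : R := Num.max 0 (Num.min 1 x).

Lemma clamp01 x : 0 <= clamp x <= 1.
Proof. by rewrite /clamp le_max lexx/= ge_max ler01/= ge_min lexx. Qed.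

Lemma clamp_lipschitz x y : `|clamp x - clamp y| <= `|x - y|.
Proof.
have hmin (u v : R) : `|Num.min 1 u - Num.min 1 v| <= `|u - v|.
  have := ler_norm (u - v); have := ler_norm (v - u); rewrite (distrC v u) ler_norml.
  by move: `|u - v| => t; case: (leP 1 u); case: (leP 1 v); lra.
apply: le_trans (hmin x y); rewrite /clamp; move: (Num.min 1 x) (Num.min 1 y) => u v.
have := ler_norm (u - v); have := ler_norm (v - u); rewrite (distrC v u) ler_norml.
by move: `|u - v| => t; case: (leP 0 u); case: (leP 0 v); lra.
Qed.

Definition ramp u v x : R := clamp ((x - u) / (v - u)).

Lemma ramp01 u v x : 0 <= ramp u v x <= 1.
Proof. exact: clamp01. Qed.

Lemma ramp_lipschitz u v x y : u < v -> `|ramp u v x - ramp u v y| <= (v - u)^-1 * `|x - y|.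
Proof.
move=> uv; rewrite (le_trans (clamp_lipschitz _ _))// -mulrBl opprB addrA subrK normrM mulrC.
by rewrite (@ger0_norm _ (v - u)^-1)// invr_ge0 subr_ge0 ltW.
Qed.

Lemma ramp_eq0 u v x : u < v -> x <= u -> ramp u v x = 0.
Proof.
move=> uv xu; apply/eqP; rewrite /ramp /clamp; apply/eqP/max_idPl.
rewrite ge_min; apply/orP; right.
by rewrite ler_pdivrMr ?subr_gt0// mul0r subr_le0.
Qed.

Lemma ramp_eq1 u v x : u < v -> v <= x -> ramp u v x = 1.
Proof.
move=> uv vx; rewrite /ramp /clamp min_l; first by rewrite max_r.
by rewrite ler_pdivlMr ?subr_gt0// mul1r lerD2r.
Qed.

Lemma ramp_le_indic u v x : u < v -> ramp u v x <= \1_(`]u, +oo[%classic) x.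
Proof.
move=> uv; rewrite indicE; have [_|] := boolP (x \in _); first by have /andP[] := ramp01 u v x.
by rewrite notin_setE/= in_itv/= andbT => /negP; rewrite -leNgt => xu; rewrite ramp_eq0.
Qed.

Lemma near_harmonic_lt (dl : R) : 0 < dl -> \forall n \near \oo, n.+1%:R^-1 < dl.
Proof.
move=> dl0; have /cvgrPdist_lt/(_ _ dl0) := @cvg_harmonic R.
by apply: filterS => n; rewrite sub0r normrN ger0_norm //=.
Qed.

(** Ramps that reach 1 at [c] lie above the indicator of the closed half-line and converge to it;
    those that leave 0 at [c] ([ramp_cvg_gt]) lie below and converge to the indicator of the open
    one. *)
Lemma ramp_cvg_ge c x :
  ramp (c - n.+1%:R^-1) c x @[n --> \oo] --> (\1_(`[c, +oo[%classic) x : R).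
Proof.
have cn n : c - n.+1%:R^-1 < c by rewrite ltrBlDr ltrDl.
rewrite indicE; have [|] := boolP (x \in _).
  rewrite inE/= in_itv/= andbT => cx; rewrite (_ : (fun n => _) = fun=> 1); first exact: cvg_cst.
  by apply/funext => n; rewrite ramp_eq1.
rewrite notin_setE/= in_itv/= andbT => /negP; rewrite -ltNge => xc.
apply: cvg_near_cst; have cx0 : 0 < c - x by rewrite subr_gt0.
apply: filterS (near_harmonic_lt cx0) => n h.
by rewrite ramp_eq0// lerBrDr addrC -lerBrDr ltW.
Qed.

Lemma ramp_cvg_gt c x :
  ramp c (c + n.+1%:R^-1) x @[n --> \oo] --> (\1_(`]c, +oo[%classic) x : R).
Proof.
have cn n : c < c + n.+1%:R^-1 by rewrite ltrDl.
rewrite indicE; have [|] := boolP (x \in _); last first.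
  rewrite notin_setE/= in_itv/= andbT => /negP; rewrite -leNgt => xc.
  rewrite (_ : (fun n => _) = fun=> 0); first exact: cvg_cst.
  by apply/funext => n; rewrite ramp_eq0.
rewrite inE/= in_itv/= andbT => cx.
apply: cvg_near_cst; have cx0 : 0 < x - c by rewrite subr_gt0.
apply: filterS (near_harmonic_lt cx0) => n h.
by rewrite ramp_eq1// addrC -lerBrDr ltW.
Qed.

End Ramp.

(** * From Lipschitz test functions to probabilities of half-lines *)

Section LipschitzLaw.
Context d (T : measurableType d) (R : realType) (P : probability T R).
Variables X X' : T -> R.
Hypothesis mX : measurable_fun setT X.
Hypothesis mX' : measurable_fun setT X'.
Hypothesis lawX : forall (f : R -> R) (L : R), 0 < L -> (forall x y, `|f x - f y| <= L * `|x - y|) ->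
  (forall x, 0 <= f x <= 1) -> Ex P (fun w => f (X w)) = Ex P (fun w => f (X' w)).

Lemma Pr_lipschitz_law (B : set R) (f : nat -> R -> R) (L : nat -> R) : measurable B ->
  (forall n, 0 < L n) -> (forall n x y, `|f n x - f n y| <= L n * `|x - y|) ->
  (forall n x, 0 <= f n x <= 1) -> (forall x, f n x @[n --> \oo] --> (\1_B x : R)) ->
  P (X @^-1` B) = P (X' @^-1` B).
Proof.
move=> mB L0 fL f01 fB.
have mXB (V : T -> R) : measurable_fun setT V -> measurable (V @^-1` B).
  by move=> mV; rewrite -[X in measurable X]setTI; exact: mV.
have h (V : T -> R) : measurable_fun setT V ->
    Ex P (fun w => f n (V w)) @[n --> \oo] --> Pr P (V @^-1` B).
  move=> mV; rewrite -Ex_indic; last exact: mXB.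
  have [] := @Ex_dominated_cvg _ _ _ P (fun n w => f n (V w)) (\1_(V @^-1` B)) (fun=> 1) _ (L1_cst P 1) _ _ => //.
  - by move=> n; apply: measurableT_comp => //; exact: (lipschitz_measurable (fL n)).
  - by move=> n w; have /andP[h1 h2] := f01 n (V w); rewrite ger0_norm.
rewrite !PrE; [|exact: mXB|exact: mXB]; congr EFin.
apply: (cvg_unique (@Rhausdorff R) (h X mX)).
rewrite (_ : (fun n => _) = (fun n => Ex P (fun w => f n (X' w)))); first exact: h.
by apply/funext => n; exact: lawX (L0 n) (fL n) (f01 n).
Qed.

Lemma Pr_ge_lipschitz_law c : P [set w | c <= X w] = P [set w | c <= X' w].
Proof.
have E (V : T -> R) : [set w | c <= V w] = V @^-1` `[c, +oo[.
  by apply/seteqP; split => w /=; rewrite in_itv/= andbT.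
rewrite !E; apply: (@Pr_lipschitz_law _ (fun n => ramp (c - n.+1%:R^-1) c) (fun n => (c - (c - n.+1%:R^-1))^-1)) => //.
- by move=> n; rewrite invr_gt0 subKr.
- by move=> n x y; apply: ramp_lipschitz; rewrite ltrBlDr ltrDl.
- by move=> n x; exact: ramp01.
- exact: ramp_cvg_ge.
Qed.

Lemma Pr_gt_lipschitz_law c : P [set w | c < X w] = P [set w | c < X' w].
Proof.
have E (V : T -> R) : [set w | c < V w] = V @^-1` `]c, +oo[.
  by apply/seteqP; split => w /=; rewrite in_itv/= andbT.
rewrite !E; apply: (@Pr_lipschitz_law _ (fun n => ramp c (c + n.+1%:R^-1)) (fun n => (c + n.+1%:R^-1 - c)^-1)) => //.
- by move=> n; rewrite invr_gt0 addrAC subrr add0r.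
- by move=> n x y; apply: ramp_lipschitz; rewrite ltrDl.
- by move=> n x; exact: ramp01.
- exact: ramp_cvg_gt.
Qed.

End LipschitzLaw.

(** * Occupation times of the Brownian ratio *)

Section OccupationTime.
Context (R : realType) (p : nat) d' (T' : measurableType d') (P' : probability T' R).
Variable W : R -> T' -> 'cV[R]_p.
Hypothesis hW : standard_BM_vector P' W.
Variables (D : ('I_p -> R) -> R) (Lc : R).
Hypothesis hD : lipschitz1 Lc D.
Hypothesis D_scale : forall (a : R) x, D (fun j => a * x j) = `|a| * D x.
Hypothesis D_ge0 : forall x, 0 <= D x.
Notation mu := (@lebesgue_measure R).

Definition BM_ratio (t : R) (w : T') : R := D (fun j => t^-1 * W t w j 0).

Definition occupation (B : set R) (w : T') : \bar R := mu [set t | 0 < t /\ B (BM_ratio t w)].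

Let mpos : measurable [set x : measurableTypeR R * T' | 0 < x.1].
Proof.
have -> : [set x : measurableTypeR R * T' | 0 < x.1] = `]0, +oo[%classic `*` setT.
  by apply/seteqP; split => x /=; rewrite in_itv/= andbT; [move=> ?; split|case].
by apply: measurableX.
Qed.

(** Joint measurability in time and chance: by path continuity [W] is the limit of step functions in
    time taking the value at the right end of each cell of length [1 / (n + 1)]. The indicator
    removes the times at which nothing is assumed of [W]. *)
Let measurable_W_joint j : measurable_fun setT
  (fun x : measurableTypeR R * T' => \1_(`]0, +oo[%classic) x.1 * W x.1 x.2 j 0).
Proof.
pose h (n : nat) (x : measurableTypeR R * T') : R := \1_(`]0, +oo[%classic) x.1 *
  \sum_(0 <= k < n.+1 * n.+1) \1_(`[k%:R / n.+1%:R, k.+1%:R / n.+1%:R[%classic) x.1 *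
    W (k.+1%:R / n.+1%:R) x.2 j 0.
apply: (@measurable_fun_cvg _ _ R setT h).
  move=> n; apply: measurable_funM.
    by apply: measurableT_comp => //; exact: measurable_indic.
  apply: measurable_sum => k; apply: measurable_funM.
    by apply: measurableT_comp => //; exact: measurable_indic.
  have mWk : measurable_fun setT (fun w => W (k.+1%:R / n.+1%:R) w j 0).
    by apply: (measurable_BMV hW); exact: divr_ge0.
  exact: (measurableT_comp mWk measurable_snd).
move=> [t w] _ /=; have [t0|t0] := leP t 0.
  rewrite indicE memNset /= ?in_itv/= ?andbT; last by apply/negP; rewrite -leNgt.
  rewrite mul0r (_ : (fun n => _) = fun=> 0); first exact: cvg_cst.
  by apply/funext => n; rewrite /h /= indicE memNset ?mul0r//= in_itv/= andbT; apply/negP; rewrite -leNgt.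
pose tn (n : nat) : R := (Num.truncn (t * n.+1%:R)).+1%:R / n.+1%:R.
have tn1 n : t < tn n.
  by rewrite ltr_pdivlMr//; exact: truncnS_gt.
have tn2 n : tn n <= t + n.+1%:R^-1.
  rewrite /tn ler_pdivrMr// mulrDl mulVf ?pnatr_eq0// -natr1 lerD2r.
  by have /andP[] := truncn_itv (mulr_ge0 (ltW t0) (ler0n R n.+1)).
have E : \forall n \near \oo, W (tn n) w j 0 = h n (t, w).
  (* From this rank on [t < n + 1], so [t] lies in one of the [(n + 1)^2] cells. *)
  exists (Num.truncn t) => // n /= tN.
  have tn' : t < n.+1%:R by apply: (lt_le_trans (truncnS_gt _)); rewrite ler_nat.
  rewrite /h /= indicE mem_set /= ?in_itv/= ?t0// mul1r.
  have kN : (Num.truncn (t * n.+1%:R) < n.+1 * n.+1)%N.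
    rewrite truncn_lt_nat ?mulr_ge0 ?(ltW t0)// natrM ltr_pM2r//.
  rewrite big_mkord (bigD1 (Ordinal kN))//= big1 ?addr0.
    rewrite indicE mem_set ?mul1r//= in_itv/= ler_pdivrMr// ltr_pdivlMr//.
    by apply/truncn_itv; rewrite mulr_ge0// ltW.
  move=> i /eqP ik; rewrite indicE memNset ?mul0r//= in_itv/= ler_pdivrMr// ltr_pdivlMr// => hi.
  by apply: ik; apply/val_inj => /=; apply/esym; exact: truncn_def.
apply: (cvg_trans (near_eq_cvg E)).
rewrite indicE mem_set /= ?in_itv/= ?t0// mul1r.
apply: (cvg_comp tn (fun s => W s w j 0)); last exact: (continuous_BMV hW).
apply: (@squeeze_cvgr _ _ _ _ (fun=> t) (fun n => t + n.+1%:R^-1)).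
- by apply: nearW => n; rewrite ltW//= tn2.
- exact: cvg_cst.
- by rewrite -[X in _ --> X]addr0; apply: cvgD; [exact: cvg_cst|exact: cvg_harmonic].
Qed.

(** On positive times the power is [t^-1], so this function coincides with [BM_ratio] there;
    [measurable_occupation_set] restricts to those times. *)
Lemma measurable_ratio_joint : measurable_fun setT
  (fun x : measurableTypeR R * T' => D (fun j => x.1 `^ (-1) * (\1_(`]0, +oo[%classic) x.1 * W x.1 x.2 j 0))).
Proof.
apply: (measurable_lipschitz1 hD) => j; apply: measurable_funM; last exact: measurable_W_joint.
exact: (measurableT_comp (measurable_powR (-1)) measurable_fst).
Qed.

Lemma measurable_occupation_set (B : set R) : measurable B ->
  measurable [set x : measurableTypeR R * T' | 0 < x.1 /\ B (BM_ratio x.1 x.2)].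
Proof.
move=> mB; have := measurableI _ _ mpos (measurable_ratio_joint measurableT mB).
have E t w : 0 < t -> D (fun j => t `^ (-1) * (\1_(`]0, +oo[%classic) t * W t w j 0)) = BM_ratio t w.
  move=> t0; congr D; apply/funext => j.
  by rewrite indicE mem_set /= ?in_itv/= ?t0// mul1r powR_inv1// ltW.
by congr measurable; rewrite setTI; apply/seteqP; split => -[t w] /= [t0]; rewrite E.
Qed.

Lemma measurable_ratio t : 0 < t -> measurable_fun setT (BM_ratio t).
Proof.
move=> t0; apply: (measurable_lipschitz1 hD) => j; apply: measurable_funM => //.
by apply: (measurable_BMV hW); exact: ltW.
Qed.

Let ysectionE (A : set (measurableTypeR R * T')) w : ysection A w = [set t | A (t, w)].
Proof. by apply/seteqP; split => t; rewrite /ysection/= inE. Qed.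

Let xsectionE (A : set (measurableTypeR R * T')) t : xsection A t = [set w | A (t, w)].
Proof. by apply/seteqP; split => w; rewrite /xsection/= inE. Qed.

Lemma measurable_occupation B : measurable B -> measurable_fun setT (occupation B).
Proof.
move=> mB; have := measurable_fun_ysection mu (measurable_occupation_set mB).
by congr measurable_fun; apply/funext => w; rewrite /= ysectionE.
Qed.

Let tonelli (A : set (measurableTypeR R * T')) : measurable A ->
  (\int[mu]_t P' [set w | A (t, w)] = \int[P']_w mu [set t | A (t, w)])%E.
Proof.
move=> mA; have := indic_fubini_tonelli mu P' mA.
rewrite indic_fubini_tonelli_FE// indic_fubini_tonelli_GE// => E.
by transitivity (\int[mu]_x (P' \o xsection A) x)%E;
  [apply: eq_integral => t _; rewrite /= xsectionE|rewrite E; apply: eq_integral => w _; rewrite /= ysectionE].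
Qed.

(** Write [W t / t] as [(sqrt t)^-1] times [(sqrt t)^-1 W t]; the second factor has the law of
    [W 1], and the first comes out of [D] by homogeneity. *)
Lemma ratio_law t (f : R -> R) (L : R) : 0 < t -> 0 < L ->
  (forall x y, `|f x - f y| <= L * `|x - y|) -> (forall x, 0 <= f x <= 1) ->
  Ex P' (fun w => f (BM_ratio t w)) = Ex P' (fun w => f ((Num.sqrt t)^-1 * BM_ratio 1 w)).
Proof.
move=> t0 L0 fL f01; pose r := (Num.sqrt t)^-1.
have r0 : 0 < r by rewrite invr_gt0 sqrtr_gt0.
have r2 : t^-1 = r * r.
  by rewrite -invfM -expr2 sqr_sqrtr// ltW.
have rf : lipschitz1 (L * r * Lc) ((fun y => f (r * y)) \o D).
  apply: lipschitz1_comp => //; first by rewrite mulr_ge0// ltW.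
  by move=> x y; rewrite (le_trans (fL _ _))// -mulrBr normrM (gtr0_norm r0) mulrA.
have := BMV_scaling hW t0 rf (fun x => f01 _).
have -> : (fun w => ((fun y => f (r * y)) \o D) (fun j => (Num.sqrt t)^-1 * W t w j 0)) =
    (fun w => f (BM_ratio t w)).
  apply/funext => w /=; rewrite -[X in X * D _](gtr0_norm r0) -D_scale; congr (f (D _)).
  by apply/funext => j; rewrite -/r r2 mulrA.
move=> ->; apply: eq_Ex => w /=; congr (f (r * D _)).
by apply/funext => j; rewrite invr1 mul1r.
Qed.

Let mratio1 t : measurable_fun setT (fun w => (Num.sqrt t)^-1 * BM_ratio 1 w).
Proof. by apply: measurable_funM => //; exact: measurable_ratio. Qed.

Let joint1 (B : set R) : measurable B ->
  measurable [set x : measurableTypeR R * T' | 0 < x.1 /\ B ((Num.sqrt x.1)^-1 * BM_ratio 1 x.2)].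
Proof.
move=> mB; have mf : measurable_fun setT (fun x : measurableTypeR R * T' => x.1 `^ (- 2^-1) * BM_ratio 1 x.2).
  apply: measurable_funM; last exact: (measurableT_comp (measurable_ratio ltr01) measurable_snd).
  exact: (measurableT_comp (measurable_powR (- 2^-1)) measurable_fst).
have := measurableI _ _ mpos (mf measurableT _ mB).
have E t : 0 < t -> t `^ (- 2^-1) = (Num.sqrt t)^-1.
  by move=> t0; rewrite powRN powR12_sqrt// ltW.
by congr measurable; rewrite setTI; apply/seteqP; split => -[t w] /= [t0]; rewrite E.
Qed.

(** Tonelli turns the expected time into an integral over [t] of one-time probabilities. Scaling
    replaces [D (W t / t)] by [(sqrt t)^-1 D (W 1)], and a second use of Tonelli leaves, for each
    outcome, the length of an explicit set of times. *)
Let integral_occupation (B : set R) (s : R -> R) : measurable B ->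
  (forall t, 0 < t -> P' [set w | B (BM_ratio t w)] = P' [set w | B ((Num.sqrt t)^-1 * BM_ratio 1 w)]) ->
  (forall x, 0 <= x -> mu [set t | 0 < t /\ B ((Num.sqrt t)^-1 * x)] = (s x)%:E) ->
  (\int[P']_w occupation B w = \int[P']_w (s (BM_ratio 1 w))%:E)%E.
Proof.
move=> mB lawB muB.
transitivity (\int[P']_w mu [set t : R | (0 < t)%R /\ B ((Num.sqrt t)^-1 * BM_ratio 1 w)%R])%E; last first.
  by apply: eq_integral => w _; rewrite muB//; exact: D_ge0.
apply: (etrans (esym (tonelli (measurable_occupation_set mB)))).
apply: (etrans _ (tonelli (joint1 mB))).
apply: eq_integral => t _ /=; have [t0|t0] := leP t 0.
  by congr (P' _); apply/seteqP; split => w [].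
have E (Q : T' -> Prop) : [set w | true /\ Q w] = [set w | Q w].
  by apply/seteqP; split => w // -[].
by rewrite !E; exact: lawB.
Qed.

Let sqrt_ge (c t x : R) : 0 < c -> 0 < t -> 0 <= x ->
  (c <= (Num.sqrt t)^-1 * x) = (t <= (c ^+ 2)^-1 * x ^+ 2).
Proof.
move=> c0 t0 x0; have s0 : 0 < Num.sqrt t by rewrite sqrtr_gt0.
rewrite mulrC ler_pdivlMr// ler_pdivlMl ?exprn_gt0//.
have -> : c ^+ 2 * t = (c * Num.sqrt t) ^+ 2 by rewrite exprMn sqr_sqrtr// ltW.
by rewrite ler_pXn2r// nnegrE// mulr_ge0// ltW.
Qed.

Let sqrt_gt (c t x : R) : 0 < c -> 0 < t -> 0 <= x ->
  (c < (Num.sqrt t)^-1 * x) = (t < (c ^+ 2)^-1 * x ^+ 2).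
Proof.
move=> c0 t0 x0; have s0 : 0 < Num.sqrt t by rewrite sqrtr_gt0.
rewrite mulrC ltr_pdivlMr// ltr_pdivlMl ?exprn_gt0//.
have -> : c ^+ 2 * t = (c * Num.sqrt t) ^+ 2 by rewrite exprMn sqr_sqrtr// ltW.
by rewrite ltr_pXn2r// nnegrE// mulr_ge0// ltW.
Qed.

(** For fixed [x = D (W 1)] the times are []0, x^2 / c^2]]; for the strict inequality below the
    interval is open on the right, with the same length. *)
Lemma integral_occupation_ge c : 0 < c ->
  (\int[P']_w occupation `[c, +oo[ w = \int[P']_w ((c ^+ 2)^-1 * BM_ratio 1 w ^+ 2)%:E)%E.
Proof.
move=> c0; apply: (@integral_occupation _ (fun x => (c ^+ 2)^-1 * x ^+ 2)) => //.
  move=> t t0; have E (V : T' -> R) : [set w | `[c, +oo[%classic (V w)] = [set w | c <= V w].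
    by apply/seteqP; split => w /=; rewrite in_itv/= andbT.
  rewrite !E; apply: Pr_ge_lipschitz_law => //; first exact: measurable_ratio.
  by move=> f L L0 fL f01; exact: ratio_law fL f01.
move=> x x0; have s0 : 0 <= (c ^+ 2)^-1 * x ^+ 2 by rewrite mulr_ge0// ?invr_ge0 exprn_ge0// ltW.
have -> : [set t | 0 < t /\ `[c, +oo[%classic ((Num.sqrt t)^-1 * x)] = `]0, (c ^+ 2)^-1 * x ^+ 2]%classic.
  apply/seteqP; split => t /=; rewrite !in_itv/= andbT.
    by move=> [t0]; rewrite sqrt_ge// t0.
  by move=> /andP[t0 h]; rewrite sqrt_ge.
rewrite lebesgue_measure_itv/= lte_fin; case: ltP => h; first by rewrite oppr0 adde0.
by congr EFin; apply/le_anti; rewrite s0.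
Qed.

Lemma integral_occupation_gt c : 0 < c ->
  (\int[P']_w occupation `]c, +oo[ w = \int[P']_w ((c ^+ 2)^-1 * BM_ratio 1 w ^+ 2)%:E)%E.
Proof.
move=> c0; apply: (@integral_occupation _ (fun x => (c ^+ 2)^-1 * x ^+ 2)) => //.
  move=> t t0; have E (V : T' -> R) : [set w | `]c, +oo[%classic (V w)] = [set w | c < V w].
    by apply/seteqP; split => w /=; rewrite in_itv/= andbT.
  rewrite !E; apply: Pr_gt_lipschitz_law => //; first exact: measurable_ratio.
  by move=> f L L0 fL f01; exact: ratio_law fL f01.
move=> x x0; have s0 : 0 <= (c ^+ 2)^-1 * x ^+ 2 by rewrite mulr_ge0// ?invr_ge0 exprn_ge0// ltW.
have -> : [set t | 0 < t /\ `]c, +oo[%classic ((Num.sqrt t)^-1 * x)] = `]0, (c ^+ 2)^-1 * x ^+ 2[%classic.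
  apply/seteqP; split => t /=; rewrite !in_itv/= andbT.
    by move=> [t0]; rewrite sqrt_gt// t0.
  by move=> /andP[t0 h]; rewrite sqrt_gt.
rewrite lebesgue_measure_itv/= lte_fin; case: ltP => h; first by rewrite oppr0 adde0.
by congr EFin; apply/le_anti; rewrite s0.
Qed.

Lemma L1_ratio_sqr : L1 P' (fun w => BM_ratio 1 w ^+ 2).
Proof.
pose s w := \sum_i \sum_j `|W 1 w i 0 * W 1 w j 0|.
have Ls : L1 P' (fun w => Lc ^+ 2 * s w).
  apply/L1Z/L1_sum => i; apply: L1_sum => j; apply: L1_abs.
  have [Li _ _] := BMV_moments hW i ltr01; have [Lj _ _] := BMV_moments hW j ltr01.
  by apply: L1_mul_sq => //; apply: (measurable_BMV hW).
apply: (L1_le _ Ls) => [|w]; first exact: measurable_funX (measurable_ratio ltr01).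
have D0 : D (fun=> 0) = 0.
  by rewrite -[RHS](mul0r (D (fun=> 0))) -[X in X * _](normr0 R) -D_scale; congr D; apply/funext => j; rewrite mul0r.
have h : BM_ratio 1 w <= Lc * \sum_j `|W 1 w j 0|.
  have := hD (fun j => 1^-1 * W 1 w j 0) (fun=> 0); rewrite D0 subr0 => /(le_trans (ler_norm _)).
  by rewrite (eq_bigr (fun j => `|W 1 w j 0|))// => j _; rewrite invr1 mul1r subr0.
rewrite ger0_norm ?sqr_ge0//.
have -> : Lc ^+ 2 * s w = (Lc * \sum_j `|W 1 w j 0|) ^+ 2.
  rewrite exprMn; congr (_ * _); rewrite /s expr2 mulr_suml; apply: eq_bigr => i _.
  by rewrite mulr_sumr; apply: eq_bigr => j _; rewrite normrM.
have r0 : 0 <= BM_ratio 1 w by exact: D_ge0.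
by rewrite ler_pXn2r// nnegrE// (le_trans r0).
Qed.

Let occupation_integrable B c : measurable B ->
  (\int[P']_w occupation B w = \int[P']_w ((c ^+ 2)^-1 * BM_ratio 1 w ^+ 2)%:E)%E ->
  P'.-integrable setT (occupation B).
Proof.
move=> mB E; apply/integrableP; split; first exact: measurable_occupation.
rewrite (eq_integral (occupation B)); last by move=> w _; rewrite gee0_abs// measure_ge0.
by rewrite E Ex_EFin ?ltry//; exact/L1Z/L1_ratio_sqr.
Qed.

Lemma occupation_fin_num c : 0 < c -> {ae P', forall w, occupation `[c, +oo[ w \is a fin_num}.
Proof.
move=> c0; have := integrable_ae measurableT (occupation_integrable (@measurable_itv _ `[c, +oo[) (integral_occupation_ge c0)).
by apply: filterS => w; exact.
Qed.

(** The two times are ordered and have the same finite expectation, so they agree almost surely: no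
    time is spent exactly at the level [c]. *)
Lemma occupation_gt_ge c : 0 < c -> {ae P', forall w, occupation `]c, +oo[ w = occupation `[c, +oo[ w}.
Proof.
move=> c0.
have Ig := occupation_integrable (@measurable_itv _ `]c, +oo[) (integral_occupation_gt c0).
have Ie := occupation_integrable (@measurable_itv _ `[c, +oo[) (integral_occupation_ge c0).
have le w : (occupation `]c, +oo[ w <= occupation `[c, +oo[ w)%E.
  apply: le_measure; rewrite ?inE.
  - have := measurable_ysection w (measurable_occupation_set (@measurable_itv _ `]c, +oo[)).
    by rewrite ysectionE.
  - have := measurable_ysection w (measurable_occupation_set (@measurable_itv _ `[c, +oo[)).
    by rewrite ysectionE.
  by move=> t /= [t0]; rewrite !in_itv/= !andbT => /ltW.
have fg := integrable_ae measurableT Ig; have fe := integrable_ae measurableT Ie.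
have mB : measurable_fun setT (fun w => occupation `[c, +oo[ w - occupation `]c, +oo[ w)%E.
  by apply: emeasurable_funB; exact: measurable_occupation.
have : (\int[P']_w `|occupation `[c, +oo[ w - occupation `]c, +oo[ w| = 0)%E.
  transitivity (\int[P']_w (occupation `[c, +oo[ w - occupation `]c, +oo[ w))%E.
    apply: ae_eq_integral => //; first exact: measurableT_comp.
    by apply: filterS2 fg fe => w /(_ I) h1 /(_ I) h2 _; rewrite gee0_abs// sube_ge0// h1.
  rewrite integralB// integral_occupation_ge// integral_occupation_gt// subee//.
  by rewrite Ex_EFin//; exact/L1Z/L1_ratio_sqr.
move=> /(ae_eq_integral_abs P' measurableT mB); apply: filterS3 fg fe => w /(_ I) h1 /(_ I) h2 /(_ I) /=.
move: h1 h2; case: (occupation _ w) => // x _; case: (occupation _ w) => // y _.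
by rewrite -EFinB => -[/eqP]; rewrite subr_eq0 => /eqP ->.
Qed.

(** The windows exhaust []0, +oo[] while [f n] tends to the indicator of [B]. The domination is by
    the indicator of the times with ratio at least [c], integrable because that occupation time is
    finite. *)
Lemma limit_time_cvg (B : set R) (c : R) (f : nat -> R -> R) w : measurable B ->
  (forall n, measurable_fun setT (f n)) -> (forall n x, 0 <= f n x) ->
  (forall n x, f n x <= \1_(`[c, +oo[%classic) x) ->
  (forall x, f n x @[n --> \oo] --> (\1_B x : R)) ->
  occupation `[c, +oo[ w \is a fin_num -> occupation B w \is a fin_num ->
  limit_time W D (f n) n.+1%:R^-1 n.+2%:R w @[n --> \oo] --> fine (occupation B w).
Proof.
move=> mB mf f0 fc fB finc finB.
pose O : set (measurableTypeR R) := `]0, +oo[%classic.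
pose J n : set (measurableTypeR R) := `[n.+1%:R^-1, n.+2%:R[%classic.
have mO : measurable O by exact: measurable_itv.
have mJ n : measurable (J n) by exact: measurable_itv.
pose rt : measurableTypeR R -> R := fun t => D (fun j => t `^ (-1) * (\1_O t * W t w j 0)).
have mrt : measurable_fun setT rt := measurableT_comp measurable_ratio_joint (pair2_measurable w).
have inO t : (t \in O) = (0 < t) by rewrite mem_setE in_itv/= andbT.
have inJ n t : (t \in J n) = (n.+1%:R^-1 <= t < n.+2%:R) by rewrite mem_setE in_itv.
have J0 n t : t \in J n -> 0 < t.
  by rewrite inJ => /andP[+ _]; apply: lt_le_trans; rewrite invr_gt0.
have rtE t : 0 < t -> rt t = BM_ratio t w.
  by move=> t0; congr D; apply/funext => j; rewrite indicE inO t0 mul1r powR_inv1// ltW.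
pose F n t : \bar R := (f n (rt t) * \1_(J n) t)%:E.
pose G (C : set R) t : \bar R := (\1_(O `&` rt @^-1` C) t)%:E.
have indO (C : set R) t : 0 < t -> \1_(O `&` rt @^-1` C) t = \1_C (rt t) :> R.
  by move=> t0; rewrite !indicE in_setI inO t0/= [t \in _](_ : _ = (rt t \in C)).
have mOC (C : set R) : measurable C -> measurable (O `&` rt @^-1` C).
  by move=> mC; apply: measurableI => //; rewrite -[X in measurable X]setTI; exact: mrt.
have mG (C : set R) : measurable C -> measurable_fun setT (G C).
  by move=> mC; apply/measurable_EFinP/measurable_indic; exact: mOC.
have mF n : measurable_fun setT (F n).
  apply/measurable_EFinP/measurable_funM; last exact/measurable_indic.
  exact: (measurableT_comp (mf n) mrt).
have occE (C : set R) : measurable C -> (\int[mu]_t G C t = occupation C w)%E.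
  move=> mC; rewrite integral_indic ?setIT//; last exact: mOC.
  congr (mu _); apply/seteqP; split => t /= [].
    by rewrite -in_setE inO => t0; rewrite rtE.
  by move=> t0 h; split; [rewrite -in_setE inO|rewrite rtE].
have mc : measurable (`[c, +oo[%classic : set R) by exact: measurable_itv.
have [] := @dominated_convergence _ _ _ mu setT measurableT F (G B) (G `[c, +oo[%classic) mF (mG B mB).
- apply: aeW => t _; apply: cvg_EFin; first exact: nearW.
  have [t0|t0] := leP t 0.
    rewrite indicE memNset; last by case; rewrite -in_setE inO ltNge t0.
    rewrite (_ : fine \o _ = fun=> 0); first exact: cvg_cst.
    apply/funext => n; rewrite /= indicE; have [/J0|_] := boolP (t \in J n); last by rewrite mulr0.
    by rewrite ltNge t0.
  rewrite indO//.
  apply: cvg_trans (fB (rt t)); apply: near_eq_cvg.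
  near=> n; rewrite /= indicE [t \in J n](_ : _ = true) ?mulr1// inJ; apply/andP; split.
    by apply/ltW; near: n; exact: near_harmonic_lt.
  apply: (lt_le_trans (truncnS_gt t)); rewrite ler_nat ltnS ltnW// ltnS.
  by near: n; exact: nbhs_infty_ge.
- apply/integrableP; split; first exact: mG.
  rewrite (eq_integral (G `[c, +oo[%classic)); last by move=> t _; rewrite /G gee0_abs// lee_fin.
  by rewrite occE// ltey_eq finc.
- apply: aeW => t n _; rewrite /F /G lee_fin ger0_norm ?mulr_ge0//.
  have [tJ|tJ] := boolP (t \in J n); last by rewrite [\1_(J n) t]indicE (negbTE tJ) mulr0.
  have t0 := J0 _ _ tJ.
  rewrite [\1_(J n) t]indicE tJ mulr1 (le_trans (fc n _))//.
  by rewrite indO.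
move=> _ _; rewrite occE// => h.
have E n : (\int[mu]_t F n t = \int[mu]_(t in J n) (f n (BM_ratio t w))%:E)%E.
  rewrite [RHS]integral_mkcond; apply: eq_integral => t _; rewrite patchE /F indicE.
  case: ifPn => tJ; last by rewrite mulr0.
  by rewrite mulr1 rtE//; exact: J0 tJ.
have -> : (fun n => limit_time W D (f n) n.+1%:R^-1 n.+2%:R w) = (fun n => fine (\int[mu]_t F n t)%E).
  by apply/funext => n; rewrite E.
by apply: fine_cvg; rewrite fineK.
Unshelve. all: by end_near.
Qed.

End OccupationTime.

                                     

(** * The scaled estimation error and its remainder *)

Section SampleMean.
Context (R : realType) (p : nat) (dist : 'cV[R]_p -> R).
Hypothesis hdist : is_distance dist.
Context d (T : measurableType d) (P : probability T R).
Variables (theta0 : 'cV[R]_p) (theta Z Rem : nat -> T -> 'cV[R]_p) (S : 'M[R]_p).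
Hypothesis htheta : forall n, (1 <= n)%N -> measurable_fun setT (theta n : T -> borelV R p).
Hypothesis hZiid : iid P (Z : nat -> T -> borelV R p).
Hypothesis hdecomp : forall n w, (1 <= n)%N ->
  theta n w - theta0 = S *m (n%:R^-1 *: \sum_(0 <= i < n) Z i w) + Rem n w.
Hypothesis hRem : cvg_in_probability0 P (fun m w =>
  ((Num.sqrt m%:R)%:E *
   ereal_sup [set (dist (Rem n w))%:E | n in [set n | (m <= n)%N]])%E).

Definition scaled_error (e : R) (n : nat) (w : T) : R := e^-1 * dist (theta n w - theta0).

Let mtheta n j : (1 <= n)%N -> measurable_fun setT (fun w => theta n w j 0).
Proof. by move=> n1; exact: (measurableT_comp (measurable_coord j) (htheta n1)). Qed.

Lemma measurable_scaled_error e n : (1 <= n)%N -> measurable_fun setT (scaled_error e n).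
Proof.
move=> n1; apply: measurable_funM => //; apply: (measurable_dist hdist) => j.
rewrite (_ : (fun w => _) = (fun w => theta n w j 0 - theta0 j 0)); last first.
  by apply/funext => w; rewrite !mxE.
by apply: measurable_funB => //; exact: mtheta.
Qed.

Lemma measurable_dist_remainder n : (1 <= n)%N -> measurable_fun setT (fun w => dist (Rem n w)).
Proof.
move=> n1; apply: (measurable_dist hdist) => j.
rewrite (_ : (fun w => _) = (fun w => theta n w j 0 - theta0 j 0 -
    \sum_k S j k * (n%:R^-1 * walk Z n k w))); last first.
  apply/funext => w; have -> : Rem n w = theta n w - theta0 - S *m (n%:R^-1 *: \sum_(0 <= i < n) Z i w).
    by rewrite hdecomp// addrAC subrr add0r.
  rewrite !mxE; congr (_ - _); apply: eq_bigr => k _.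
  by rewrite mxE summxE.
apply: measurable_funB; first by apply: measurable_funB => //; exact: mtheta.
apply: measurable_sum => k; apply: measurable_funM => //.
by apply: measurable_funM => //; exact: (measurable_walk hZiid).
Qed.

Lemma scaled_error_walk e n w : 0 < e -> (1 <= n)%N ->
  `|scaled_error e n w - distS dist S (fun j => (e * n%:R)^-1 * walk Z n j w)| <=
  e^-1 * dist (Rem n w).
Proof.
move=> e0 n1; have ei : 0 <= e^-1 by rewrite invr_ge0 ltW.
have -> : distS dist S (fun j => (e * n%:R)^-1 * walk Z n j w) =
    e^-1 * dist (S *m (n%:R^-1 *: \sum_(0 <= i < n) Z i w)).
  rewrite -[X in X * dist _](ger0_norm ei) -(dist_scale hdist) scalemxAr scalerA -invfM.
  by congr (dist (S *m _)); apply/colP => j; rewrite !mxE summxE.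
rewrite /scaled_error -mulrBr normrM (ger0_norm ei) ler_wpM2l// hdecomp//.
by rewrite (le_trans (norm_dist_sub hdist _ _))// addrAC subrr add0r.
Qed.

(** Let [m = gidx a e], so that [sqrt m * e > sqrt a]. If [dist (Rem n w) > e rho] for some
    [n >= m], then [sqrt m] times the supremum is at least [rho sqrt a], an event of small
    probability once [m] is large. *)
Lemma scaled_error_approx a rho eta : 0 < a -> 0 < rho -> 0 < eta ->
  \forall e \near 0^'+, exists A : set T, [/\ measurable A, Pr P A <= eta &
    forall w, ~ A w -> forall n, (gidx a e <= n)%N ->
      `|scaled_error e n w - distS dist S (fun j => (e * n%:R)^-1 * walk Z n j w)| <= rho].
Proof.
move=> a0 rho0 eta0; pose dl := rho * Num.sqrt a.
have dl0 : 0 < dl by rewrite mulr_gt0// sqrtr_gt0.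
have [M _ hM] : \forall m \near \oo, (P [set w | (dl%:E <= `|(Num.sqrt m%:R)%:E *
    ereal_sup [set (dist (Rem n w))%:E | n in [set n | (m <= n)%N]]|)%E] < eta%:E)%E.
  have nb : nbhs (0%E : \bar R) [set x | (x < eta%:E)%E].
    by apply: open_nbhs_nbhs; split; [exact: open_ereal_lt_ereal|rewrite /= lte_fin].
  have [M _ HM] := @hRem dl dl0 _ nb; exists M => // m Mm; exact: HM.
(* For these [e], [e^2 M <= e (M + 1) < a < e^2 m], whence [M <= m]. *)
apply: (@near0_right _ _ (Num.min 1 (a / M.+1%:R))).
  by rewrite lt_min ltr01 divr_gt0.
move=> e e0; rewrite lt_min => /andP[e1 eM].
have e20 : 0 < e ^+ 2 by rewrite exprn_gt0.
pose m := gidx a e.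
have mM : (M <= m)%N.
  rewrite -(ler_nat R) -(ler_pM2l e20) (le_trans _ (ltW (gidx_gt a e0)))//.
  apply: (@le_trans _ _ (e * M.+1%:R)); last by rewrite -ler_pdivlMr// ltW.
  by rewrite ler_pM ?ler_nat ?(ltW e20)// expr2 ler_piMl// ltW.
have m1 : (1 <= m)%N by [].
pose A := [set w | (dl%:E <= `|(Num.sqrt m%:R)%:E *
    ereal_sup [set (dist (Rem n w))%:E | n in [set n | (m <= n)%N]]|)%E].
have mA : measurable A.
  (* The shift makes every term measurable, since [hdecomp] starts at [n = 1]; it is invisible in a
     supremum over [n >= m >= 1]. *)
  pose f n w := (dist (Rem n.-1.+1 w))%:E.
  have mf n : measurable_fun setT (f n) by apply/measurable_EFinP/measurable_dist_remainder.
  have mg : measurable_fun setT (fun w => `|(Num.sqrt m%:R)%:E * esups (f ^~ w) m|)%E.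
    by apply: measurableT_comp => //; apply: measurable_funeM; exact: measurable_fun_esups.
  have := emeasurable_fun_c_infty measurableT mg dl%:E; rewrite setTI.
  congr measurable; apply/funext => w; congr (_ <= `|_ * ereal_sup _|)%E.
  apply/seteqP; split => _ [n /= mn <-]; exists n => //; rewrite /f prednK//; exact: leq_trans mn.
exists A; split=> //; first by rewrite -lee_fin -PrE//; apply/ltW/hM.
move=> w Aw n mn; have n1 : (1 <= n)%N by exact: leq_trans mn.
apply: (le_trans (scaled_error_walk w e0 n1)).
rewrite ler_pdivrMl// leNgt; apply/negP => hn; apply: Aw; rewrite /A /=.
have sm0 : 0 < Num.sqrt (m%:R : R) by rewrite sqrtr_gt0 ltr0n.
apply: (le_trans _ (lee_abs _)).
apply: (@le_trans _ _ ((Num.sqrt m%:R)%:E * (dist (Rem n w))%:E)%E); last first.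
  by rewrite lee_pmul2l// ?lte_fin//; apply: ereal_sup_ubound; exists n.
rewrite -EFinM lee_fin; apply: (@le_trans _ _ (Num.sqrt m%:R * (e * rho))); last first.
  by rewrite ler_pM2l// ltW.
rewrite /dl mulrC mulrA ler_pM2r//.
have -> : Num.sqrt m%:R * e = Num.sqrt (e ^+ 2 * m%:R).
  by rewrite sqrtrM ?ltW// sqrtr_sqr gtr0_norm// mulrC.
by rewrite ler_sqrt ?mulr_ge0 ?ltW// gidx_gt.
Qed.

End SampleMean.

(** * Late exceedances of the walk *)

Section WalkTail.
Context d (T : measurableType d) (R : realType) (P : probability T R).

(** Markov applied to the square of the sum: each of its [p^2] products has mean at most [s], by
    [|x y| <= (x^2 + y^2) / 2]. *)
Lemma chebyshev_norm1 (p : nat) (X : 'I_p -> T -> R) (s c : R) :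
  (forall j, measurable_fun setT (X j)) -> (forall j, L1 P (fun w => X j w ^+ 2)) ->
  (forall j, Ex P (fun w => X j w ^+ 2) <= s) -> 0 < c ->
  Pr P [set w | c <= \sum_j `|X j w|] <= p%:R ^+ 2 * s / c ^+ 2.
Proof.
move=> mX LX EX c0; have Lij i j : L1 P (fun w => `|X i w * X j w|).
  by apply: L1_abs; exact: L1_mul_sq.
pose f w := \sum_i \sum_j `|X i w * X j w|.
have fE w : f w = (\sum_j `|X j w|) ^+ 2.
  rewrite /f expr2 mulr_suml; apply: eq_bigr => i _.
  by rewrite mulr_sumr; apply: eq_bigr => j _; rewrite normrM.
have Lf : L1 P f by apply: L1_sum => i; exact: L1_sum.
have -> : [set w | c <= \sum_j `|X j w|] = [set w | c ^+ 2 <= f w].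
  by apply/seteqP; split => w /=; rewrite fE ler_pXn2r// nnegrE ?(ltW c0)// sumr_ge0.
apply: (le_trans (markov_ineq Lf _ _)); first by move=> w; rewrite fE sqr_ge0.
  by rewrite exprn_gt0.
rewrite ler_wpM2r ?invr_ge0 ?exprn_ge0 ?(ltW c0)// Ex_sum; last by move=> i; exact: L1_sum.
have hij i j : Ex P (fun w => `|X i w * X j w|) <= s.
  have L2 : L1 P (fun w => 2^-1 * (X i w ^+ 2 + X j w ^+ 2)) by apply/L1Z/L1D.
  have h w : `|X i w * X j w| <= 2^-1 * (X i w ^+ 2 + X j w ^+ 2).
    have := sqr_ge0 (`|X i w| - `|X j w|); rewrite sqrrB !real_normK ?num_real// normrM; lra.
  apply: (le_trans (le_Ex (Lij i j) L2 h)).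
  by rewrite ExZ ?ExD//; [have := EX i; have := EX j; lra|exact: L1D].
apply: (@le_trans _ _ (\sum_(i < p) \sum_(j < p) s)).
  by apply: ler_sum => i _; rewrite Ex_sum//; apply: ler_sum => j _.
have Es (x : R) : \sum_(i < p) x = p%:R * x by rewrite sumr_const card_ord mulr_natl.
by rewrite !Es mulrA -expr2.
Qed.

Lemma sum_inv_sqr_le (J M : nat) : (0 < J)%N ->
  \sum_(0 <= j < M) (((J + j).+1%:R ^+ 2)^-1 : R) <= J%:R^-1.
Proof.
move=> J0; suff : \sum_(0 <= j < M) (((J + j).+1%:R ^+ 2)^-1 : R) <= J%:R^-1 - (J + M)%:R^-1.
  by move=> /le_trans; apply; rewrite lerBlDr lerDl.
elim: M => [|M IH]; first by rewrite big_geq// addn0 subrr.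
rewrite big_nat_recr//= addnS; set x : R := (J + M)%:R.
have x0 : 0 < x by rewrite ltr0n addn_gt0 J0.
have xS : (J + M).+1%:R = x + 1 :> R by rewrite -natr1.
have h : ((x + 1) ^+ 2)^-1 <= x^-1 - (x + 1)^-1.
  have -> : x^-1 - (x + 1)^-1 = (x * (x + 1))^-1 by field; rewrite !gt_eqF//; lra.
  by rewrite lef_pV2 ?posrE ?expr2 ?mulr_gt0//; nra.
rewrite xS; move: IH; rewrite -/x; lra.
Qed.

Variables (p : nat) (Z : nat -> T -> 'cV[R]_p).
Hypothesis hZiid : iid P (Z : nat -> T -> borelV R p).
Hypothesis hZstd : forall i, standardized P (Z i).

Definition excess (kap e : R) (n : nat) (w : T) : R :=
  (kap * (e * n%:R) <= \sum_j `|walk Z n j w|)%R%:R.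

Let mind (A : T -> R) (c : R) : measurable_fun setT A -> L1 P (fun w => (c <= A w)%R%:R).
Proof.
move=> mA; apply: L1_ext (L1_indic P (measurable_le_cst c mA)) => w.
by rewrite indicE; congr (nat_of_bool _)%:R; apply/idP/idP; rewrite inE.
Qed.

Let Eind (A : T -> R) (c : R) : measurable_fun setT A -> Ex P (fun w => (c <= A w)%R%:R) = Pr P [set w | c <= A w].
Proof.
move=> mA; rewrite -Ex_indic; last exact: measurable_le_cst.
by apply: eq_Ex => w; rewrite indicE; congr (nat_of_bool _)%:R; apply/idP/idP; rewrite inE.
Qed.

Let mwalk1 n : measurable_fun setT (fun w => \sum_j `|walk Z n j w|).
Proof.
apply: measurable_sum => j; apply: (@measurableT_comp _ _ _ _ _ _ (fun x : R => `|x|)) => //.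
exact: (measurable_walk hZiid).
Qed.

Let mwalkB m n j : measurable_fun setT (fun w => walk Z n j w - walk Z m j w).
Proof. by apply: measurable_funB; exact: (measurable_walk hZiid). Qed.

Let mwalk1B m n : measurable_fun setT (fun w => \sum_j `|walk Z n j w - walk Z m j w|).
Proof.
by apply: measurable_sum => j; apply: (@measurableT_comp _ _ _ _ _ _ (fun x : R => `|x|)).
Qed.

Lemma measurable_excess kap e n : measurable_fun setT (excess kap e n).
Proof. exact: L1_measurable (mind _ (mwalk1 n)). Qed.

                                                                            
                                                                              
                                                               
(** Chebyshev at each index gives a probability of order [1 / (e^2 n)], and [e^2] times its sum
    diverges logarithmically. Hence blocks of Brownian times between consecutive squares [t j ^ 2].
    An exceedance at [n] in block [j] requires either a large walk at the block start, of
    probability [O(1 / t j ^ 2)], or a large increment since then, of probability [O(t j / t j ^ 4)]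
    over a block of length [O(t j)]. Both contributions are summable in [j], with tails of order
    [1 / J]. *)
Lemma walk_excess_blocks (kap zeta e : R) (J M : nat) :
  0 < kap -> 0 < zeta -> (0 < J)%N -> 0 < e -> e <= 1 ->
  Pr P [set w | zeta <= e ^+ 2 *
    \sum_(gidx (J.+1%:R ^+ 2) e <= n < gidx ((J + M).+1%:R ^+ 2) e) excess kap e n w] <=
  (4 * p%:R ^+ 2 / kap ^+ 2 + 48 * p%:R ^+ 2 / kap ^+ 2 / zeta) / J%:R.
Proof.
move=> kap0 zeta0 J0 e0 e1.
have e20 : 0 < e ^+ 2 by rewrite exprn_gt0.
have e21 : e ^+ 2 <= 1 by rewrite expr2 mulr_ile1// ltW.
pose t j : R := (J + j).+1%:R; pose nk j := gidx (t j ^+ 2) e.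
have t1 j : 1 <= t j by rewrite ler1n.
have tS j : t j.+1 = t j + 1 by rewrite /t addnS -natr1.
have t0 j : 0 < t j by exact: lt_le_trans (t1 j).
have nkS j : (nk j <= nk j.+1)%N.
  by apply: le_gidx => //; rewrite tS ler_pXn2r ?nnegrE ?addr_ge0 ?(ltW (t0 j))// lerDl.
pose C1 : R := p%:R ^+ 2 / kap ^+ 2.
have C10 : 0 <= C1 by rewrite divr_ge0 ?exprn_ge0// ltW.
pose bB j w : R := (kap * (e * (nk j)%:R) / 2 <= \sum_i `|walk Z (nk j) i w|)%R%:R.
pose bD j n w : R := (kap * (e * n%:R) / 2 <= \sum_i `|walk Z n i w - walk Z (nk j) i w|)%R%:R.
have LB j : L1 P (bB j) by exact: mind.
have LD j n : L1 P (bD j n) by exact: mind.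
have PB j : Ex P (bB j) <= 4 * C1 * (t j ^+ 2)^-1.
  have l1 := gidx_gt (t j ^+ 2) e0; set N : R := (nk j)%:R.
  have N0 : 0 < N by rewrite -(pmulr_rgt0 _ e20) (lt_trans _ l1)// exprn_gt0.
  rewrite Eind//.
  have := @chebyshev_norm1 p (walk Z (nk j)) N (kap * (e * N) / 2) (measurable_walk hZiid (nk j)).
  have h i := walk_sqr hZiid hZstd (nk j) i.
  move=> /(_ (fun i => proj1 (h i))) H; apply: (le_trans (H _ _)).
  - by move=> i; rewrite (proj2 (h i)).
  - by rewrite !mulr_gt0.
  have -> : p%:R ^+ 2 * N / (kap * (e * N) / 2) ^+ 2 = 4 * C1 * (e ^+ 2 * N)^-1.
    by rewrite /C1; field; rewrite !gt_eqF.
  apply: ler_wpM2l; first exact: mulr_ge0.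
  by rewrite lef_pV2 ?posrE ?mulr_gt0 ?exprn_gt0// ltW.
have PD j n : (nk j <= n < nk j.+1)%N -> Ex P (bD j n) <= 4 * C1 * ((2 * t j + 1) / t j ^+ 4).
  move=> /andP[jn nj]; have l1 := gidx_gt (t j ^+ 2) e0.
  have nN : (nk j)%:R <= n%:R :> R by rewrite ler_nat.
  have l2 : t j ^+ 2 < e ^+ 2 * n%:R by rewrite (lt_le_trans l1)// ler_pM2l.
  have N0 : (0 : R) < n%:R by rewrite -(pmulr_rgt0 _ e20) (lt_trans _ l2)// exprn_gt0.
  have l3 : e ^+ 2 * (n%:R - (nk j)%:R) <= 2 * t j + 1.
    have : e ^+ 2 * n.+1%:R <= t j.+1 ^+ 2 + e ^+ 2.
      apply: (le_trans _ (gidx_le (exprn_ge0 2 (ltW (t0 j.+1))) e0)).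
      by rewrite ler_pM2l// ler_nat.
    rewrite -natr1 mulrDr mulr1 lerD2r tS => l4; rewrite mulrBr.
    by move: l1 l4; rewrite -/(nk j); move: (e ^+ 2 * _) (e ^+ 2 * _) => x y; nra.
  rewrite Eind//.
  have := @chebyshev_norm1 p (fun i w => walk Z n i w - walk Z (nk j) i w) (n%:R - (nk j)%:R)
    (kap * (e * n%:R) / 2) (mwalkB (nk j) n).
  have h i := walk_increment_sqr hZiid hZstd i jn.
  move=> /(_ (fun i => proj1 (h i))) H; apply: (le_trans (H _ _)).
  - by move=> i; rewrite (proj2 (h i)) natrB.
  - by rewrite !mulr_gt0.
  have -> : p%:R ^+ 2 * (n%:R - (nk j)%:R) / (kap * (e * n%:R) / 2) ^+ 2 =
      4 * C1 * (e ^+ 2 * (n%:R - (nk j)%:R) * (e ^+ 2 * n%:R) ^- 2).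
    by rewrite /C1; field; rewrite !gt_eqF.
  apply: ler_wpM2l; first exact: mulr_ge0.
  apply: ler_pM => //.
  - by rewrite mulr_ge0 ?(ltW e20)// subr_ge0.
  - by rewrite invr_ge0 exprn_ge0// mulr_ge0// ltW.
  - rewrite lef_pV2 ?posrE ?exprn_gt0 ?mulr_gt0//.
    by rewrite -[4%N]/(2 * 2)%N exprM ler_pXn2r ?nnegrE ?exprn_ge0 ?mulr_ge0 ?ltW// ltW.
(* On the event of the statement [G >= 1]: either some block start is large, or every exceedance is
   due to an increment and their total time is at least [zeta]. Markov's inequality for [G] at level
   1 concludes. *)
pose G w := \sum_(0 <= j < M) bB j w +
  zeta^-1 * (e ^+ 2 * \sum_(0 <= j < M) \sum_(nk j <= n < nk j.+1) bD j n w).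
have b0 (b : bool) : (0 : R) <= b%:R by exact: ler0n.
have G0 w : 0 <= G w.
  apply: addr_ge0; first by apply: sumr_ge0.
  apply: mulr_ge0; first by rewrite invr_ge0 ltW.
  apply: mulr_ge0; first exact: ltW.
  by apply: sumr_ge0 => j _; apply: sumr_ge0.
have LS : L1 P (fun w => \sum_(0 <= j < M) bB j w) by exact: L1_sum.
have LT : L1 P (fun w => \sum_(0 <= j < M) \sum_(nk j <= n < nk j.+1) bD j n w).
  by apply: L1_sum => j; exact: L1_sum.
have LG : L1 P G by apply: L1D => //; exact/L1Z/L1Z.
have Jsum := sum_inv_sqr_le M J0.
have EB : \sum_(0 <= j < M) Ex P (bB j) <= 4 * C1 / J%:R.
  apply: (@le_trans _ _ (\sum_(0 <= j < M) 4 * C1 * (t j ^+ 2)^-1)); first by apply: ler_sum.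
  by rewrite -mulr_sumr; apply: ler_wpM2l => //; exact: mulr_ge0.
have ED : e ^+ 2 * (\sum_(0 <= j < M) \sum_(nk j <= n < nk j.+1) Ex P (bD j n)) <= 48 * C1 / J%:R.
  apply: (@le_trans _ _ (\sum_(0 <= j < M) 48 * C1 * (t j ^+ 2)^-1)); last first.
    by rewrite -mulr_sumr; apply: ler_wpM2l => //; exact: mulr_ge0.
  rewrite mulr_sumr; apply: ler_sum => j _.
  pose K := 4 * C1 * ((2 * t j + 1) / t j ^+ 4).
  have K0 : 0 <= K.
    apply: mulr_ge0; first exact: mulr_ge0.
    by rewrite divr_ge0 ?exprn_ge0 ?(ltW (t0 j))// addr_ge0// mulr_ge0// ltW.
  apply: (@le_trans _ _ (e ^+ 2 * (nk j.+1 - nk j)%:R * K)).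
    rewrite -mulrA ler_pM2l// mulr_natl -sumr_const_nat; apply: ler_sum_nat => n; exact: PD.
  have l1 := gidx_gt (t j ^+ 2) e0.
  have l2 := gidx_le (exprn_ge0 2 (ltW (t0 j.+1))) e0.
  have l3 : e ^+ 2 * (nk j.+1 - nk j)%:R <= 4 * t j.
    rewrite natrB// mulrBr; move: l1 l2; rewrite -/(nk j) -/(nk j.+1) tS.
    by move: (e ^+ 2 * _) (e ^+ 2 * _) (t1 j) => x y; nra.
  apply: (le_trans (ler_wpM2r K0 l3)).
  (* The constant is 4 (block length at most [4 t j]) times 4 (Chebyshev at half the threshold)
     times 3 (from [2 t j + 1 <= 3 t j]). *)
  have -> : 48 * C1 * (t j ^+ 2)^-1 = 4 * t j * (4 * C1 * (3 * t j / t j ^+ 4)).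
    by field; rewrite gt_eqF.
  apply: ler_wpM2l; first by rewrite mulr_ge0// ltW.
  apply: ler_wpM2l; first exact: mulr_ge0.
  by rewrite ler_wpM2r ?invr_ge0 ?exprn_ge0 ?(ltW (t0 j))//; have := t1 j; lra.
have EG : Ex P G <= (4 * p%:R ^+ 2 / kap ^+ 2 + 48 * p%:R ^+ 2 / kap ^+ 2 / zeta) / J%:R.
  rewrite /G ExD//; last exact/L1Z/L1Z.
  rewrite ExZ; last exact: L1Z.
  rewrite ExZ// Ex_sum//.
  have -> : Ex P (fun w => \sum_(0 <= j < M) \sum_(nk j <= n < nk j.+1) bD j n w) =
      \sum_(0 <= j < M) \sum_(nk j <= n < nk j.+1) Ex P (bD j n).
    by rewrite Ex_sum => [|j]; [apply: eq_bigr => j _; rewrite Ex_sum|exact: L1_sum].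
  have zi : 0 <= zeta^-1 by rewrite invr_ge0 ltW.
  apply: (le_trans (lerD EB (ler_wpM2l zi ED))).
  have -> // : 4 * C1 / J%:R + zeta^-1 * (48 * C1 / J%:R) =
    (4 * p%:R ^+ 2 / kap ^+ 2 + 48 * p%:R ^+ 2 / kap ^+ 2 / zeta) / J%:R.
  by rewrite /C1; field; rewrite !gt_eqF// ltr0n.
apply: (le_trans _ EG); rewrite -[leRHS]divr1.
apply: (le_trans _ (markov_ineq LG G0 ltr01)); apply: le_Pr.
- apply: measurable_le_cst; apply: measurable_funM => //.
  by apply: measurable_sum => n; exact: measurable_excess.
- by apply: measurable_le_cst; exact: L1_measurable LG.
move=> w /= hw.
have [[j jM hj]|nB] := pselect (exists2 j, (j < M)%N & bB j w = 1).
  rewrite /G (bigD1_seq j) ?mem_index_iota ?iota_uniq//= hj -addrA lerDl.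
  apply: addr_ge0; first by apply: sumr_ge0.
  apply: mulr_ge0; first by rewrite invr_ge0 ltW.
  apply: mulr_ge0; first exact: ltW.
  by apply: sumr_ge0 => i _; apply: sumr_ge0.
apply: (@le_trans _ _ (zeta^-1 * (e ^+ 2 * \sum_(0 <= j < M) \sum_(nk j <= n < nk j.+1) bD j n w))); last first.
  by rewrite lerDr; apply: sumr_ge0.
rewrite ler_pdivlMl// mulr1 (le_trans hw)// ler_pM2l//.
have -> : gidx (J.+1%:R ^+ 2) e = nk 0%N by rewrite /nk /t addn0.
rewrite -(sum_blocks nkS); apply: ler_sum_nat => j /andP[_ jM]; apply: ler_sum_nat => n /andP[jn _].
rewrite /excess /bD; have [h1|] := boolP (kap * (e * n%:R) <= _); last by rewrite b0.
have hm : \sum_i `|walk Z (nk j) i w| < kap * (e * (nk j)%:R) / 2.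
  by rewrite ltNge; apply/negP => hh; apply: nB; exists j => //; rewrite /bB hh.
have hn : kap * (e * (nk j)%:R) / 2 <= kap * (e * n%:R) / 2.
  by rewrite ler_pM2r// ler_pM2l// ler_pM2l// ler_nat.
have tri : \sum_i `|walk Z n i w| <= \sum_i `|walk Z n i w - walk Z (nk j) i w| + \sum_i `|walk Z (nk j) i w|.
  rewrite -big_split/=; apply: ler_sum => i _.
  by rewrite -{1}(subrK (walk Z (nk j) i w) (walk Z n i w)) ler_normD.
rewrite [X in _ <= (nat_of_bool X)%:R](_ : _ = true)//.
by move: h1 hm hn tri; set u := kap * _; lra.
Qed.

(** The event is the increasing union over [M] of those in [walk_excess_blocks], whose bound does
    not depend on [M] or [e]; continuity from below keeps it. One event therefore serves all [N]. *)
Lemma walk_excess_tail (kap zeta eta : R) : 0 < kap -> 0 < zeta -> 0 < eta ->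
  exists b0 : R, forall b e, b0 <= b -> 0 < e -> e <= 1 ->
    exists A : set T, [/\ measurable A, Pr P A <= eta &
      forall w, ~ A w -> forall N, e ^+ 2 * (\sum_(gidx b e <= n < N) excess kap e n w) <= zeta].
Proof.
move=> kap0 zeta0 eta0.
pose C := 4 * p%:R ^+ 2 / kap ^+ 2 + 48 * p%:R ^+ 2 / kap ^+ 2 / zeta.
pose J := (Num.truncn (C / eta)).+1.
have CJ : C / J%:R <= eta.
  by rewrite ler_pdivrMr ?ltr0n// mulrC -ler_pdivrMr//; apply/ltW/truncnS_gt.
exists (J.+1%:R ^+ 2) => b e b0 e0 e1; have e20 : 0 < e ^+ 2 by rewrite exprn_gt0.
pose nk j := gidx ((J + j).+1%:R ^+ 2) e.
pose E M := [set w | zeta <= e ^+ 2 * \sum_(gidx (J.+1%:R ^+ 2) e <= n < nk M) excess kap e n w].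
have mE M : measurable (E M).
  apply: measurable_le_cst; apply: measurable_funM => //.
  by apply: measurable_sum => n; exact: measurable_excess.
have nk0 M : (gidx (J.+1%:R ^+ 2) e <= nk M)%N.
  by apply: le_gidx => //; rewrite ler_pXn2r ?nnegrE// ler_nat ltnS leq_addr.
have nkm : {homo nk : i j / (i <= j)%N >-> (i <= j)%N}.
  by move=> i j ij; apply: le_gidx => //; rewrite ler_pXn2r ?nnegrE// ler_nat ltnS leq_add2l.
have sum_mono b1 m n w : (m <= n)%N -> (b1 <= m)%N ->
    \sum_(b1 <= i < m) excess kap e i w <= \sum_(b1 <= i < n) excess kap e i w.
  move=> mn bm; rewrite [leRHS](big_cat_nat (n := m))//= lerDl.
  by apply: sumr_ge0 => i _; exact: ler0n.
have ndE : nondecreasing_seq E.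
  move=> i j ij; apply/subsetPset => w /= /le_trans; apply.
  by rewrite ler_pM2l//; apply: sum_mono => //; exact: nkm.
have mA : measurable (\bigcup_M E M) by exact: bigcup_measurable.
exists (\bigcup_M E M); split=> //.
  rewrite -lee_fin -PrE//; have cv := nondecreasing_cvg_mu (mu := P) mE mA ndE.
  rewrite -(cvg_lim _ cv)//; apply: lime_le; first by apply/cvg_ex; eexists; exact: cv.
  apply: nearW => M /=; rewrite PrE// lee_fin.
  by apply: (le_trans (walk_excess_blocks M kap0 zeta0 _ e0 e1)).
move=> w nA N; rewrite leNgt; apply/negP => h; apply: nA; exists N => //=; apply/ltW/(lt_le_trans h).
rewrite ler_pM2l//.
have NN : (N <= nk N)%N.
  rewrite -(ler_nat R) -(ler_pM2l e20) (le_trans _ (ltW (gidx_gt _ e0)))//.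
  apply: (@le_trans _ _ N%:R); first by rewrite ler_piMl// expr2 mulr_ile1// ltW.
  apply: (@le_trans _ _ (J + N).+1%:R); first by rewrite ler_nat -addSn leq_addl.
  by rewrite expr2 ler_peMr// ler1n.
have [Nb|bN] := leqP N (gidx b e).
  by rewrite big_geq//; apply: sumr_ge0 => i _; exact: ler0n.
apply: (le_trans (sum_mono (gidx b e) N (nk N) w NN (ltnW bN))).
rewrite [leRHS](big_cat_nat (n := gidx b e))//=.
- by rewrite lerDr; apply: sumr_ge0 => i _; exact: ler0n.
- exact: le_gidx.
- by rewrite (leq_trans (ltnW bN)).
Qed.

End WalkTail.

                                    

Lemma Ex_ae_bounded_cvg d (T : measurableType d) (R : realType) (P : probability T R)
    (f_ : nat -> T -> R) (f : T -> R) (M : R) :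
  (forall n, measurable_fun setT (f_ n)) -> measurable_fun setT f ->
  (forall n w, `|f_ n w| <= M) ->
  {ae P, forall w, f_ n w @[n --> \oo] --> f w} ->
  Ex P (f_ n) @[n --> \oo] --> Ex P f.
Proof.
move=> mf_ mf fM cvgf.
have [] := @dominated_convergence _ _ _ P setT measurableT (fun n => EFin \o f_ n) (EFin \o f) (cst M%:E).
- by move=> n; exact/measurable_EFinP.
- exact/measurable_EFinP.
- by apply: filterS cvgf => w cw _; apply: cvg_EFin; [exact: nearW|exact: cw].
- exact: (L1_cst P M).
- by apply: aeW => w n _ /=; rewrite lee_fin.
move=> If _ cvgI; apply: fine_cvg; rewrite Ex_EFin// in cvgI.
Qed.

(** * Sandwiching the distribution function of the exceedance time *)

Section Sandwich.
Context d (T : measurableType d) (R : realType) (P : probability T R).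
Variables (p : nat) (Z : nat -> T -> 'cV[R]_p).
Hypothesis hZiid : iid P (Z : nat -> T -> borelV R p).
Hypothesis hZstd : forall i, standardized P (Z i).
Context d' (T' : measurableType d') (P' : probability T' R).
Variable W : R -> T' -> 'cV[R]_p.
Hypothesis hW : standard_BM_vector P' W.
Variables (D : ('I_p -> R) -> R) (Lc : R).
Hypothesis hD : lipschitz1 Lc D.
Hypothesis Lc0 : 0 < Lc.
Hypothesis D_scale : forall (a : R) x, D (fun j => a * x j) = `|a| * D x.
Hypothesis D_ge0 : forall x, 0 <= D x.
Variable Y : R -> nat -> T -> R.
Hypothesis mY : forall e n, (0 < n)%N -> measurable_fun setT (Y e n).
Hypothesis hY : forall a rho eta : R, 0 < a -> 0 < rho -> 0 < eta ->
  \forall e \near 0^'+, exists A : set T, [/\ measurable A, Pr P A <= eta &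
    forall w, ~ A w -> forall n, (gidx a e <= n)%N ->
      `|Y e n w - D (fun j => (e * n%:R)^-1 * walk Z n j w)| <= rho].

Definition exceeds (e : R) (n : nat) (w : T) : bool := (0 < n)%N && (1 <= Y e n w).

Definition exceedance_time (e : R) (w : T) : \bar R :=
  ((e ^+ 2)%:E * \sum_(0 <= n <oo) ((exceeds e n w)%:R)%:E)%E.

Let ind0 e n w : 0 <= (exceeds e n w)%:R :> R. Proof. exact: ler0n. Qed.

Lemma measurable_exceedance_time e : measurable_fun setT (exceedance_time e).
Proof.
apply: measurable_funeM; apply: ge0_emeasurable_sum => [n w _ _|n _]; first by rewrite lee_fin.
apply/measurable_EFinP; case: n => [|n].
  by rewrite (_ : (fun _ => _) = cst 0).
have := L1_measurable (L1_indic P (measurable_le_cst 1 (mY e (ltn0Sn n)))).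
congr measurable_fun; apply/funext => w; rewrite indicE /exceeds ltn0Sn/=.
by congr (nat_of_bool _)%:R; apply/idP/idP; rewrite inE.
Qed.

Lemma exceedance_time_ge e w (m N : nat) :
  ((e ^+ 2 * \sum_(m <= n < N) (exceeds e n w)%:R)%:E <= exceedance_time e w)%E.
Proof.
rewrite EFinM lee_wpmul2l ?lee_fin ?sqr_ge0//.
apply: (@le_trans _ _ (\sum_(0 <= n < N) ((exceeds e n w)%:R)%:E)%E); last first.
  by apply: nneseries_lim_ge => n _ _; rewrite lee_fin.
rewrite sumEFin lee_fin; have [mN|Nm] := leqP m N; last first.
  by rewrite big_geq ?(ltnW Nm)//; apply: sumr_ge0.
by rewrite [leRHS](big_cat_nat (n := m))//= lerDr sumr_ge0.
Qed.

Lemma exceedance_time_le e w (x : R) : 0 < e ->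
  (forall N, e ^+ 2 * \sum_(0 <= n < N) (exceeds e n w)%:R <= x) -> (exceedance_time e w <= x%:E)%E.
Proof.
move=> e0 h; have e20 : 0 < e ^+ 2 by rewrite exprn_gt0.
have -> : x%:E = ((e ^+ 2)%:E * ((e ^+ 2)^-1 * x)%:E)%E by rewrite -EFinM mulVKf// gt_eqF.
rewrite lee_pmul2l// ?lte_fin//; apply: lime_le.
  by apply: is_cvg_nneseries => n _ _; rewrite lee_fin.
by apply: nearW => N; rewrite sumEFin lee_fin ler_pdivlMl.
Qed.

Local Notation occ1 := (occupation W D `[1, +oo[).

Let q w : R := fine (occ1 w).

Let mocc B : measurable B -> measurable_fun setT (occupation W D B) := @measurable_occupation _ _ _ _ P' W hW D Lc hD B.

Let mq : measurable_fun setT q.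
Proof. by apply: measurableT_comp => //; apply: mocc. Qed.

Let mle (x : R) (f : T' -> R) : measurable_fun setT f -> measurable [set w | f w <= x].
Proof.
move=> mf; have := mf measurableT _ (measurable_itv `]-oo, x]).
by rewrite setTI; congr measurable; apply/seteqP; split => w /=; rewrite in_itv.
Qed.

Let mexc e x : measurable [set w | (exceedance_time e w <= x)%E].
Proof. by have := emeasurable_fun_infty_c measurableT (measurable_exceedance_time e) x; rewrite setTI. Qed.

Lemma Pr_occupation_fine (y : R) :
  Pr P' [set w | (occ1 w <= y%:E)%E] = Pr P' [set w | q w <= y].
Proof.
have mo : measurable [set w | (occ1 w <= y%:E)%E].
  by have := emeasurable_fun_infty_c measurableT (mocc (@measurable_itv _ `[1, +oo[)) y%:E; rewrite setTI.
rewrite -!Ex_indic//; last exact: mle.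
apply: Ex_ae_eq; [exact: measurable_indic|exact/measurable_indic/mle|].
apply: filterS (occupation_fin_num hW hD D_scale D_ge0 ltr01) => w fin.
rewrite !indicE; congr (nat_of_bool _)%:R; apply/idP/idP; rewrite !inE/= /q.
  by rewrite -lee_fin fineK.
by rewrite -lee_fin fineK.
Qed.

Let a_ (n : nat) : R := n.+1%:R^-1.
Let b_ (n : nat) : R := n.+2%:R.
Let a0 n : 0 < a_ n. Proof. by rewrite invr_gt0. Qed.
Let ab n : a_ n < b_ n.
Proof. by rewrite (@le_lt_trans _ _ 1)// ?invf_le1 ?ler1n// ltr1n. Qed.

(** Bounded convergence on top of [limit_time_cvg]. The set [B] may be the open or the closed
    half-line, since it enters only through an occupation time almost surely equal to that of [[1,
    +oo[]. *)
Let Ex_limit_cvg (B : set R) (c : R) (f : nat -> R -> R) (L : nat -> R) (g : R -> R) (Lg : R) :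
  measurable B -> 0 < c ->
  (forall n, 0 < L n) -> (forall n x y, `|f n x - f n y| <= L n * `|x - y|) ->
  (forall n x, 0 <= f n x <= 1) -> (forall n x, f n x <= \1_(`[c, +oo[%classic) x) ->
  (forall x, f n x @[n --> \oo] --> (\1_B x : R)) ->
  {ae P', forall w, occupation W D B w = occupation W D `[1, +oo[ w} ->
  (forall x y, `|g x - g y| <= Lg * `|x - y|) -> (forall x, 0 <= g x <= 1) ->
  Ex P' (fun w => g (limit_time W D (f n) (a_ n) (b_ n) w)) @[n --> \oo] --> Ex P' (fun w => g (q w)).
Proof.
move=> mB c0 L0 fL f01 fc fB occB gL g01.
have mg := lipschitz_measurable gL.
apply: (@Ex_ae_bounded_cvg _ _ _ _ _ _ 1).
- by move=> n; apply: measurableT_comp => //; exact: (measurable_limit_time hW hD (L0 n) (fL n) (f01 n)).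
- exact: measurableT_comp.
- by move=> n w; have /andP[h1 h2] := g01 (limit_time W D (f n) (a_ n) (b_ n) w); rewrite ger0_norm.
apply: filterS3 occB (occupation_fin_num hW hD D_scale D_ge0 c0) (occupation_fin_num hW hD D_scale D_ge0 ltr01).
move=> w E finc fin1.
have cg : continuous g.
  move=> x; apply: (@lipschitz1_cvg R unit R (nbhs x) _ Lg (fun x => g (x tt)) (fun y _ => y) (fun=> x)) => //.
  by move=> u v; rewrite (eq_bigl (pred1 tt)) ?big_pred1_eq ?gL//; case.
apply: (cvg_comp (fun n => limit_time W D (f n) (a_ n) (b_ n) w) g); last exact: cg.
rewrite /q -E; apply: (limit_time_cvg hW hD mB _ _ fc fB finc); last by rewrite E.
  by move=> n; exact: lipschitz_measurable (fL n).
by move=> n x; have /andP[] := f01 n x.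
Qed.

Let one_sub_ramp (u v : R) : u < v ->
  [/\ 0 < (v - u)^-1,
      forall x y, `|(1 - ramp u v x) - (1 - ramp u v y)| <= (v - u)^-1 * `|x - y|
    & forall x, 0 <= 1 - ramp u v x <= 1].
Proof.
move=> uv; split; first by rewrite invr_gt0 subr_gt0.
  by move=> x y; rewrite opprB addrC addrA subrK distrC (le_trans (ramp_lipschitz _ _ uv))// distrC.
by move=> x; have := ramp01 u v x; lra.
Qed.

(** A ramp above level 1 lies below the indicator, and dropping the early and late indices only
    decreases the sum, so the exceedance time dominates [late_count]. These ramps tend to the
    indicator of []1, +oo[], which [occupation_gt_ge] identifies with the closed case in the
    limit. *)
Lemma exceedance_time_upper (x xi eta : R) : 0 < xi -> 0 < eta ->
  \forall e \near 0^'+, Pr P [set w | (exceedance_time e w <= x%:E)%E] <= Pr P' [set w | q w <= x + xi] + eta.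
Proof.
move=> xi0 eta0; have xxi : x < x + xi by rewrite ltrDl.
have [Lg0 gL g01] := one_sub_ramp xxi; set g := (fun y => 1 - ramp x (x + xi) y) in gL g01.
pose f (n : nat) : R -> R := ramp 1 (1 + n.+1%:R^-1).
have un n : (1 : R) < 1 + n.+1%:R^-1 by rewrite ltrDl.
have L0 (n : nat) : (0 : R) < (1 + n.+1%:R^-1 - 1)^-1 by rewrite invr_gt0 subr_gt0.
have fL n u v := ramp_lipschitz u v (un n).
have f01 n u : 0 <= f n u <= 1 by exact: ramp01.
have fc n u : f n u <= \1_(`[1, +oo[%classic) u.
  rewrite (le_trans (ramp_le_indic _ (un n)))// !indicE !mem_setE !in_itv/= !andbT ler_nat.
  by case: (ltP 1 u) => // /ltW ->.
have := @Ex_limit_cvg `]1, +oo[%classic 1 f _ g _ (@measurable_itv _ _) ltr01 L0 fL f01 fc (@ramp_cvg_gt R 1)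
  (occupation_gt_ge hW hD D_scale D_ge0 ltr01) gL g01.
have eta2 : 0 < eta / 2 by rewrite divr_gt0.
move=> /cvgrPdist_lt/(_ _ eta2)/filter_ex[n hn].
have /cvgrPdist_lt/(_ _ eta2) h2 := late_count_cvg hZiid hZstd hW hD Lc0 mY hY (L0 n) (fL n) (f01 n) Lg0 gL g01 (a0 n) (ab n).
near=> e; have e0 : 0 < e by near: e; exact: nbhs_right_gt.
have h3 : `|Ex P' (fun w => g (limit_time W D (f n) (a_ n) (b_ n) w)) -
    Ex P (fun w => g (late_count Y (f n) (a_ n) (b_ n) e w))| < eta / 2 by near: e.
have gq : Ex P' (fun w => g (q w)) <= Pr P' [set w | q w <= x + xi].
  rewrite -Ex_indic; last exact: mle.
  apply: le_Ex; last first.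
  - move=> w; rewrite indicE; have [_|] := boolP (w \in _); first by have /andP[] := g01 (q w).
    by rewrite notin_setE/= => /negP; rewrite -ltNge => /ltW h; rewrite /g ramp_eq1// subrr.
  - exact/L1_indic/mle.
  - apply: (@L1_bounded _ _ _ _ _ 1); first exact: measurableT_comp (lipschitz_measurable gL) mq.
    by move=> w; have /andP[? ?] := g01 (q w); rewrite ger0_norm.
have gV : Pr P [set w | (exceedance_time e w <= x%:E)%E] <= Ex P (fun w => g (late_count Y (f n) (a_ n) (b_ n) e w)).
  rewrite -Ex_indic//; apply: le_Ex; first exact: L1_indic.
    apply: (@L1_bounded _ _ _ _ _ 1).
      exact: measurableT_comp (lipschitz_measurable gL) (measurable_late_count mY (fL n) _ _ e).
    by move=> w; have /andP[? ?] := g01 (late_count Y (f n) (a_ n) (b_ n) e w); rewrite ger0_norm.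
  move=> w; rewrite indicE; have [|_] := boolP (w \in _); last by have /andP[] := g01 (late_count Y (f n) (a_ n) (b_ n) e w).
  rewrite inE/= => hx; rewrite /g ramp_eq0 ?subr0// -lee_fin (le_trans _ hx)//.
  apply: (le_trans _ (exceedance_time_ge e w (gidx (a_ n) e) (gidx (b_ n) e))).
  rewrite lee_fin /late_count ler_pM2l ?exprn_gt0//; apply: ler_sum_nat => k /andP[k1 _].
  have k0 : (0 < k)%N by exact: leq_trans k1.
  rewrite /exceeds k0/=; have := fc n (Y e k w); rewrite indicE mem_setE in_itv/= andbT.
  exact.
move: hn h3; rewrite !ltr_norml; lra.
Unshelve. all: by end_near.
Qed.

Let D_le x : D x <= Lc * \sum_j `|x j|.
Proof.
have D0 : D (fun=> 0) = 0.
  by rewrite -[RHS](mul0r (D (fun=> 0))) -[X in X * _](normr0 R) -D_scale; congr D; apply/funext => j; rewrite mul0r.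
have := hD x (fun=> 0); rewrite D0 subr0 => /(le_trans (ler_norm _)).
by rewrite (eq_bigr (fun j => `|x j|))// => j _; rewrite subr0.
Qed.

(** If [Y >= 1] is within [1 / 2] of [D] at the scaled walk, then [D >= 1 / 2]; the Lipschitz bound
    at 0 gives the threshold [(2 Lc)^-1]. *)
Let exceeds_excess e n w : 0 < e -> (0 < n)%N ->
  `|Y e n w - D (fun j => (e * n%:R)^-1 * walk Z n j w)| <= 2^-1 ->
  (exceeds e n w)%:R <= excess Z ((2 * Lc)^-1) e n w.
Proof.
move=> e0 n0 hn; rewrite /exceeds n0/=; have [Y1|_] := leP 1 (Y e n w); last exact: ler0n.
have en0 : 0 < e * n%:R by rewrite mulr_gt0// ltr0n.
have := D_le (fun j => (e * n%:R)^-1 * walk Z n j w).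
have -> : \sum_j `|(e * n%:R)^-1 * walk Z n j w| = (e * n%:R)^-1 * \sum_j `|walk Z n j w|.
  by rewrite mulr_sumr; apply: eq_bigr => j _; rewrite normrM gtr0_norm// invr_gt0.
move=> h; have h2 : 2^-1 <= Lc * ((e * n%:R)^-1 * \sum_j `|walk Z n j w|).
  apply: le_trans h; move: hn; rewrite ler_norml; lra.
rewrite /excess [X in _ <= (nat_of_bool X)%:R](_ : _ = true)//.
move: h2; rewrite mulrCA ler_pdivlMl// -ler_pdivrMl// => h2.
rewrite (_ : (2 * Lc)^-1 * (e * n%:R) = Lc^-1 * (e * n%:R / 2))//.
by move: (e * n%:R) => z; field; rewrite gt_eqF.
Qed.

(** A ramp below level 1 lies above the indicator, so the middle indices contribute at most
    [late_count]. The early ones weigh at most [a + e^2], and off two small events the late ones are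
    bounded by [walk_excess_tail]. *)
Lemma exceedance_time_lower (x xi eta : R) : 0 < xi -> 0 < eta ->
  \forall e \near 0^'+, Pr P' [set w | q w <= x - xi] - eta <= Pr P [set w | (exceedance_time e w <= x%:E)%E].
Proof.
(* The ramp stops at [x - xi / 2], which leaves [xi / 4] for the early indices and [xi / 4] for the
   late ones. *)
move=> xi0 eta0; have xxi : x - xi < x - xi / 2 by lra.
have [Lg0 gL g01] := one_sub_ramp xxi; set g := (fun y => 1 - ramp (x - xi) (x - xi / 2) y) in gL g01.
(* Starting from [n.+2] keeps every ramp supported in [[1/2, +oo[], so the occupation time at level
   [1/2] dominates. *)
pose f (n : nat) : R -> R := ramp (1 - n.+2%:R^-1) 1.
have un n : (1 : R) - n.+2%:R^-1 < 1 by rewrite ltrBlDr ltrDl.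
have L0 (n : nat) : (0 : R) < (1 - (1 - n.+2%:R^-1))^-1 by rewrite invr_gt0 subr_gt0.
have fL n u v := ramp_lipschitz u v (un n).
have f01 n u : 0 <= f n u <= 1 by exact: ramp01.
have fc n u : f n u <= \1_(`[2^-1, +oo[%classic) u.
  rewrite (le_trans (ramp_le_indic _ (un n)))// !indicE !mem_setE !in_itv/= !andbT ler_nat.
  have i2 : n.+2%:R^-1 <= 2^-1 :> R by rewrite lef_pV2 ?posrE// ler_nat.
  case: (ltP (1 - n.+2%:R^-1) u) => // h; rewrite (_ : 2^-1 <= u)//.
  by move: i2 h; move: (n.+2%:R^-1) => z; lra.
have fcvg u : f n u @[n --> \oo] --> (\1_(`[1, +oo[%classic) u : R).
  have := @ramp_cvg_ge R 1 u; rewrite -cvg_shiftS; exact.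
have half0 : (0 : R) < 2^-1 by rewrite invr_gt0.
have := @Ex_limit_cvg `[1, +oo[%classic 2^-1 f _ g _ (@measurable_itv _ _) half0 L0 fL f01 fc fcvg
  (aeW _ (fun w => erefl)) gL g01.
have eta4 : 0 < eta / 4 by rewrite divr_gt0.
have xi4 : 0 < xi / 4 by rewrite divr_gt0.
have xi8 : 0 < xi / 8 by rewrite divr_gt0.
have kap0 : 0 < (2 * Lc)^-1 by rewrite invr_gt0 mulr_gt0.
have [bb hb] := walk_excess_tail hZiid hZstd kap0 xi4 eta4.
move=> /cvgrPdist_lt/(_ _ eta4) hE.
have [n [hn [an bn]]] : exists n : nat, `|Ex P' (fun w => g (q w)) -
    Ex P' (fun w => g (limit_time W D (f n) (a_ n) (b_ n) w))| < eta / 4 /\ (a_ n < xi / 8 /\ bb <= b_ n).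
  have hB : \forall n \near \oo, bb <= b_ n.
    exists (Num.truncn bb) => // n /= bn; rewrite (le_trans (ltW (truncnS_gt bb)))// ler_nat.
    by rewrite ltnS ltnW.
  exact: (filter_ex (filterI hE (filterI (near_harmonic_lt xi8) hB))).
have /cvgrPdist_lt/(_ _ eta4) h2 := late_count_cvg hZiid hZstd hW hD Lc0 mY hY (L0 n) (fL n) (f01 n) Lg0 gL g01 (a0 n) (ab n).
have bn0 : 0 < b_ n by exact: lt_trans (ab n).
near=> e; have e0 : 0 < e by near: e; exact: nbhs_right_gt.
have e1 : e <= 1 by near: e; exact: nbhs_right_le.
have ex : e <= xi / 8 by near: e; exact: nbhs_right_le.
have h3 : `|Ex P' (fun w => g (limit_time W D (f n) (a_ n) (b_ n) w)) -
    Ex P (fun w => g (late_count Y (f n) (a_ n) (b_ n) e w))| < eta / 4 by near: e.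
have [A1 [mA1 PA1 hA1]] := hb _ _ bn e0 e1.
have [A2 [mA2 PA2 hA2]] : exists A : set T, [/\ measurable A, Pr P A <= eta / 4 &
    forall w, ~ A w -> forall k, (gidx (b_ n) e <= k)%N ->
      `|Y e k w - D (fun j => (e * k%:R)^-1 * walk Z k j w)| <= 2^-1].
  by near: e; exact: hY.
have e20 : 0 < e ^+ 2 by rewrite exprn_gt0.
have e2e : e ^+ 2 <= e by rewrite expr2 ler_piMl// ltW.
have gq : Pr P' [set w | q w <= x - xi] <= Ex P' (fun w => g (q w)).
  rewrite -Ex_indic; last exact: mle.
  apply: le_Ex; first exact/L1_indic/mle.
    apply: (@L1_bounded _ _ _ _ _ 1); first exact: measurableT_comp (lipschitz_measurable gL) mq.
    by move=> w; have /andP[? ?] := g01 (q w); rewrite ger0_norm.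
  move=> w; rewrite indicE; have [|_] := boolP (w \in _); last by have /andP[] := g01 (q w).
  by rewrite inE/= => h; rewrite /g ramp_eq0// subr0.
have LV : L1 P (fun w => g (late_count Y (f n) (a_ n) (b_ n) e w)).
  apply: (@L1_bounded _ _ _ _ _ 1).
    exact: measurableT_comp (lipschitz_measurable gL) (measurable_late_count mY (fL n) _ _ e).
  by move=> w; have /andP[? ?] := g01 (late_count Y (f n) (a_ n) (b_ n) e w); rewrite ger0_norm.
have gV : Ex P (fun w => g (late_count Y (f n) (a_ n) (b_ n) e w)) <=
    Pr P [set w | (exceedance_time e w <= x%:E)%E] + Pr P A1 + Pr P A2.
  rewrite -!Ex_indic// -ExD; [|exact: L1_indic|exact: L1_indic].
  rewrite -ExD; [|by apply: L1D; exact: L1_indic|exact: L1_indic].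
  apply: le_Ex => //; first by apply: L1D; [apply: L1D; exact: L1_indic|exact: L1_indic].
  move=> w; set V := late_count _ _ _ _ _ _; have /andP[g0 g1] := g01 V.
  have i0 (A : set T) : 0 <= \1_A w :> R by rewrite indicE.
  have [wA1|wA1] := boolP (w \in A1).
    by rewrite [\1_A1 w]indicE wA1 (le_trans g1)// -addrA addrCA lerDl addr_ge0.
  have [wA2|wA2] := boolP (w \in A2).
    by rewrite [\1_A2 w]indicE wA2 (le_trans g1)// lerDr addr_ge0.
  have [xV|Vx] := leP (x - xi / 2) V.
    by rewrite /g ramp_eq1// subrr !addr_ge0.
  rewrite (le_trans g1)// -addrA [\1__ w]indicE mem_set ?lerDl ?addr_ge0//=.
  have nA1 : ~ A1 w by move: wA1; rewrite notin_setE.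
  have nA2 : ~ A2 w by move: wA2; rewrite notin_setE.
  apply: exceedance_time_le => // N.
  set ga := gidx (a_ n) e; set gb := gidx (b_ n) e.
  have gab : (ga <= gb)%N by apply: le_gidx => //; exact/ltW/ab.
  have S1 : e ^+ 2 * \sum_(0 <= k < ga) (exceeds e k w)%:R <= xi / 4.
    apply: (@le_trans _ _ (e ^+ 2 * ga%:R)).
      rewrite ler_pM2l//; apply: (@le_trans _ _ (\sum_(0 <= k < ga) 1)).
        by apply: ler_sum => k _; rewrite lern1 leq_b1.
      by rewrite sumr_const_nat subn0.
    rewrite (le_trans (gidx_le (ltW (a0 n)) e0))//.
    by move: an ex e2e; lra.
  have S2 : e ^+ 2 * \sum_(ga <= k < gb) (exceeds e k w)%:R <= V.
    rewrite ler_pM2l//; apply: ler_sum_nat => k /andP[ak _].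
    have k0 : (0 < k)%N by exact: leq_trans ak.
    rewrite /exceeds k0/=; have [Y1|_] := leP 1 (Y e k w); first by rewrite /f ramp_eq1.
    by have /andP[] := f01 n (Y e k w).
  (* The bound [maxn N gb] covers the case where [N] falls before the late range. *)
  have S3 : e ^+ 2 * \sum_(gb <= k < maxn N gb) (exceeds e k w)%:R <= xi / 4.
    apply: le_trans (hA1 w nA1 (maxn N gb)); rewrite ler_pM2l//; apply: ler_sum_nat => k /andP[bk _].
    by apply: exceeds_excess => //; [exact: leq_trans bk|exact: hA2].
  apply: (@le_trans _ _ (e ^+ 2 * \sum_(0 <= k < maxn N gb) (exceeds e k w)%:R)).
    rewrite ler_pM2l// [leRHS](big_cat_nat (n := N)) ?leq_maxl//= lerDl.
    by apply: sumr_ge0.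
  rewrite (big_cat_nat (n := gb)) ?leq_maxr//= (big_cat_nat (n := ga))//= !mulrDr.
  by move: S1 S2 S3 Vx; lra.
move: hn h3; rewrite !ltr_norml; lra.
Unshelve. all: by end_near.
Qed.

Lemma exceedance_time_cvg (X : R -> T -> \bar R) :
  (forall e, 0 < e -> X e = exceedance_time e) ->
  cvg_in_distribution P P' (0^'+ : set_system R) X occ1.
Proof.
move=> XE; split.
- by apply: (near0_right ltr01) => e e0 _; rewrite XE//; exact: measurable_exceedance_time.
- exact: mocc.
- exact: (occupation_fin_num hW hD D_scale D_ge0 ltr01).
move=> x cx; pose G (y : R) := Pr P' [set w | q w <= y].
have mo y : measurable [set w | (occ1 w <= y%:E)%E].
  by have := emeasurable_fun_infty_c measurableT (mocc (@measurable_itv _ `[1, +oo[)) y%:E; rewrite setTI.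
have GE y : P' [set w | (occ1 w <= y%:E)%E] = (G y)%:E by rewrite PrE// Pr_occupation_fine.
have cG : G y @[y --> x] --> G x.
  have := cx; rewrite /prop_for /continuous_at GE => /fine_cvg.
  by rewrite (_ : fine \o _ = G)//; apply/funext => y /=; rewrite GE.
rewrite GE; apply: cvg_EFin.
  by apply: (near0_right ltr01) => e e0 _; rewrite XE// PrE.
apply/cvgrPdist_lt => /= eta eta0; have eta2 : 0 < eta / 2 by rewrite divr_gt0.
have /cvgrPdist_lt/(_ _ eta2)/nbhs_ballP[dl /= dl0 hdl] := cG.
have xi0 : 0 < dl / 2 by rewrite divr_gt0.
have h1 : `|G x - G (x + dl / 2)| < eta / 2.
  by apply: hdl; rewrite /ball/= opprD addrA subrr sub0r normrN gtr0_norm// ltr_pdivrMr// ltr_pMr// ltr1n.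
have h2 : `|G x - G (x - dl / 2)| < eta / 2.
  by apply: hdl; rewrite /ball/= opprB addrCA subrr addr0 gtr0_norm// ltr_pdivrMr// ltr_pMr// ltr1n.
near=> e; have e0 : 0 < e by near: e; exact: nbhs_right_gt.
rewrite XE// -/(Pr P _).
have u1 : Pr P [set w | (exceedance_time e w <= x%:E)%E] <= G (x + dl / 2) + eta / 2.
  by near: e; exact: exceedance_time_upper.
have u2 : G (x - dl / 2) - eta / 2 <= Pr P [set w | (exceedance_time e w <= x%:E)%E].
  by near: e; exact: exceedance_time_lower.
move: h1 h2 u1 u2; rewrite !ltr_norml; lra.
Unshelve. all: by end_near.
Qed.

End Sandwich.

(** * Identification of the count, of the limit and of its mean *)

Section QcountQlimit.
Context (R : realType) (p : nat) (dist : 'cV[R]_p -> R).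
Hypothesis hdist : is_distance dist.

Lemma QcountE d (T : measurableType d) (theta : nat -> T -> 'cV[R]_p) (theta0 : 'cV[R]_p) (e : R) :
  0 < e -> (fun w => ((e ^+ 2)%:E * Qcount dist theta theta0 e w)%E) =
  exceedance_time (scaled_error dist theta0 theta) e.
Proof.
move=> e0; apply/funext => w; rewrite /exceedance_time /Qcount counting_dirac.
congr (_ * _)%E; apply: eq_eseriesr => n _; rewrite diracE; congr (_%:R%:E).
congr nat_of_bool; apply/idP/idP; rewrite inE/= /exceeds /scaled_error ler_pdivlMl// mulr1.
  by case=> -> ->.
by move=> /andP[].
Qed.

Lemma QlimitE d (T : measurableType d) (S : 'M[R]_p) (W : R -> T -> 'cV[R]_p) :
  Qlimit dist S W = occupation W (distS dist S) `[1, +oo[.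
Proof.
apply/funext => w; congr (lebesgue_measure _).
have E t : BM_ratio W (distS dist S) t w = dist (t^-1 *: (S *m W t w)).
  rewrite /BM_ratio /distS scalemxAr; congr (dist (S *m _)).
  by apply/colP => j; rewrite !mxE.
apply/seteqP; split => t /= [].
  (* At [t = 0] the inverse is 0, so the distance is 0 and the time is excluded from both sets. *)
  rewrite le_eqVlt => /predU1P[<-|t0 h]; last by split=> //; rewrite in_itv/= andbT E.
  by rewrite invr0 scale0r (dist0 hdist) ler10.
by move=> t0; rewrite in_itv/= andbT E; split=> //; exact: ltW.
Qed.

Lemma quadform_mulmx (A S : 'M[R]_p) (v : 'cV[R]_p) :
  quadform A (S *m v) = \sum_i \sum_j (S^T *m A *m S) i j * (v i 0 * v j 0).
Proof.
have -> : quadform A (S *m v) = (v^T *m (S^T *m A *m S) *m v) 0 0.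
  by rewrite /quadform trmx_mul !mulmxA.
rewrite mxE exchange_big/=; apply: eq_bigr => j _.
by rewrite mxE mulr_suml; apply: eq_bigr => i _; rewrite !mxE; ring.
Qed.

Lemma Ex_quadform_BMV d (T : measurableType d) (P : probability T R) (W : R -> T -> 'cV[R]_p)
    (A S : 'M[R]_p) : standard_BM_vector P W ->
  Ex P (fun w => quadform A (S *m W 1 w)) = \tr (S^T *m A *m S).
Proof.
move=> hW; set M := S^T *m A *m S.
have L i j : L1 P (fun w => M i j * (W 1 w i 0 * W 1 w j 0)).
  by apply: L1Z; exact: (proj1 (BMV_cross_moment hW i j ltr01)).
rewrite (eq_Ex P (fun w => quadform_mulmx A S (W 1 w))) Ex_sum; last by move=> i; exact: L1_sum.
apply: eq_bigr => i _; rewrite Ex_sum// (bigD1 i)//= big1 => [|j ji]; rewrite ExZ;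
  try exact: (proj1 (BMV_cross_moment hW _ _ ltr01)).
  by rewrite (proj2 (BMV_cross_moment hW i i ltr01)) eqxx !mulr1 addr0.
by rewrite (proj2 (BMV_cross_moment hW i j ltr01)) eq_sym (negbTE ji) !mulr0.
Qed.

End QcountQlimit.

Theorem mainTheorem6 (R : realType) (p : nat)
    (dist : 'cV[R]_p -> R) (hdist : is_distance dist)
    (d : measure_display) (T : measurableType d) (P : probability T R)
    (theta0 : 'cV[R]_p) (theta : nat -> T -> 'cV[R]_p)
    (Z : nat -> T -> 'cV[R]_p) (Rem : nat -> T -> 'cV[R]_p)
    (Sigma0 S : 'M[R]_p)
    (d' : measure_display) (T' : measurableType d') (P' : probability T' R)
    (W : R -> T' -> 'cV[R]_p)
    (htheta : forall n, (1 <= n)%N ->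
      measurable_fun setT (theta n : T -> borelV R p))
    (hSigma0 : symm_nonneg_def Sigma0) (hS : is_symm_sqrt S Sigma0)
    (hZiid : iid P (Z : nat -> T -> borelV R p))
    (hZstd : forall i, standardized P (Z i))
    (hdecomp : forall n w, (1 <= n)%N ->
      theta n w - theta0 =
        S *m (n%:R^-1 *: \sum_(0 <= i < n) Z i w) + Rem n w)
    (hRem : cvg_in_probability0 P (fun m w =>
      ((Num.sqrt m%:R)%:E *
       ereal_sup [set (dist (Rem n w))%:E | n in [set n | (m <= n)%N]])%E))
    (hW : standard_BM_vector P' W) :
  cvg_in_distribution P P' (0^'+ : set_system R)
    (fun eps w => ((eps ^+ 2)%:E * Qcount dist theta theta0 eps w)%E)
    (Qlimit dist S W)
  /\ (forall A : 'M[R]_p, symm_pos_def A ->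
      (forall x y : 'cV[R]_p, dist (x - y) = Num.sqrt (quadform A (x - y))) ->
      (\int[P']_w Qlimit dist S W w)%E = (\tr (A *m Sigma0))%:E).
Proof.
have [Lc Lc0 hD] := distS_lipschitz hdist S.
have D_scale := distSZ hdist S; have D_ge0 := distS_ge0 hdist S.
have QL := QlimitE hdist S W.
split.
  rewrite QL; apply: (exceedance_time_cvg hZiid hZstd hW hD Lc0 D_scale D_ge0
    (Y := scaled_error dist theta0 theta)).
  - by move=> e n n0; exact: (measurable_scaled_error hdist theta0 htheta).
  - by move=> a rho eta; exact: (scaled_error_approx hdist htheta hZiid hdecomp hRem).
  - by move=> e e0; exact: QcountE.
move=> A [_ Apos] distA.
have dist2 x : dist x ^+ 2 = quadform A x.
  have := distA x 0; rewrite subr0 => ->; rewrite sqr_sqrtr//.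
  have [->|/Apos/ltW//] := eqVneq x 0.
  by rewrite /quadform mulmx0 mxE.
have [[/is_hermitianmxP ST _] SS] := hS.
(* At level 1 the expected occupation time is the mean of [dist (S *m W 1)^2], a quadratic form in a
   vector with identity covariance. *)
rewrite QL (integral_occupation_ge hW hD D_scale D_ge0 ltr01).
have ratioE w : (1 ^+ 2)^-1 * BM_ratio W (distS dist S) 1 w ^+ 2 = quadform A (S *m W 1 w).
  rewrite expr1n invr1 mul1r -dist2 -(distS_col dist); congr (distS _ _ _ ^+ 2).
  by apply/funext => j; rewrite invr1 mul1r.
have LQ := L1_ratio_sqr hW hD D_scale D_ge0.
rewrite Ex_EFin; last exact: L1Z.
rewrite (eq_Ex P' ratioE) (Ex_quadform_BMV A S hW); congr EFin.
have -> : S^T = S by rewrite {2}ST expr0 scale1r map_mx_id.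
by rewrite -mulmxA mxtrace_mulC -mulmxA SS.
Qed.
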